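(* Let $\mathcal{X}=(X,r,\rho,\mu)$ and $\mathcal{X}_n=(X_n,r_n,\rho_n,\mu_n)$, $n\in\mathbb{N}$, be metric boundedly finite measure spaces. Then the following are equivalent. (1) $(\mathcal{X}_n)_{n\in\mathbb{N}}$ converges in Gromov-vague topology to $\mathcal{X}$, and for all $\delta>0$ and $R>0$, $\liminf_{n\to\infty}\mathfrak{m}^R_\delta(\mathcal{X}_n)>0$. (2) $\operatorname{supp}(\mu)$ is Heine-Borel, and $\big(\operatorname{supp}(\mu_n)\cup\{\rho_n\},r_n,\rho_n,\mu_n\big)_{n\in\mathbb{N}}$ converges in Gromov-Hausdorff-vague topology to $\big(\operatorname{supp}(\mu)\cup\{\rho\},r,\rho,\mu\big)$. If $\mathcal{X}_n$ is Heine-Borel for all $n\in\mathbb{N}$, the following is also equivalent: (3) $(\mathcal{X}_n)_{n\in\mathbb{N}}$ converges in Gromov-vague topology to $\mathcal{X}$, and $\{\mathcal{X}_n:n\in\mathbb{N}\}$ satisfies the local lower mass-bound property, i.e. $\inf_{n\in\mathbb{N}}\mathfrak{m}_\delta^R(\mathcal{X}_n)>0$ for all $R>\delta>0$.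
   Context: A (pointed, complete, separable) metric measure space $(X,r,\rho,\mu)$ consists of a complete separable metric space $(X,r)$, a point $\rho\in X$ (the root) and a Borel measure $\mu$ on $X$; it is boundedly finite if $\mu$ is finite on all bounded sets. Two metric measure spaces are equivalent if there is a (surjective) isometry $\phi\colon\operatorname{supp}(\mu)\cup\{\rho\}\to\operatorname{supp}(\mu')\cup\{\rho'\}$ with $\phi(\rho)=\rho'$ and $\phi_*\mu=\mu'$; spaces are identified with their equivalence classes. A Heine-Borel metric space is one in which every bounded closed set is compact; a (class of a) metric boundedly finite measure space is called Heine-Borel if it has a representative whose metric space is Heine-Borel. $B_r(x,R)$ and $\overline{B}_r(x,R)$ denote open and closed balls, and for $R\ge0$, $\mathcal{X}{\upharpoonright}_R:=(X,r,\rho,\mu{\upharpoonright}_{\overline{B}_r(\rho,R)})$. Gromov-weak convergence (of metric finite measure spaces): for $m\in\mathbb{N}$ let $\nu_m(\mathcal{X})$ be the image of $\mu^{\otimes m}$ under $(x_1,\dots,x_m)\mapsto (r(x_i,x_j))_{0\le i<j\le m}$, $x_0:=\rho$; $\mathcal{X}_n\to\mathcal{X}$ Gromov-weakly iff $\nu_m(\mathcal{X}_n)\to\nu_m(\mathcal{X})$ weakly for all $m$. Gromov-Hausdorff-weak convergence (of metric finite measure spaces): $\mathcal{X}_n\to\mathcal{X}_\infty$ iff there are a pointed metric space $(E,d_E,\rho_E)$ and isometric embeddings $\varphi_n\colon\operatorname{supp}(\mu_n)\cup\{\rho_n\}\to E$, $n\in\mathbb{N}\cup\{\infty\}$, with $\varphi_n(\rho_n)=\rho_E$,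 such that $(\varphi_n)_*\mu_n\to(\varphi_\infty)_*\mu_\infty$ weakly and $d_{\mathrm H}(\varphi_n(\operatorname{supp}\mu_n),\varphi_\infty(\operatorname{supp}\mu_\infty))\to0$. Here $d_{\mathrm H}(A,B)=\inf\{\varepsilon>0: A^\varepsilon\supseteq B,\ B^\varepsilon\supseteq A\}$ with $A^\varepsilon=\{x\in E:d_E(x,A)\le\varepsilon\}$. A sequence of metric boundedly finite measure spaces converges $\mathcal{X}_n\to\mathcal{X}$ Gromov-vaguely (resp. Gromov-Hausdorff-vaguely) iff $\mathcal{X}_n{\upharpoonright}_R\to\mathcal{X}{\upharpoonright}_R$ Gromov-weakly (resp. Gromov-Hausdorff-weakly) for all but countably many $R>0$. Lower mass function: $\mathfrak{m}_\delta^R((X,r,\rho,\mu)):=\inf\{\mu(\overline{B}_r(x,\delta)):x\in B_r(\rho,R)\cap\operatorname{supp}(\mu)\}$, with $\inf\emptyset=\infty$. *)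

(* Defs.v *)
From HB Require Import structures.
From mathcomp Require Import all_boot all_order all_algebra.
From mathcomp Require Import all_classical all_reals all_analysis.

Set Implicit Arguments.
Unset Strict Implicit.
Unset Printing Implicit Defensive.

Import Order.TTheory GRing.Theory Num.Theory.
Import numFieldNormedType.Exports.

Local Open Scope classical_set_scope.
Local Open Scope ring_scope.

(* Pointed metric spaces; the root is [point]. *)
#[short(type="pmetricType")]
HB.structure Definition PointedMetric (R : numDomainType) :=
  { T of Pointed T & Metric R T }.

#[short(type="completePMetricType")]
HB.structure Definition CompletePointedMetric (R : numDomainType) :=
  { T of Complete T & Metric R T }.

Section metric.
Context {R : realType}.

(* [closed_ball] of the library is the closure of the open ball, which can be
   smaller in a general metric space. *)
Definition cball {T : metricType R} (x : T) (e : R) : set T :=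
  [set y | mdist x y <= e].

Definition separable (T : topologicalType) :=
  exists2 D : set T, countable D & dense D.

Definition metric_bounded {T : metricType R} (A : set T) :=
  exists M : R, forall x y, A x -> A y -> mdist x y <= M.

Definition heine_borel (T : metricType R) :=
  forall A : set T, closed A -> metric_bounded A -> compact A.

Definition isometric {S T : metricType R} (f : S -> T) :=
  forall x y, mdist (f x) (f y) = mdist x y.

(* d(x, set0) = +oo *)
Definition set_dist {T : metricType R} (x : T) (A : set T) : \bar R :=
  ereal_inf [set (mdist x a)%:E | a in A].

Definition thickening {T : metricType R} (A : set T) (e : R) : set T :=
  [set x | (set_dist x A <= e%:E)%E].

Definition hausdorff_dist {T : metricType R} (A B : set T) : \bar R :=
  ereal_inf [set e%:E | e in
    [set e : R | [/\ 0 < e, B `<=` thickening A e & A `<=` thickening B e]]].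

Lemma closed_cball {T : metricType R} (x : T) (e : R) : closed (cball x e).
Proof.
rewrite -openC openE => y /=; rewrite /cball /= => /negP; rewrite -ltNge => xy.
rewrite /interior -nbhs_ballE; exists (mdist x y - e); first by rewrite /= subr_gt0.
move=> z; rewrite ballEmdist /= => yz xz; move: yz; apply/negP.
rewrite -leNgt lerBlDl; apply: (le_trans (metric_triangle x z y)).
by rewrite (metric_sym z y) lerD2r.
Qed.

End metric.

(* The metric of a subset, viewed as a space of its own. *)
Section subset_metric.
Context {R : realType} {T : metricType R} (A : set T).

Let dist (x y : set_type A) : R := mdist (set_val x) (set_val y).

Let dist_ge0 x y : 0 <= dist x y.
Proof. exact: mdist_ge0. Qed.

Let dist_positivity x y : dist x y = 0 -> x = y.
Proof. by move/mdist_positivity => xy; apply: val_inj; exact: xy. Qed.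

Let dist_ball (x : set_type A) d : ball x d = [set y | dist x y < d].
Proof. by rewrite -initial_ballE ballEmdist. Qed.

HB.instance Definition _ := @PseudoMetric_isMetric.Build R (set_type A)
  dist dist_ge0 dist_positivity dist_ball.

End subset_metric.

(* The underlying set with its Borel sigma-algebra. *)
Notation borel T := (g_sigma_algebraType (@open T)).

(* Complete separable pointed metric measure spaces, root [point]. They are
   not quotiented by equivalence ([mm_equiv] below). *)
Record mmspace (R : realType) := MMSpace {
  mm_car :> completePMetricType R ;
  mm_separable : separable mm_car ;
  mm_meas : {measure set (borel mm_car) -> \bar R} }.
Arguments MMSpace {R mm_car}.
Arguments mm_meas {R}.

Section mmspace_theory.
Context {R : realType}.
Implicit Types X Y : mmspace R.
Local Open Scope ereal_scope.

Definition boundedly_finite X :=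
  forall A : set (borel X), measurable A -> metric_bounded A ->
    mm_meas X A < +oo.

Lemma measurable_cball X (x : X) (e : R) :
  measurable (cball x e : set (borel X)).
Proof.
rewrite -[cball x e]setCK; apply: measurableC; apply: sub_sigma_algebra.
by rewrite openC; exact: closed_cball.
Qed.

Definition mm_restr X (r : R) : mmspace R :=
  MMSpace (@mm_separable R X) (mrestr (mm_meas X) (@measurable_cball X point r)).

Definition supp X : set X :=
  [set x | forall U, open U -> U x -> 0 < mm_meas X U].

Arguments supp X : clear implicits.

Definition rsupp X : set X := supp X `|` [set point].
Arguments rsupp X : clear implicits.

Lemma closed_supp X : closed (supp X).
Proof.
move=> x clx U oU Ux.
have [y [sy Uy]] := clx U (open_nbhs_nbhs (conj oU Ux)).
exact: sy.
Qed.

Lemma closed_rsupp X : closed (rsupp X).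
Proof.
apply: closedU; first exact: closed_supp.
apply: accessible_closed_set1; apply: hausdorff_accessible.
exact: metric_hausdorff.
Qed.

Lemma measurable_rsupp X : measurable (rsupp X : set (borel X)).
Proof.
rewrite -[rsupp X]setCK; apply: measurableC; apply: sub_sigma_algebra.
by rewrite openC; exact: closed_rsupp.
Qed.

(* The metric measure space on supp(mu) together with the root. *)
Definition rsupp_type X : Type := set_type (rsupp X).

End mmspace_theory.

Arguments supp {R} X.
Arguments rsupp {R} X.

Section rsupp_space.
Context {R : realType} (X : mmspace R).
Local Notation S := (rsupp_type X).
Local Notation val := (set_val : S -> X).

HB.instance Definition _ := Metric.on S.

Let root_in : (point : X) \in rsupp X.
Proof. by apply/mem_set; right. Qed.

HB.instance Definition _ := isPointed.Build S (exist _ point root_in).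

Let S_complete (F : set_system S) : ProperFilter F -> cauchy F -> cvg F.
Proof.
move=> FF /cauchy_ballP cF.
have cG : cauchy (val @ F).
  apply/cauchy_ballP => e e0; have [[P Q] /= [FP FQ] PQ] := cF e e0.
  exists (val @` P, val @` Q) => /=.
    by split; [apply: filterS FP|apply: filterS FQ] => x ?; exists x.
  by move=> [_ _] [/= [x Px <-] [y Qy <-]]; exact: (PQ (x, y)).
have [x Fx] : exists x : X, val @ F --> x.
  by apply/cvg_ex; exact: cauchy_cvg.
have Sx : rsupp X x.
  apply: closed_rsupp => U /Fx FU.
  have [y Uy] : exists y : S, U (val y) := filter_ex (FU : F (val @^-1` U)).
  by exists (val y); split => //; exact/set_mem/(valP y).
apply/cvg_ex; exists (exist _ x (mem_set Sx)).
move=> A [_ [[B oB <-] Bx] BA].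
apply: (filterS BA); apply: Fx; exact: open_nbhs_nbhs.
Qed.

HB.instance Definition _ := Uniform_isComplete.Build S S_complete.

Lemma separable_rsupp : separable S.
Proof.
have [D cD dD] := @mm_separable R X.
pose q (p : X * nat) : S :=
  get [set y : S | mdist p.1 (val y) < p.2.+1%:R^-1].
exists (q @` (D `*` setT)).
  apply: sub_countable (card_image_le _ _) _.
  by apply: countableX.
move=> U [x Ux] oU.
have : nbhs x U by exact: open_nbhs_nbhs.
rewrite -nbhs_ballE => -[e /= e0 xU].
have [k ke] : exists k : nat, k.+1%:R^-1 < e / 2.
  have e20 : 0 < e / 2 by rewrite divr_gt0.
  have := @near_infty_natSinv_lt R (PosNum e20).
  by move=> /filter_ex[k /= ?]; exists k.
have k0 : 0 < k.+1%:R^-1 :> R by rewrite invr_gt0.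
have : ball (val x) k.+1%:R^-1 !=set0 by exists (val x); exact: ballxx.
have [a [xa Da]] : (ball (val x) k.+1%:R^-1 `&` D) !=set0.
  have := dD (interior (ball (val x) k.+1%:R^-1)).
  case.
  - by exists (val x); exact: nbhsx_ballx.
  - exact: open_interior.
  - by move=> z [/interior_subset ? ?]; exists z.
move=> _; exists (q (a, k)); split; last by exists (a, k).
apply: xU.
have [y ay] : exists y : S, mdist a (val y) < k.+1%:R^-1.
  by exists x; move: xa; rewrite ballEmdist /= metric_sym.
have : [set y : S | mdist a (val y) < k.+1%:R^-1] (q (a, k)).
  by apply: (@getPex _ [set y : S | mdist a (val y) < k.+1%:R^-1]); exists y.
move=> /= aq; rewrite ballEmdist /=.
apply: (le_lt_trans (metric_triangle (val x) a (val (q (a, k))))).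
rewrite [ltRHS]splitr ltrD//; last exact: lt_trans aq ke.
by move: xa; rewrite ballEmdist /= => /lt_trans; apply.
Qed.

Let val_rsupp (x : S) : rsupp X (val x).
Proof. exact/set_mem/(valP x). Qed.

Lemma measurable_rsupp_image (B : set (borel S)) :
  measurable B -> measurable (val @` B : set (borel X)).
Proof.
move=> mB; apply: (mB [set B | measurable (val @` B : set (borel X))]).
split; [split => /= | ].
- by rewrite image_set0; exact: measurable0.
- move=> A mA.
  have -> : val @` (setT `\` A) = rsupp X `\` val @` A.
    apply/seteqP; split => [_ [x [_ Ax] <-]|x [Sx Ax]].
      by split=> // -[y Ay /val_inj yx]; apply: Ax; rewrite -yx.
    exists (exist _ x (mem_set Sx)) => //; split => // Ax'.
    by apply: Ax; exists (exist _ x (mem_set Sx)).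
  by apply: measurableD => //; exact: measurable_rsupp.
- by move=> F mF; rewrite image_bigcup; exact: bigcup_measurable.
- move=> _ [U oU <-] /=.
  have -> : val @` (val @^-1` U) = U `&` rsupp X.
    apply/seteqP; split => [_ [x Ux <-]//|x [Ux Sx]].
    by exists (exist _ x (mem_set Sx)).
  apply: measurableI; last exact: measurable_rsupp.
  exact: sub_sigma_algebra.
Qed.

Definition rsupp_meas (B : set (borel S)) : \bar R := mm_meas X (val @` B).

Let rsupp_meas0 : rsupp_meas set0 = 0%E.
Proof. by rewrite /rsupp_meas image_set0 measure0. Qed.

Let rsupp_meas_ge0 B : (0 <= rsupp_meas B)%E.
Proof. exact: measure_ge0. Qed.

Let rsupp_meas_sigma_additive : semi_sigma_additive rsupp_meas.
Proof.
move=> F mF tF mU; rewrite /rsupp_meas image_bigcup.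
apply: measure_semi_sigma_additive.
- by move=> n; exact: measurable_rsupp_image.
- apply/trivIsetP => i j _ _ ij; apply/seteqP; split => // _ [[x Fx <-]].
  move=> [y Fy /val_inj yx]; rewrite yx in Fy.
  have /trivIsetP/(_ i j Logic.I Logic.I ij) Fij := tF.
  by have : (F i `&` F j) x by []; rewrite Fij.
- by rewrite -image_bigcup; exact: measurable_rsupp_image.
Qed.

HB.instance Definition _ := isMeasure.Build _ _ _ rsupp_meas
  rsupp_meas0 rsupp_meas_ge0 rsupp_meas_sigma_additive.

Definition rsupp_space : mmspace R := MMSpace separable_rsupp rsupp_meas.

End rsupp_space.

Section convergence.
Context {R : realType}.
Implicit Types (X Y : mmspace R) (Xs : nat -> mmspace R).

Definition borel_pushforward {S T : ptopologicalType}
    (mu : set (borel S) -> \bar R) (f : S -> T) : set (borel T) -> \bar R :=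
  pushforward mu (f : borel S -> borel T).

Definition mm_equiv X Y :=
  exists phi : rsupp_space X -> rsupp_space Y,
    [/\ isometric phi, range phi = setT, phi point = point &
      forall B : set (borel (rsupp_space Y)), measurable B ->
        borel_pushforward (mm_meas (rsupp_space X)) phi B =
        mm_meas (rsupp_space Y) B].

Definition heine_borel_class X := exists2 Y, mm_equiv X Y & heine_borel Y.

Definition weak_cvg {T : ptopologicalType}
    (mu_ : nat -> set (borel T) -> \bar R) (mu : set (borel T) -> \bar R) :=
  forall f : T -> R, continuous f -> (exists M, forall x, `|f x| <= M) ->
    (\int[mu_ n]_x (f x)%:E)%E @[n --> \oo] --> (\int[mu]_x (f x)%:E)%E.

(* The m-fold product; used for finite mu only, for which the library product
   of two measures is a measure. *)
Fixpoint power_measure {d} {T : measurableType d} (mu : set T -> \bar R) (m : nat)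
    : set (m.-tuple T) -> \bar R :=
  if m is k.+1 then
    pushforward (mu \x @power_measure d T mu k)%E
      (fun p : T * k.-tuple T => [tuple of p.1 :: p.2])
  else \d_[tuple].
Arguments power_measure {d T} mu m _.

(* Pairs (i, j) with 0 <= i < j <= m; index 0 stands for the root. *)
Definition index_pairs (m : nat) : {set 'I_m.+1 * 'I_m.+1} :=
  [set p : 'I_m.+1 * 'I_m.+1 | (p.1 < p.2)%N].

Definition dist_vector X (m : nat) (t : m.-tuple (borel X)) :
    borel 'rV[R]_#|index_pairs m| :=
  let x := tnth [tuple of (point : X) :: t] in
  \row_k mdist (x (enum_val k).1) (x (enum_val k).2).

Definition dist_distribution X (m : nat) :
    set (borel 'rV[R]_#|index_pairs m|) -> \bar R :=
  pushforward (power_measure (mm_meas X) m) (@dist_vector X m).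
Arguments dist_distribution X m _ : clear implicits.

(* The two notions of convergence below are meant for finite measures; they are
   applied to the restrictions of boundedly finite ones. *)
Definition gromov_weak Xs X :=
  forall m : nat, weak_cvg (fun n => dist_distribution (Xs n) m) (dist_distribution X m).

Definition gromov_hausdorff_weak Xs X :=
  exists (E : pmetricType R) (phi_ : forall n, rsupp_space (Xs n) -> E)
    (phi : rsupp_space X -> E),
    [/\ (forall n, isometric (phi_ n)) /\ isometric phi,
      (forall n, phi_ n point = point) /\ phi point = point,
      weak_cvg
        (fun n => borel_pushforward (mm_meas (rsupp_space (Xs n))) (phi_ n))
        (borel_pushforward (mm_meas (rsupp_space X)) phi) &
      hausdorff_dist (phi_ n @` [set x | supp (Xs n) (set_val x)])
                     (phi @` [set x | supp X (set_val x)])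
        @[n --> \oo] --> 0%E].

Definition gromov_vague Xs X :=
  countable [set r : R | 0 < r /\
    ~ gromov_weak (fun n => mm_restr (Xs n) r) (mm_restr X r)].

Definition gromov_hausdorff_vague Xs X :=
  countable [set r : R | 0 < r /\
    ~ gromov_hausdorff_weak (fun n => mm_restr (Xs n) r) (mm_restr X r)].

Definition lower_mass (delta r : R) X : \bar R :=
  ereal_inf [set mm_meas X (cball x delta) | x in ball point r `&` supp X].

End convergence.

(* Main.v *)
(** (1) => (2).  Write W(z) for the integrals against mu_n of functions of the
    distances to the points of a finite list z.  Gromov-weak convergence makes
    the integral of (1 - Q / C) ^ k over lists z converge, for Q the squared
    error of the distances within z and of the W(z) relative to a fixed list y
    in supp(mu); taking k large, for all large n some list z in supp(mu_n)
    matches y up to any given precision.  The lower mass bound passes to the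
    limit and makes bounded closed subsets of supp(mu) compact, so that y may
    be taken to be a fine net; the mass bound then forces the matched z to be
    a net of supp(mu_n), and matching the integrals of a partition of unity
    subordinate to the net controls the measures.  Bridges of vanishing length
    between y and z glue all the spaces to X in one metric space, where the
    restrictions to a closed ball of radius r converge for all but countably
    many r; the radii to avoid, besides those without Gromov-weak convergence,
    are those where the support of the restriction is smaller than supp(mu) in
    the closed ball.

    (2) => (1).  In a common space, integrals of uniformly continuous
    functions of several variables converge one variable at a time, uniformly
    by compactness of the limit; bump functions at a finite net of supp(mu)
    give the lower mass bound.

    (3).  A Heine-Borel space has positive lower masses, which takes care of
    the finitely many n not covered by the liminf. *)
Require Import Defs.
From HB Require Import structures.
From mathcomp Require Import all_boot all_order all_algebra.
From mathcomp Require Import all_classical all_reals all_analysis.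
From mathcomp Require Import measurable_realfun ring lra.

Set Implicit Arguments.
Unset Strict Implicit.
Unset Printing Implicit Defensive.

Import Order.TTheory GRing.Theory Num.Theory.
Import numFieldNormedType.Exports.

Local Open Scope classical_set_scope.
Local Open Scope ring_scope.

(** * Bounded continuous functions on metric measure spaces *)

(** Gromov-weak convergence comes without a common space, so whatever is drawn from it must be read
    off integrals of functions of distance matrices. W(z) is such an integral over extra points, and
    a product of several W(z) is one over disjoint blocks of extra points; the test functions are
    therefore kept closed under products, reindexing and integration of variables. They are
    uniformly continuous in the entries; on restrictions to a ball this costs nothing, because
    almost all distance matrices there lie in a compact box. Weak convergence alone cannot see
    points of supp(mu_n) with little mass around them. The mass bound excludes such points, but it
    concerns balls that may stick out of the closed ball of radius r. Nets are therefore matched at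
    a slightly larger radius r', and the way back to r costs the mass of the shell between the two
    spheres, which is small for r' close to r because closed balls decrease to closed balls. *)

Lemma bounded_integrable {R : realType} d (T : measurableType d)
    (nu : {measure set T -> \bar R}) (f : T -> R) M :
  (nu setT < +oo)%E -> measurable_fun setT f -> (forall x, `|f x| <= M) ->
  nu.-integrable setT (EFin \o f).
Proof.
move=> nuy mf fM; apply/integrableP; split; first exact/measurable_EFinP.
apply: (@le_lt_trans _ _ (\int[nu]_x (M%:E))%E).
  apply: ge0_le_integral => //.
  - by apply/measurableT_comp => //; exact/measurable_EFinP.
  - by move=> x _; rewrite lee_fin; exact: fM.
rewrite integral_cst//.
by rewrite -(@fineK _ (nu setT)) ?ge0_fin_numE// -EFinM ltry.
Qed.

Section bounded_continuous.
Context {R : realType}.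

Lemma continuous_mdist (T : metricType R) (f : T -> R) : continuous f <->
  forall x e, 0 < e -> exists2 d, 0 < d &
    forall y, mdist x y < d -> `|f x - f y| < e.
Proof.
split => [cf x e e0|H x].
  have /cvgrPdist_lt/(_ _ e0)/nbhs_ballP[d /= d0 xd] := cf x.
  by exists d => // y xy; apply: xd; rewrite ballEmdist.
apply/cvgrPdist_lt => e e0; have [d d0 xd] := H x e e0.
by apply/nbhs_ballP; exists d => //= y; rewrite ballEmdist; exact: xd.
Qed.

Lemma metric_ball_open {T : metricType R} (x : T) (e : R) : open (ball x e).
Proof.
rewrite openE => y; rewrite ballEmdist /= => xy.
apply/nbhs_ballP; exists (e - mdist x y); first by rewrite /= subr_gt0.
move=> z; rewrite !ballEmdist /= => yz.
by apply: le_lt_trans (metric_triangle x y z) _; rewrite -ltrBrDl.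
Qed.

Lemma isometric_continuous (S T : metricType R) (f : S -> T) :
  isometric f -> continuous f.
Proof.
move=> isof x U /nbhs_ballP[e /= e0 xU].
apply/nbhs_ballP; exists e => //= y; rewrite ballEmdist /= => xy; apply: xU.
by rewrite ballEmdist /= isof.
Qed.

Lemma open_borel (T : ptopologicalType) (U : set T) :
  open U -> measurable (U : set (borel T)).
Proof. exact: sub_sigma_algebra. Qed.

Lemma continuous_borel_measurable (T : ptopologicalType) (f : T -> R) :
  continuous f -> measurable_fun setT (f : borel T -> R).
Proof.
move=> /continuousP cf; apply: (measurability _ (RGenOpens.measurableE R)).
move=> _ [_ [a [b ->] <-]]; rewrite setTI; apply: open_borel.
by apply: cf; exact: interval_open.
Qed.

Lemma continuous_borel_measurable_map (S T : ptopologicalType) (f : S -> T) :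
  continuous f -> measurable_fun setT (f : borel S -> borel T).
Proof.
move=> /continuousP cf.
apply: (@measurability _ _ (borel S) (borel T) _ _ (@open T)) => //.
by move=> _ [U oU <-]; rewrite setTI; apply: open_borel; exact: cf.
Qed.

Definition bcont (T : topologicalType) (f : T -> R) :=
  continuous f /\ exists M, forall x, `|f x| <= M.

Lemma bcont_cst (T : topologicalType) (c : R) : bcont (fun _ : T => c).
Proof. by split; [exact: cst_continuous|exists `|c|]. Qed.

Lemma bcontD (T : topologicalType) (f g : T -> R) :
  bcont f -> bcont g -> bcont (fun x => f x + g x).
Proof.
move=> [cf [M fM]] [cg [N gN]]; split; first by move=> x; apply: cvgD; [exact: cf|exact: cg].
by exists (M + N) => x; rewrite (le_trans (ler_normD _ _))// lerD.
Qed.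

Lemma bcontM (T : topologicalType) (f g : T -> R) :
  bcont f -> bcont g -> bcont (fun x => f x * g x).
Proof.
move=> [cf [M fM]] [cg [N gN]]; split; first by move=> x; apply: cvgM; [exact: cf|exact: cg].
by exists (M * N) => x; rewrite normrM ler_pM.
Qed.

Lemma bcontN (T : topologicalType) (f : T -> R) :
  bcont f -> bcont (fun x => - f x).
Proof.
move=> [cf [M fM]]; split; first by move=> x; apply: cvgN; exact: cf.
by exists M => x; rewrite normrN.
Qed.

Lemma bcontB (T : topologicalType) (f g : T -> R) :
  bcont f -> bcont g -> bcont (fun x => f x - g x).
Proof. by move=> bf bg; apply: bcontD => //; exact: bcontN. Qed.

Lemma bcont_comp (S T : topologicalType) (p : S -> T) (f : T -> R) :
  continuous p -> bcont f -> bcont (f \o p).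
Proof.
move=> cp [cf [M fM]]; split; first by move=> x; apply: continuous_comp; [exact: cp|exact: cf].
by exists M => x /=.
Qed.

End bounded_continuous.

Section finite_mmspace.
Context {R : realType} (Z : mmspace R).
Hypothesis finZ : (mm_meas Z setT < +oo)%E.
Local Notation mu := (mm_meas Z).
Implicit Types f g : Z -> R.

Definition mass : R := fine (mu setT).

Definition Int f : R := \int[mu]_x f x.

Lemma massE : mass%:E = mu setT.
Proof. by rewrite fineK// ge0_fin_numE. Qed.

Lemma mass_ge0 : 0 <= mass.
Proof. exact: fine_ge0. Qed.

Lemma meas_fin (A : set (borel Z)) : measurable A -> mu A \is a fin_num.
Proof.
move=> mA; rewrite ge0_fin_numE//; apply: le_lt_trans finZ.
by apply: le_measure => //; rewrite inE.
Qed.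

Lemma bcont_integrable f : bcont f -> mu.-integrable setT (EFin \o f).
Proof.
move=> [cf [M fM]].
exact: bounded_integrable finZ (continuous_borel_measurable cf) fM.
Qed.

Lemma IntE f : bcont f -> (Int f)%:E = (\int[mu]_x (f x)%:E)%E.
Proof.
by move=> bf; rewrite fineK//; apply: integrable_fin_num => //; exact: bcont_integrable.
Qed.

Lemma IntD f g : bcont f -> bcont g -> Int (fun x => f x + g x) = Int f + Int g.
Proof. by move=> bf bg; apply: RintegralD => //; exact: bcont_integrable. Qed.

Lemma IntB f g : bcont f -> bcont g -> Int (fun x => f x - g x) = Int f - Int g.
Proof. by move=> bf bg; apply: RintegralB => //; exact: bcont_integrable. Qed.

Lemma IntZ c f : bcont f -> Int (fun x => c * f x) = c * Int f.
Proof. by move=> bf; apply: RintegralZl => //; exact: bcont_integrable. Qed.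

Lemma Int_cst c : Int (fun=> c) = c * mass.
Proof. exact: Rintegral_cst. Qed.

Lemma measurable_supp : measurable (supp Z : set (borel Z)).
Proof.
rewrite -[supp Z]setCK; apply: measurableC; apply: sub_sigma_algebra.
by rewrite openC; exact: closed_supp.
Qed.

End finite_mmspace.

Section support.
Context {R : realType} (Z : mmspace R).
Local Notation mu := (mm_meas Z).

Lemma measurable_ball (x : Z) (e : R) : measurable (ball x e : set (borel Z)).
Proof. by apply: open_borel; exact: metric_ball_open. Qed.

Lemma dense_sequence : exists s : nat -> Z,
  forall (x : Z) (e : R), 0 < e -> exists n, mdist x (s n) < e.
Proof.
have [D /countable_injP[f injf] dD] := mm_separable Z.
exists (fun n => xget point [set x | D x /\ f x = n]) => x e e0.
have [|y [xy Dy]] := dD (ball x e) _ (metric_ball_open x e).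
  by exists x; exact: ballxx.
exists (f y); case: xgetP => [z _ [Dz fz]|/(_ y)/= []//].
have -> : z = y by apply: injf => //; rewrite inE.
by move: xy; rewrite ballEmdist.
Qed.

(** Separability at work: a point outside the support has a null neighbourhood, hence lies in a null
    ball of radius 1/(k+1) around a member of the dense sequence, and there are only countably many
    such balls. *)
Lemma supp_conull : mu (~` supp Z) = 0%E.
Proof.
have [s ds] := dense_sequence.
pose C k : set (borel Z) := ~` supp Z `&` \bigcup_(n in [set n | mu (ball (s n) k.+1%:R^-1) = 0%E])
   ball (s n) k.+1%:R^-1.
have mS : measurable (~` supp Z : set (borel Z)).
  by apply: measurableC; exact: measurable_supp.
suff sub : ~` supp Z `<=` \bigcup_k C k.
  apply/(negligibleP mu) => //; apply: (@negligibleS _ (borel Z) R mu _ _ sub).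
  apply: negligible_bigcup => k; apply: (@negligibleS _ (borel Z) R mu _ _ (@subIsetr _ _ _)).
  rewrite bigcup_mkcond; apply: negligible_bigcup => n.
  case: ifPn => [|_]; last exact: negligible_set0.
  rewrite inE /= => n0; apply/(negligibleP mu) => //.
  exact: measurable_ball.
move=> x nsx.
have [U [oU Ux U0]] : exists U, [/\ open U, U x & mu U = 0%E].
  move: (nsx) => /existsNP[U] /not_implyP[oU] /not_implyP[Ux] /negP.
  rewrite -leNgt => U0; exists U; split => //.
  by apply/eqP; rewrite eq_le U0 measure_ge0.
have /nbhs_ballP[e /= e0 xU] : nbhs x U by exact: open_nbhs_nbhs.
have [k ke] : exists k : nat, k.+1%:R^-1 < e / 2.
  have e20 : 0 < e / 2 by rewrite divr_gt0.
  have := @near_infty_natSinv_lt R (PosNum e20).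
  by move=> /filter_ex[k /= ?]; exists k.
have k0 : 0 < k.+1%:R^-1 :> R by rewrite invr_gt0.
have [n xn] := ds x _ k0.
exists k => //; split => //; exists n; last by rewrite ballEmdist /= metric_sym.
apply/eqP; rewrite eq_le measure_ge0 andbT -U0.
apply: le_measure; rewrite ?inE; [exact: measurable_ball|exact: open_borel|].
move=> y; rewrite ballEmdist /= => ny; apply: xU; rewrite ballEmdist /=.
by apply: le_lt_trans (metric_triangle _ (s n) _) _; rewrite [ltRHS]splitr ltrD// (lt_trans _ ke).
Qed.

End support.

Section integral_on_support.
Context {R : realType} (Z : mmspace R).
Hypothesis finZ : (mm_meas Z setT < +oo)%E.
Local Notation mu := (mm_meas Z).
Implicit Types f g : Z -> R.

(** Thanks to this, comparisons of integrals ask for pointwise bounds on [supp Z] only, which is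
    where nets and mass bounds give control. *)
Lemma Int_supp f : bcont f -> Int f = \int[mu]_(x in supp Z) f x.
Proof.
move=> bf; rewrite /Int /Rintegral; congr fine.
rewrite (@negligible_integral _ _ _ mu setT (~` supp Z)) ?setTD ?setCK//.
- by apply: measurableC; exact: measurable_supp.
- exact: bcont_integrable.
- exact: supp_conull.
Qed.

Lemma Int_le f g : bcont f -> bcont g -> (forall x, supp Z x -> f x <= g x) ->
  Int f <= Int g.
Proof.
move=> bf bg fg; rewrite !Int_supp//; apply: le_Rintegral => //.
- exact: measurable_supp.
- by apply: integrableS (bcont_integrable finZ bf) => //; exact: measurable_supp.
- by apply: integrableS (bcont_integrable finZ bg) => //; exact: measurable_supp.
Qed.

Lemma Int_ge0 f : bcont f -> (forall x, supp Z x -> 0 <= f x) -> 0 <= Int f.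
Proof.
move=> bf f0; rewrite -[0](mul0r (mass Z)) -Int_cst; apply: Int_le => //.
exact: bcont_cst.
Qed.

Lemma Int_le_cst f c : bcont f -> (forall x, supp Z x -> f x <= c) ->
  Int f <= c * mass Z.
Proof.
by move=> bf fc; rewrite -Int_cst; apply: Int_le => //; exact: bcont_cst.
Qed.

Lemma Int_dist f g c : bcont f -> bcont g ->
  (forall x, supp Z x -> `|f x - g x| <= c) -> `|Int f - Int g| <= c * mass Z.
Proof.
move=> bf bg fg; rewrite -IntB//; rewrite ler_norml; apply/andP; split.
  rewrite -mulNr -Int_cst; apply: Int_le; [exact: bcont_cst|exact: bcontB|].
  by move=> x /fg; rewrite ler_norml => /andP[].
by apply: Int_le_cst; [exact: bcontB|move=> x /fg; rewrite ler_norml => /andP[]].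
Qed.

Lemma Int_ge_meas f c (A : set (borel Z)) : bcont f -> measurable A -> 0 <= c ->
  (forall x, 0 <= f x) -> (forall x, A x -> c <= f x) ->
  c * fine (mu A) <= Int f.
Proof.
move=> bf mA c0 f0 Af.
rewrite -lee_fin IntE// EFinM fineK ?meas_fin// -[A in mu A]setIT -integral_indic//.
rewrite -ge0_integralZl//; last by apply/measurable_EFinP; exact: measurable_indic.
apply: ge0_le_integral => //.
- by move=> x _; rewrite mule_ge0.
- by apply/measurable_EFinP; apply: measurable_funM => //; exact: measurable_indic.
- by apply/measurable_EFinP; apply: continuous_borel_measurable; case: bf.
move=> x _; rewrite indicE; case: (boolP (x \in A)) => [/set_mem/Af|_].
  by rewrite mule1 lee_fin.
by rewrite mule0 lee_fin.
Qed.

End integral_on_support.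

(** * Iterated integrals and distance matrices *)

Section uniform_bounded.
Context {R : realType} {T : Type}.
Variables (P : T -> Prop) (nr : R -> T -> T -> Prop).

(** Bounded uniform continuity on P, with [nr d x y] in the role of a distance below d. One
    definition serves lists ([ubcs]), matrices ([ubcm]) and vectors ([ubcv]). *)
Definition ubc (F : T -> R) :=
  (exists M, forall x, P x -> `|F x| <= M) /\
  forall e, 0 < e -> exists2 d, 0 < d &
    forall x y, P x -> P y -> nr d x y -> `|F x - F y| < e.

Hypothesis nr_mono : forall d d' x y, d <= d' -> nr d x y -> nr d' x y.

Lemma ubc_cst c : ubc (fun=> c).
Proof.
split; first by exists `|c|.
by move=> e e0; exists 1 => // x y _ _ _; rewrite subrr normr0.
Qed.

Lemma ubcD F G : ubc F -> ubc G -> ubc (fun x => F x + G x).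
Proof.
move=> [[M FM] cF] [[N GN] cG]; split.
  by exists (M + N) => x Px; rewrite (le_trans (ler_normD _ _))// lerD ?FM ?GN.
move=> e e0; have e20 : 0 < e / 2 by rewrite divr_gt0.
have [d d0 Fd] := cF _ e20; have [d' d'0 Gd] := cG _ e20.
exists (Num.min d d'); first by rewrite lt_min d0.
move=> x y Px Py xy; rewrite opprD addrACA.
rewrite (le_lt_trans (ler_normD _ _))// [ltRHS]splitr ltrD//.
  by apply: Fd => //; apply: nr_mono xy; rewrite ge_min lexx.
by apply: Gd => //; apply: nr_mono xy; rewrite ge_min lexx orbT.
Qed.

Lemma ubcM F G : ubc F -> ubc G -> ubc (fun x => F x * G x).
Proof.
move=> [[M FM] cF] [[N GN] cG]; split.
  by exists (M * N) => x Px; rewrite normrM ler_pM// ?FM ?GN.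
move=> e e0; pose K := `|M| + `|N| + 1.
have K0 : 0 < K by rewrite /K -addrA ltr_wpDl// ltr_wpDl.
have e20 : 0 < e / 2 / K by rewrite !divr_gt0.
have [d d0 Fd] := cF _ e20; have [d' d'0 Gd] := cG _ e20.
exists (Num.min d d'); first by rewrite lt_min d0.
move=> x y Px Py xy.
have -> : F x * G x - F y * G y = F x * (G x - G y) + (F x - F y) * G y by ring.
rewrite (le_lt_trans (ler_normD _ _))// [ltRHS]splitr ltrD// normrM.
  apply: (@le_lt_trans _ _ (`|G x - G y| * K)).
    rewrite mulrC ler_wpM2l// (le_trans (FM _ Px))// (le_trans (ler_norm _))//.
    by rewrite /K -addrA lerDl addr_ge0.
  by rewrite -ltr_pdivlMr//; apply: Gd => //; apply: nr_mono xy; rewrite ge_min lexx orbT.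
apply: (@le_lt_trans _ _ (`|F x - F y| * K)).
  rewrite ler_wpM2l// (le_trans (GN _ Py))// (le_trans (ler_norm _))//.
  by rewrite /K addrAC lerDr addr_ge0.
by rewrite -ltr_pdivlMr//; apply: Fd => //; apply: nr_mono xy; rewrite ge_min lexx.
Qed.

Lemma ubcZ c F : ubc F -> ubc (fun x => c * F x).
Proof. by move=> bF; apply: ubcM => //; exact: ubc_cst. Qed.

Lemma ubcB F G : ubc F -> ubc G -> ubc (fun x => F x - G x).
Proof.
move=> bF bG; have := ubcD bF (ubcZ (-1) bG).
by under [X in ubc X]eq_fun do rewrite mulN1r.
Qed.

Lemma ubc_sum (I : Type) (r : seq I) (F : I -> T -> R) :
  (forall i, ubc (F i)) -> ubc (fun x => \sum_(i <- r) F i x).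
Proof.
move=> bF; elim: r => [|i r IH].
  by under [X in ubc X]eq_fun do rewrite big_nil; exact: ubc_cst.
by under [X in ubc X]eq_fun do rewrite big_cons; exact: ubcD.
Qed.

End uniform_bounded.

Section sequences_near.
Context {R : realType} {T : metricType R}.

(** Lists of different lengths are never near, since [all2] fails on them. *)
Definition near_seq (d : R) (s s' : seq T) : Prop :=
  all2 (fun x y => mdist x y < d) s s'.

Lemma near_seq_mono d d' s s' : d <= d' -> near_seq d s s' -> near_seq d' s s'.
Proof.
rewrite /near_seq => dd'; elim: s s' => [|x s IH] [|y s']//= /andP[xy ss'].
by rewrite (lt_le_trans xy)//= IH.
Qed.

Lemma near_seq_refl d s : 0 < d -> near_seq d s s.
Proof. by move=> d0; rewrite /near_seq; elim: s => //= x s ->; rewrite mdistxx d0. Qed.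

Lemma near_seq_cat d s s' t t' : near_seq d s s' -> near_seq d t t' ->
  near_seq d (s ++ t) (s' ++ t').
Proof.
rewrite /near_seq => + tt'; elim: s s' => [|x s IH] [|y s']//= /andP[-> ss'].
exact: IH.
Qed.

Lemma near_seq_nth d x0 s s' i : 0 < d -> near_seq d s s' ->
  mdist (nth x0 s i) (nth x0 s' i) < d.
Proof.
rewrite /near_seq => d0; elim: s s' i => [|x s IH] [|y s']//= i.
  by rewrite mdistxx.
by move=> /andP[xy ss']; case: i => //= i; exact: IH.
Qed.

Definition ubcs (m : nat) := ubc (fun s : seq T => size s = m) near_seq.

Lemma ubcs_cat n m F z : size z = n -> ubcs (n + m) F ->
  ubcs m (fun w => F (z ++ w)).
Proof.
move=> zn [[M FM] cF]; split.
  by exists M => s sm; apply: FM; rewrite size_cat zn sm.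
move=> e e0; have [d d0 Fd] := cF e e0; exists d => // s s' sm s'm ss'.
by apply: Fd; rewrite ?size_cat ?zn ?sm ?s'm//; apply: near_seq_cat => //; exact: near_seq_refl.
Qed.

Lemma ubcs_cons m F x : ubcs m.+1 F -> ubcs m (fun w => F (x :: w)).
Proof. exact: (@ubcs_cat 1 m F [:: x]). Qed.

End sequences_near.

Section iterated_integral.
Context {R : realType} (Z : mmspace R).
Hypothesis finZ : (mm_meas Z setT < +oo)%E.
Implicit Types F G : seq Z -> R.

(** Lists instead of tuples let blocks of variables be concatenated and split without casts. *)
Fixpoint iint (m : nat) (F : seq Z -> R) : R :=
  if m is k.+1 then Int (fun x : Z => iint k (fun t => F (x :: t))) else F [::].

Lemma iint_cat n m F :
  iint (n + m) F = iint n (fun z => iint m (fun w => F (z ++ w))).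
Proof.
elim: n F => [//|n IH] F /=.
by congr Int; apply/funext => x; rewrite IH.
Qed.

Lemma eq_iint m F G : (forall s, size s = m -> F s = G s) -> iint m F = iint m G.
Proof.
elim: m F G => [|m IH] F G FG /=; first exact: FG.
by congr Int; apply/funext => x; apply: IH => s sm; rewrite FG//= sm.
Qed.

Lemma iint_cst m c : iint m (fun=> c) = c * mass Z ^+ m.
Proof.
elim: m => [|m IH] /=; first by rewrite mulr1.
transitivity (Int (fun _ : Z => c * mass Z ^+ m)); last first.
  by rewrite Int_cst exprSr mulrA.
by congr Int; apply/funext => x; exact: IH.
Qed.

Let sections m F := ubcs m.+1 F -> bcont (fun x : Z => iint m (fun t => F (x :: t))).

(** Continuity of sections with m inner variables needs the estimate for m variables, and the
    estimate for m.+1 variables needs that continuity. Stating the first conditionally on the second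
    lets the induction of [iint_dist] alternate between them. *)
Let dist_sections m :
  (forall F G c, ubcs m F -> ubcs m G ->
    (forall s, size s = m -> (forall x, x \in s -> supp Z x) -> `|F s - G s| <= c) ->
    `|iint m F - iint m G| <= c * mass Z ^+ m) ->
  forall F, sections m F.
Proof.
move=> H F bF; have [[M FM] cF] := bF; split.
  apply/continuous_mdist => x e e0.
  have K0 : 0 < mass Z ^+ m + 1 by rewrite ltr_wpDl// exprn_ge0// mass_ge0.
  have [d d0 Fd] := cF _ (divr_gt0 e0 K0); exists d => // y xy.
  apply: (@le_lt_trans _ _ (e / (mass Z ^+ m + 1) * mass Z ^+ m)).
    apply: H; [exact: ubcs_cons|exact: ubcs_cons|move=> s sm _].
    apply/ltW/Fd; rewrite /= ?sm//.
    by rewrite /near_seq /= xy /=; exact: near_seq_refl.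
  by rewrite mulrAC ltr_pdivrMr// ltr_pM2l// ltrDl.
exists (M * mass Z ^+ m) => x.
rewrite -[iint _ _]subr0 -[0](mul0r (mass Z ^+ m)) -iint_cst.
apply: H; [exact: ubcs_cons|exact: ubc_cst|move=> s sm _].
by rewrite subr0 FM//= sm.
Qed.

Lemma iint_dist m F G c : ubcs m F -> ubcs m G ->
  (forall s, size s = m -> (forall x, x \in s -> supp Z x) -> `|F s - G s| <= c) ->
  `|iint m F - iint m G| <= c * mass Z ^+ m.
Proof.
elim: m F G c => [|m IH] F G c bF bG FG /=; first by rewrite mulr1; exact: FG.
rewrite exprSr mulrA; apply: Int_dist => //; [exact: dist_sections|exact: dist_sections|].
move=> x sx; apply: IH; [exact: ubcs_cons|exact: ubcs_cons|move=> s sm ss].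
by apply: FG; rewrite /= ?sm// => y; rewrite inE => /predU1P[->//|/ss].
Qed.

Lemma iint_bcont m F : ubcs m.+1 F ->
  bcont (fun x : Z => iint m (fun t => F (x :: t))).
Proof. by apply: dist_sections => G H c; exact: iint_dist. Qed.

Lemma iint_le m F G : ubcs m F -> ubcs m G ->
  (forall s, size s = m -> (forall x, x \in s -> supp Z x) -> F s <= G s) ->
  iint m F <= iint m G.
Proof.
elim: m F G => [|m IH] F G bF bG FG /=; first exact: FG.
apply: Int_le => //; [exact: iint_bcont|exact: iint_bcont|].
move=> x sx; apply: IH; [exact: ubcs_cons|exact: ubcs_cons|move=> s sm ss].
by apply: FG; rewrite /= ?sm// => y; rewrite inE => /predU1P[->//|/ss].
Qed.

Lemma iint_ge0 m F : ubcs m F -> (forall s, size s = m -> 0 <= F s) -> 0 <= iint m F.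
Proof.
move=> bF F0; rewrite -[0](mul0r (mass Z ^+ m)) -iint_cst.
by apply: iint_le => //; [exact: ubc_cst|move=> s sm _; exact: F0].
Qed.

Lemma iintZ m c F : ubcs m F -> iint m (fun s => c * F s) = c * iint m F.
Proof.
elim: m F => [//|m IH] F bF /=; rewrite -IntZ//; last exact: iint_bcont.
by congr Int; apply/funext => x; rewrite IH//; exact: ubcs_cons.
Qed.

Lemma iintD m F G : ubcs m F -> ubcs m G ->
  iint m (fun s => F s + G s) = iint m F + iint m G.
Proof.
elim: m F G => [//|m IH] F G bF bG /=.
rewrite -IntD//; [|exact: iint_bcont|exact: iint_bcont].
by congr Int; apply/funext => x; rewrite IH//; exact: ubcs_cons.
Qed.

(** The modulus of continuity of F in z is the same for all w, so integration over w multiplies it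
    by at most [mass Z ^+ m]. *)
Lemma ubcs_iint n m F : ubcs (n + m) F ->
  ubcs n (fun z => iint m (fun w => F (z ++ w))).
Proof.
move=> bF; have [[M FM] cF] := bF; split.
  exists (M * mass Z ^+ m) => z zn.
  rewrite -[iint _ _]subr0 -[0](mul0r (mass Z ^+ m)) -iint_cst.
  apply: iint_dist; [exact: ubcs_cat bF|exact: ubc_cst|move=> s sm _].
  by rewrite subr0 FM//= size_cat zn sm.
move=> e e0.
have K0 : 0 < mass Z ^+ m + 1 by rewrite ltr_wpDl// exprn_ge0// mass_ge0.
have [d d0 Fd] := cF _ (divr_gt0 e0 K0); exists d => // x y xn yn xy.
apply: (@le_lt_trans _ _ (e / (mass Z ^+ m + 1) * mass Z ^+ m)).
  apply: iint_dist; [exact: ubcs_cat bF|exact: ubcs_cat bF|move=> s sm _].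
  apply/ltW/Fd; rewrite /= ?size_cat ?sm ?xn ?yn//.
  by apply: near_seq_cat => //; exact: near_seq_refl.
by rewrite mulrAC ltr_pdivrMr// ltr_pM2l// ltrDl.
Qed.

(** Markov's inequality in one variable after the other, on the box of lists d-near y. For y in the
    support it bounds the limit integral in [matching] away from zero. *)
Lemma iint_ge_box F a d (y : seq Z) : ubcs (size y) F -> 0 <= a ->
  (forall s, size s = size y -> 0 <= F s) -> (forall s, near_seq d y s -> a <= F s) ->
  a * \prod_(x <- y) fine (mm_meas Z (ball x d)) <= iint (size y) F.
Proof.
move=> + a0; elim: y F => [|y0 y IH] F bF F0 Fa /=.
  by rewrite big_nil mulr1; exact: Fa.
rewrite big_cons [X in a * X]mulrC mulrA; apply: Int_ge_meas => //.
- exact: iint_bcont.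
- exact: measurable_ball.
- by rewrite mulr_ge0// prodr_ge0// => x _; exact: fine_ge0.
- move=> x; apply: iint_ge0; first exact: ubcs_cons.
  by move=> s sy; apply: F0; rewrite /= sy.
move=> x; rewrite ballEmdist /= => y0x; apply: IH; first exact: ubcs_cons.
  by move=> s sy; apply: F0; rewrite /= sy.
by move=> s ys; apply: Fa; rewrite /near_seq /= y0x.
Qed.

End iterated_integral.

(** * Distance matrices of finite lists *)

Section distance_matrix.
Context {R : realType}.

(* Index 0 stands for the root, and so does every out-of-range index. *)
Definition dmat (T : pmetricType R) (s : seq T) (i j : nat) : R :=
  mdist (nth point (point :: s) i) (nth point (point :: s) j).

Lemma mdist_quad (T : metricType R) (x y x' y' : T) :
  `|mdist x y - mdist x' y'| <= mdist x x' + mdist y y'.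
Proof.
have h1 := metric_triangle x x' y; have h2 := metric_triangle x' y' y.
have h3 := metric_triangle x' x y'; have h4 := metric_triangle x y y'.
rewrite (metric_sym y' y) in h2; rewrite (metric_sym x' x) in h3.
rewrite ler_norml; lra.
Qed.

Lemma dmat_near (T : pmetricType R) (s s' : seq T) d i j : 0 < d ->
  near_seq d s s' -> `|dmat s i j - dmat s' i j| < d *+ 2.
Proof.
move=> d0 ss'; apply: le_lt_trans (mdist_quad _ _ _ _) _; rewrite mulr2n ltrD//.
  by apply: near_seq_nth => //; rewrite /near_seq /= mdistxx d0.
by apply: near_seq_nth => //; rewrite /near_seq /= mdistxx d0.
Qed.

Definition near_mat (d : R) (D D' : nat -> nat -> R) : Prop :=
  forall i j, `|D i j - D' i j| < d.

Lemma near_mat_mono d d' D D' : d <= d' -> near_mat d D D' -> near_mat d' D D'.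
Proof. by move=> dd' DD' i j; exact: lt_le_trans (DD' i j) dd'. Qed.

(** Test functions take the infinite matrix, so that the same one applies to lists of every length
    and [reindex] can move its indices freely. *)
Definition ubcm := ubc (fun _ : nat -> nat -> R => True) near_mat.

Lemma ubcs_dmat (T : pmetricType R) m Phi : ubcm Phi ->
  ubcs m (fun s : seq T => Phi (dmat s)).
Proof.
move=> [[M PM] cP]; split; first by exists M => s _; exact: PM.
move=> e e0; have [d d0 Pd] := cP e e0; exists (d / 2); first by rewrite divr_gt0.
move=> s s' _ _ ss'; apply: Pd => // i j; have d20 : 0 < d / 2 by rewrite divr_gt0.
by have := dmat_near i j d20 ss'; rewrite mulr2n -splitr.
Qed.

Definition reindex (sigma : nat -> nat) (D : nat -> nat -> R) i j := D (sigma i) (sigma j).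

Lemma ubcm_reindex sigma Phi : ubcm Phi -> ubcm (Phi \o reindex sigma).
Proof.
move=> [[M PM] cP]; split; first by exists M => s _; exact: PM.
move=> e e0; have [d d0 Pd] := cP e e0; exists d => // D D' _ _ DD'.
by apply: Pd => // i j; exact: DD'.
Qed.

End distance_matrix.

(** * Gromov-weak convergence as convergence of iterated integrals *)

Section finite_measure_of.
Context d (T : measurableType d) (R : realType) (mu : {measure set T -> \bar R}).

(** The proof of finiteness is carried in the term, so that the finite measure instance below is
    found and products are recognised as measures. *)
Definition finm of (mu setT < +oo)%E : set T -> \bar R := mu.

Hypothesis H : (mu setT < +oo)%E.

Let finm0 : finm H set0 = 0%E. Proof. exact: measure0. Qed.
Let finm_ge0 A : (0 <= finm H A)%E. Proof. exact: measure_ge0. Qed.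
Let finm_sigma : semi_sigma_additive (finm H).
Proof. exact: measure_semi_sigma_additive. Qed.

HB.instance Definition _ := isMeasure.Build _ _ _ (finm H) finm0 finm_ge0 finm_sigma.

Let finm_fin : fin_num_fun (finm H). Proof. exact: lty_fin_num_fun. Qed.

HB.instance Definition _ := Measure_isFinite.Build _ _ _ (finm H) finm_fin.

End finite_measure_of.

Section tuple_measurability.
Context {R : realType} (Z : mmspace R).

(* A set open for the product topology is a countable union of products of
   balls centred at points of a dense sequence. *)
Lemma open_tuple_measurable m (A : set (m.-tuple (borel Z))) :
  (forall t, A t -> exists2 e : R, 0 < e & forall t' : m.-tuple (borel Z),
     near_seq e (t : seq Z) (t' : seq Z) -> A t') -> measurable A.
Proof.
move=> oA; have [s ds] := dense_sequence Z.
pose B (p : m.-tuple nat * nat) : set (m.-tuple (borel Z)) :=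
  \bigcap_(i in [set: 'I_m]) (@tnth _ _ ^~ i) @^-1` (ball (s (tnth p.1 i)) p.2.+1%:R^-1 : set (borel Z)).
have mB p : measurable (B p).
  apply: fin_bigcap_measurable; first exact: finite_finset.
  move=> i _; rewrite -[X in measurable X]setTI.
  by apply: measurable_tnth => //; exact: measurable_ball.
have -> : A = \bigcup_p (if `[< B p `<=` A >] then B p else set0).
  apply/seteqP; split => [t At|t [p _]]; last by case: ifPn => // /asboolP pA /pA.
  have [e e0 tA] := oA t At.
  have [k ke] : exists k : nat, k.+1%:R^-1 < e / 2.
    have e20 : 0 < e / 2 by rewrite divr_gt0.
    have := @near_infty_natSinv_lt R (PosNum e20).
    by move=> /filter_ex[k /= ?]; exists k.
  have k0 : 0 < k.+1%:R^-1 :> R by rewrite invr_gt0.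
  pose idx := [tuple of [seq sval (cid (ds x _ k0)) | x <- t]].
  have sidx i : mdist (tnth t i : Z) (s (tnth idx i)) < k.+1%:R^-1.
    rewrite tnth_map; exact: (svalP (cid (ds (tnth t i) _ k0))).
  exists (idx, k) => //; rewrite asboolT.
    by move=> i _ /=; rewrite ballEmdist /= metric_sym.
  move=> t' Bt'; apply: tA; rewrite /near_seq.
  have : forall i, mdist (tnth t i : Z) (tnth t' i) < e.
    move=> i; have := Bt' i Logic.I; rewrite /= ballEmdist /= => h.
    apply: le_lt_trans (metric_triangle _ (s (tnth idx i)) _) _.
    by rewrite [ltRHS]splitr ltrD// (lt_trans _ ke).
  move=> h; rewrite all2E !size_tuple eqxx /=.
  apply/(all_nthP (point, point)) => i; rewrite size_zip !size_tuple minnn => im.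
  rewrite nth_zip ?size_tuple//=.
  by have := h (Ordinal im); rewrite !(tnth_nth (point : Z)).
apply: countable_bigcupT_measurable; first exact: countableP.
by move=> p; case: ifP.
Qed.

Lemma ubcs_measurable m (F : seq Z -> R) : ubcs m F ->
  measurable_fun setT (fun t : m.-tuple (borel Z) => F t).
Proof.
move=> [_ cF]; apply: (measurability _ (RGenOpens.measurableE R)).
move=> _ [_ [a [b ->] <-]]; rewrite setTI; apply: open_tuple_measurable => t /=.
rewrite in_itv /= => /andP[aF Fb].
have e0 : 0 < Num.min (F t - a) (b - F t) by rewrite lt_min !subr_gt0 aF.
have [d d0 Fd] := cF _ e0; exists d => // t' tt'.
have := Fd _ _ (size_tuple t) (size_tuple t') tt'.
by rewrite lt_min !ltr_norml /= in_itv /=; lra.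
Qed.

End tuple_measurability.

(** * Power measures as iterated integrals *)

Section power.
Context {R : realType} (Z : mmspace R).
Hypothesis finZ : (mm_meas Z setT < +oo)%E.
Local Notation mu := (mm_meas Z).

(** [power_measure] is a bare set function, so the measure is supplied with an equation. Finiteness
    belongs to the induction because the next product requires it. *)
Lemma power_measure_finite m :
  exists2 nu : {measure set (m.-tuple (borel Z)) -> \bar R},
    (nu setT < +oo)%E & @power_measure R _ _ mu m = nu.
Proof.
elim: m => [|m [nu nuy IH]] /=.
  exists (\d_([tuple] : 0.-tuple (borel Z)))%E => //.
  by rewrite [X in (X < _)%E](_ : _ = 1%E) ?ltry//; exact: diracT.
have mc : measurable_fun setT (fun p : borel Z * m.-tuple (borel Z) => [tuple of p.1 :: p.2]).
  by apply: measurable_cons.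
exists (pushforward (finm finZ \x finm nuy)%E
   (fun p : borel Z * m.-tuple (borel Z) => [tuple of p.1 :: p.2])); last first.
  by rewrite IH.
suff : ((finm finZ \x finm nuy) setT < +oo)%E by [].
rewrite -setXTT; by rewrite product_measure1E// lte_mul_pinfty// ge0_fin_numE.
Unshelve. exact: mc.
Qed.


Lemma power_iint m (F : seq Z -> R) : ubcs m F ->
  (\int[@power_measure R _ _ mu m]_t (F t)%:E = (iint m F)%:E)%E.
Proof.
elim: m F => [|m IH] F bF /=.
  rewrite integral_dirac// ?diracT ?mul1e//.
  by apply/measurable_EFinP; exact: ubcs_measurable bF.
have [nu nuy nuE] := power_measure_finite m.
have mc : measurable_fun setT (fun p : borel Z * m.-tuple (borel Z) => [tuple of p.1 :: p.2]).
  by apply: measurable_cons.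
have mF := ubcs_measurable bF.
have mFc : measurable_fun setT (fun p : borel Z * m.-tuple (borel Z) => F (p.1 :: p.2)).
  exact: (measurableT_comp mF mc).
have [M FM] := bF.1.
have iF : (finm finZ \x finm nuy)%E.-integrable setT
    (fun p : borel Z * m.-tuple (borel Z) => (F (p.1 :: p.2))%:E).
  have fy : ((finm finZ \x finm nuy) setT < +oo)%E.
    by rewrite -setXTT product_measure1E// lte_mul_pinfty// ge0_fin_numE.
  by apply: (bounded_integrable fy mFc) => p; apply: FM; rewrite /= size_tuple.
rewrite nuE.
have -> : pushforward (mu \x nu)%E (fun p : borel Z * m.-tuple (borel Z) => [tuple of p.1 :: p.2])
   = pushforward (finm finZ \x finm nuy)%E (fun p : borel Z * m.-tuple (borel Z) => [tuple of p.1 :: p.2]) by [].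
rewrite integral_pushforward//; last exact/measurable_EFinP.
rewrite preimage_setT /comp /= -integral12_prod_meas1// IntE//; last exact: iint_bcont.
apply: eq_integral => x _ /=; rewrite -IH; last exact: ubcs_cons.
by rewrite nuE.
Qed.

End power.

Section distance_vector.
Context {R : realType}.
Variable m : nat.
Local Notation V := 'rV[R]_#|index_pairs m|.

Definition near_vec (d : R) (v w : V) : Prop := forall k, `|v ord0 k - w ord0 k| < d.

Lemma near_vec_mono d d' v w : d <= d' -> near_vec d v w -> near_vec d' v w.
Proof. by move=> dd' vw k; exact: lt_le_trans (vw k) dd'. Qed.

Definition ubcv := ubc (fun _ : V => True) near_vec.

Definition vec_of_mat (D : nat -> nat -> R) : V :=
  \row_k D ((enum_val k).1 : 'I_m.+1) ((enum_val k).2 : 'I_m.+1).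

Definition vec_entry (v : V) (p : 'I_m.+1 * 'I_m.+1) : R :=
  if [pick k | enum_val k == p] is Some k then v ord0 k else 0.

(** Out-of-range indices go to the root, in agreement with the default of [nth] in [dmat]; this is
    what makes [mat_of_vec] recover the whole infinite matrix in [vec_of_matK]. *)
Definition root_index (l : nat) : 'I_m.+1 := if (l <= m)%N then inord l else ord0.

Definition mat_of_vec (v : V) (i j : nat) : R :=
  if (root_index i < root_index j)%N then vec_entry v (root_index i, root_index j)
  else if (root_index j < root_index i)%N then vec_entry v (root_index j, root_index i)
  else 0.

Lemma mat_of_vec_near d v w : 0 < d -> near_vec d v w ->
  near_mat d (mat_of_vec v) (mat_of_vec w).
Proof.
move=> d0 vw i j; have H p : `|vec_entry v p - vec_entry w p| < d.
  by rewrite /vec_entry; case: pickP => [k _|_]; [exact: vw|rewrite subrr normr0].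
by rewrite /mat_of_vec; do 2 case: ifP => _ //; rewrite subrr normr0.
Qed.

Lemma vec_of_mat_near d D D' : near_mat d D D' ->
  near_vec d (vec_of_mat D) (vec_of_mat D').
Proof. by move=> DD' k; rewrite !mxE; exact: DD'. Qed.

Lemma vec_of_matK (T : pmetricType R) (s : seq T) : size s = m ->
  mat_of_vec (vec_of_mat (dmat s)) = dmat s.
Proof.
move=> sm; apply/funext => i; apply/funext => j; rewrite /mat_of_vec.
pose c := root_index; rewrite -!/(c _).
have cE l : nth point (point :: s) (c l) = nth point (point :: s) l.
  rewrite /c /root_index; case: leqP => [lm|ml]; first by rewrite inordK.
  by rewrite /= nth_default//= sm.
have eE (p q : 'I_m.+1) : (p < q)%N -> vec_entry (vec_of_mat (dmat s)) (p, q) = dmat s p q.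
  move=> pq; rewrite /vec_entry; case: pickP => [k /eqP kE|/(_ (enum_rank_in _ _))].
    by rewrite mxE kE.
  have pI : (p, q) \in index_pairs m by rewrite inE.
  by move=> /(_ _ pI (p, q)); rewrite enum_rankK_in// eqxx.
have dE : dmat s i j = dmat s (c i) (c j) by rewrite /dmat !cE.
case: ltnP => [cij|cji]; first by rewrite eE.
case: ltnP => [cji'|cij]; first by rewrite eE// dE /dmat metric_sym.
have -> : dmat s i j = 0.
  have cc : c i = c j by apply/val_inj/eqP; rewrite eqn_leq cij cji.
  by rewrite dE cc /dmat mdistxx.
by [].
Qed.

Lemma nbhs_vec (v : V) (U : set V) : nbhs v U <->
  exists2 d : R, 0 < d & forall w, near_vec d v w -> U w.
Proof.
split => [/nbhs_ballP[d /= d0 vU]|[d d0 vU]].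
  exists d => // w vw; apply: vU; split => // i k; rewrite (ord1 i) /=.
  exact: vw.
apply/nbhs_ballP; exists d => //= w [_ vw]; apply: vU => k.
exact: vw.
Qed.

Lemma ubcv_continuous (f : V -> R) : ubcv f -> bcont f.
Proof.
move=> [[M fM] cf]; split; last by exists M => v; exact: fM.
move=> v U /nbhs_ballP[e /= e0 fU]; have [d d0 fd] := cf e e0.
by apply/nbhs_vec; exists d => // w vw; apply: fU; exact: fd.
Qed.

Variable (Z : mmspace R).

Lemma dist_vectorE (t : m.-tuple (borel Z)) :
  dist_vector t = vec_of_mat (dmat (t : seq Z)).
Proof.
by apply/rowP => k; rewrite !mxE /dmat !(tnth_nth (point : Z)).
Qed.

Lemma measurable_dist_vector : measurable_fun setT (@dist_vector R Z m).
Proof.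
apply: (@measurability _ _ _ (borel V) _ _ (@open V)) => //.
move=> _ [U oU <-]; rewrite setTI; apply: open_tuple_measurable => t /= Ut.
have /nbhs_vec[d d0 tU] : nbhs (dist_vector t : V) U by exact: open_nbhs_nbhs.
exists (d / 2); first by rewrite divr_gt0.
move=> t' tt'; apply: tU; rewrite !dist_vectorE; apply: vec_of_mat_near => i j.
have d20 : 0 < d / 2 by rewrite divr_gt0.
by have := dmat_near i j d20 tt'; rewrite mulr2n -splitr.
Qed.

Hypothesis finZ : (mm_meas Z setT < +oo)%E.

Lemma dist_distribution_finite :
  exists2 nu : {measure set (borel V) -> \bar R},
    (nu setT < +oo)%E & @dist_distribution R Z m = nu.
Proof.
have [nu nuy nuE] := power_measure_finite finZ m.
by exists (pushforward nu (@dist_vector R Z m)); rewrite /dist_distribution ?nuE.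
Unshelve. exact: measurable_dist_vector.
Qed.

Lemma dist_distribution_iint (f : V -> R) : ubcv f ->
  (\int[@dist_distribution R Z m]_v (f v)%:E =
   (iint m (fun s : seq Z => f (vec_of_mat (dmat s))))%:E)%E.
Proof.
move=> uf; have [cf [M fM]] := ubcv_continuous uf.
have [nu nuy nuE] := power_measure_finite finZ m.
have mf : measurable_fun setT (f : borel V -> R) := continuous_borel_measurable cf.
have mD := measurable_dist_vector.
rewrite /dist_distribution nuE integral_pushforward//; last 2 first.
- exact/measurable_EFinP.
- rewrite preimage_setT; apply: (bounded_integrable nuy) => //.
  exact: (measurableT_comp mf mD).
rewrite preimage_setT -power_iint//; last first.
  have uPhi : ubcm (fun D => f (vec_of_mat D)).
    split; first by exists M.
    move=> e e0; have [d d0 fd] := uf.2 e e0; exists d => // D D' _ _ DD'.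
    by apply: fd => //; exact: vec_of_mat_near.
  exact: (@ubcs_dmat R Z m _ uPhi).
rewrite nuE; apply: eq_integral => t _ /=.
by rewrite dist_vectorE.
Qed.

End distance_vector.

(** Only x has to lie in K, while y may leave it: test functions on a glued space are thus
    controlled at points of the approximating spaces that are merely close to the compact limit. *)
Lemma compact_unif_continuous {R : realType} (T : pseudoMetricType R) (K : set T)
    (f : T -> R) : compact K -> continuous f -> forall e, 0 < e ->
  exists2 d, 0 < d & forall x y, K x -> ball x d y -> `|f x - f y| < e.
Proof.
move=> /compact_near_coveringP cK cf e e0.
pose P (d : R) x := forall y, ball x d y -> `|f x - f y| < e.
have : \forall d \near 0^'+, K `<=` P d.
  apply: cK => x Kx.
  have e20 : 0 < e / 2 by rewrite divr_gt0.
  have /cvgrPdist_lt/(_ _ e20)/nbhs_ballP[d /= d0 xd] := cf x.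
  have d20 : 0 < d / 2 by rewrite divr_gt0.
  exists (ball x (d / 2), [set d' | 0 < d' < d / 2]) => /=.
    split; first exact: nbhsx_ballx.
    near=> d'; apply/andP; split => //; near: d'; exact: nbhs_right_lt.
  move=> [z d'] /= [xz /andP[d'0 d'd]] y zy.
  have -> : f z - f y = (f x - f y) - (f x - f z) by ring.
  apply: (le_lt_trans (ler_normB _ _)); rewrite [ltRHS]splitr ltrD//; apply: xd.
    rewrite [d]splitr; apply: ball_triangle xz _.
    by apply: le_ball zy; exact: ltW.
  by apply: le_ball xz; lra.
move=> H; have /filter_ex[d [d0 Kd]] : \forall d \near (0:R)^'+, 0 < d /\ K `<=` P d.
  by near=> d; split => //; near: d.
by exists d => // x y Kx; exact: Kd.
Unshelve. all: by end_near. Qed.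

Section gromov_weak_iint.
Context {R : realType}.

Definition iint_cvg (Zs : nat -> mmspace R) (Z : mmspace R) :=
  forall m Phi, ubcm Phi ->
    iint m (fun s : seq (Zs n) => Phi (dmat s)) @[n --> \oo] -->
    iint m (fun s : seq Z => Phi (dmat s)).

Variables (Zs : nat -> mmspace R) (Z : mmspace R).
Hypotheses (finZs : forall n, (mm_meas (Zs n) setT < +oo)%E)
  (finZ : (mm_meas Z setT < +oo)%E).

Lemma gromov_weak_iint : gromov_weak Zs Z -> iint_cvg Zs Z.
Proof.
move=> H m Phi uPhi; pose f (v : 'rV[R]_#|index_pairs m|) := Phi (mat_of_vec v).
have uf : ubcv f.
  split; first by have [[M PM] _] := uPhi; exists M => v _; exact: PM.
  move=> e e0; have [d d0 Pd] := uPhi.2 e e0; exists d => // v w _ _ vw.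
  by apply: Pd => //; exact: mat_of_vec_near.
have [cf bf] := ubcv_continuous uf.
have E (Y : mmspace R) : iint m (fun s : seq Y => f (vec_of_mat m (dmat s))) =
           iint m (fun s : seq Y => Phi (dmat s)).
  by apply: eq_iint => s sm; rewrite /f vec_of_matK.
have := H m f cf bf; rewrite dist_distribution_iint// E.
under eq_fun do rewrite dist_distribution_iint// E.
by move/fine_cvg.
Qed.

Definition clamp_vec {k} (B : R) (v : 'rV[R]_k) : 'rV[R]_k :=
  \row_i Num.max (- B) (Num.min B (v ord0 i)).

Lemma clamp_dist (B x y : R) : 0 <= B ->
  `|Num.max (- B) (Num.min B x) - Num.max (- B) (Num.min B y)| <= `|x - y|.
Proof.
have H u v : u <= v -> 0 <= B -> 0 <= Num.max (- B) (Num.min B v) - Num.max (- B) (Num.min B u) <= v - u.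
  move=> uv B0; case: (leP B u) => ?; case: (leP B v) => ?;
    case: (leP (- B) B) => ?; case: (leP (- B) u) => ?; case: (leP (- B) v) => ?;
    by apply/andP; split; lra.
move=> B0; have [/ltW xy|xy] := ltP x y.
  have /andP[h1 h2] := H _ _ xy B0.
  by rewrite distrC [leRHS]distrC (ger0_norm h1) ger0_norm ?subr_ge0.
have /andP[h1 h2] := H _ _ xy B0.
by rewrite (ger0_norm h1) ger0_norm ?subr_ge0.
Qed.

Lemma min_dist (c x y : R) : `|Num.min c x - Num.min c y| <= `|x - y|.
Proof.
have h1 := ler_norm (x - y); have h2 := ler_norm (y - x); rewrite distrC in h2.
by rewrite ler_norml; case: (leP c x) => ?; case: (leP c y) => ?; apply/andP; split; lra.
Qed.

Lemma clamp_vec_continuous {k} B : 0 <= B -> continuous (@clamp_vec k B).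
Proof.
move=> B0 v U /nbhs_ballP[d /= d0 vU]; apply/nbhs_ballP; exists d => // w [_ vw].
apply: vU; split => // i j; rewrite !mxE -ball_normE /=.
apply: le_lt_trans (clamp_dist _ _ B0) _.
by have := vw ord0 j; rewrite -ball_normE.
Qed.

Lemma ubcv_clamp m B (f : 'rV[R]_#|index_pairs m| -> R) : 0 <= B -> bcont f ->
  ubcv (f \o clamp_vec B).
Proof.
move=> B0 [cf [M fM]]; split; first by exists M => v _; exact: fM.
move=> e e0.
have cK : compact [set v : 'rV[R]_#|index_pairs m| | forall i, `[(- B), B]%classic (v ord0 i)].
  by apply: (@rV_compact R _ (fun=> `[(- B), B]%classic)) => i; exact: segment_compact.
have [d d0 fd] := compact_unif_continuous cK cf e0; exists d => // v w _ _ vw.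
apply: fd.
  by move=> i; rewrite mxE /= in_itv /= le_max lexx ge_max ge_min lexx /= andbT; lra.
split => // i j; rewrite !mxE -ball_normE /=.
exact: le_lt_trans (clamp_dist _ _ B0) (vw j).
Qed.

(* Test functions need not be uniformly continuous, but on bounded spaces only
   their values on a compact box matter. *)
Lemma dist_distribution_clamp (Y : mmspace R) m B (f : 'rV[R]_#|index_pairs m| -> R) :
  (mm_meas Y setT < +oo)%E -> (forall x, supp Y x -> mdist point x <= B) ->
  bcont f ->
  (\int[@dist_distribution R Y m]_v (f v)%:E =
   \int[@dist_distribution R Y m]_v (f (clamp_vec (2 * `|B|) v))%:E)%E.
Proof.
(* Two points within [|B|] of the root are at most C apart. *)
move=> finY YB bf; set C := 2 * `|B|.
have C0 : 0 <= C by rewrite mulr_ge0.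
(* h is nonnegative and vanishes exactly at the vectors that clamping fixes. Being uniformly
   continuous and bounded, it can be integrated as an iterated integral over the support, where it
   is zero; so almost every vector is fixed by clamping. *)
pose h (v : 'rV[R]_#|index_pairs m|) := \sum_k Num.min 1 `|v ord0 k - clamp_vec C v ord0 k|.
have uh : ubcv h.
  apply: (ubc_sum (@near_vec_mono _ _)) => k; split.
    by exists 1 => v _; rewrite ger0_norm ?ge_min ?lexx// le_min ler01 normr_ge0.
  move=> e e0; exists (e / 2); first by rewrite divr_gt0.
  move=> v w _ _ /(_ k) vw; rewrite !mxE.
  have := clamp_dist (v ord0 k) (w ord0 k) C0.
  set a := Num.max _ _; set b := Num.max _ _ => ab.
  apply: (@le_lt_trans _ _ (`| `|v ord0 k - a| - `|w ord0 k - b| |)).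
    exact: min_dist.
  apply: (le_lt_trans (ler_dist_dist _ _)).
  have -> : v ord0 k - a - (w ord0 k - b) = (v ord0 k - w ord0 k) - (a - b) by ring.
  apply: (le_lt_trans (ler_normB _ _)); lra.
have h0 v : 0 <= h v by apply: sumr_ge0 => k _; rewrite le_min ler01 normr_ge0.
have Ih : (\int[@dist_distribution R Y m]_v (h v)%:E = 0)%E.
  rewrite dist_distribution_iint//; congr EFin.
  have uP : ubcs m (fun s : seq Y => h (vec_of_mat m (dmat s))).
    apply: (@ubcs_dmat R Y m (fun D => h (vec_of_mat m D))); split.
      by have [[M hM] _] := uh; exists M => D _; exact: hM.
    move=> e e0; have [d d0 hd] := uh.2 e e0; exists d => // D D' _ _ DD'.
    by apply: hd => //; exact: vec_of_mat_near.
  suff : `|iint m (fun s : seq Y => h (vec_of_mat m (dmat s))) -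
           @iint R Y m (fun=> 0)| <= 0 * mass Y ^+ m.
    by rewrite (iint_cst Y m 0) !mul0r subr0 normr_le0 => /eqP.
  apply: iint_dist => //; first exact: ubc_cst.
  move=> s sm ss; rewrite subr0 ger0_norm// /h big1// => k _; rewrite !mxE.
  set i := (enum_val k).1; set j := (enum_val k).2.
  have bnd l : mdist point (nth point (point :: s) l) <= `|B|.
    have [ls|sl] := ltnP l (size (point :: s)); last by rewrite nth_default// mdistxx.
    have := mem_nth (point : Y) ls; rewrite inE => /predU1P[->|/ss/YB]; first by rewrite mdistxx.
    by move=> hB; apply: (le_trans hB); exact: ler_norm.
  have dC : dmat s i j <= C.
    rewrite /dmat; apply: (le_trans (metric_triangle _ point _)).
    rewrite metric_sym /C mulr_natl mulr2n lerD//; exact: bnd.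
  have d0 : 0 <= dmat s i j by exact: mdist_ge0.
  rewrite (min_idPr dC) (max_idPr _); last by lra.
  by rewrite subrr normr0 min_r.
have [nu nuy nuE] := dist_distribution_finite m finY.
rewrite nuE in Ih *.
have [ch _] := ubcv_continuous uh; have [cf _] := bf.
have mh : measurable_fun setT (h : borel 'rV[R]_#|index_pairs m| -> R) :=
  continuous_borel_measurable ch.
apply: ae_eq_integral => //.
- by apply/measurable_EFinP; exact: (continuous_borel_measurable cf).
- apply/measurable_EFinP; apply: (@continuous_borel_measurable R 'rV[R]_#|index_pairs m| (f \o clamp_vec C)).
  by move=> v; apply: continuous_comp; [exact: (clamp_vec_continuous C0)|exact: cf].
have : ae_eq nu setT (EFin \o h) (cst 0%E).
  apply/ae_eq_integral_abs => //; first exact/measurable_EFinP.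
  by rewrite -[RHS]Ih; apply: eq_integral => v _; rewrite /= ger0_norm.
apply: filterS => v hv _; congr (f _)%:E.
have {}hv : h v = 0 by have [] := hv Logic.I.
apply/rowP => k; have : Num.min 1 `|v ord0 k - clamp_vec C v ord0 k| = 0.
  apply/eqP; move: hv => /eqP; rewrite psumr_eq0; last by move=> l _; rewrite le_min ler01 normr_ge0.
  by move=> /allP/(_ k (mem_index_enum _)).
rewrite (ord1 (0 : 'I_1)) /Num.min; case: ifP => [_ /eqP|_ /eqP]; first by rewrite oner_eq0.
by rewrite normr_eq0 subr_eq0 => /eqP.
Qed.

Lemma iint_gromov_weak B : (forall x, supp Z x -> mdist point x <= B) ->
  (forall n x, supp (Zs n) x -> mdist point x <= B) ->
  iint_cvg Zs Z -> gromov_weak Zs Z.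
Proof.
move=> ZB ZsB H m f cf bf.
have B0 : 0 <= 2 * `|B| by rewrite mulr_ge0.
have uf := ubcv_clamp B0 (conj cf bf).
have E (Y : mmspace R) : (mm_meas Y setT < +oo)%E ->
    (forall x, supp Y x -> mdist point x <= B) ->
    (\int[@dist_distribution R Y m]_v (f v)%:E =
     (iint m (fun s : seq Y => f (clamp_vec (2 * `|B|) (vec_of_mat m (dmat s)))))%:E)%E.
  move=> finY YB; rewrite (dist_distribution_clamp finY YB (conj cf bf)).
  by have := dist_distribution_iint finY uf.
rewrite (E Z)// (_ : (fun n => _) = fun n => (iint m (fun s : seq (Zs n) =>
    f (clamp_vec (2 * `|B|) (vec_of_mat m (dmat s)))))%:E); last first.
  by apply/funext => n; rewrite E//; exact: ZsB.
apply: cvg_EFin; first by apply: nearW.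
apply: (H m (fun D => f (clamp_vec (2 * `|B|) (vec_of_mat m D)))).
split; first by have [[M hM] _] := uf; exists M => D _; exact: hM.
move=> e e0; have [d d0 hd] := uf.2 e e0; exists d => // D D' _ _ DD'.
by apply: hd => //; exact: vec_of_mat_near.
Qed.

End gromov_weak_iint.

(** * Matching finite lists of points *)

Lemma ubcs_dmat_cat {R : realType} (Y : mmspace R) (z : seq Y) k Psi :
  ubcm Psi -> ubcs k (fun w => Psi (dmat (z ++ w))).
Proof.
move=> uPsi; apply: (@ubcs_cat _ _ (size z) k (fun s => Psi (dmat s))) => //.
exact: ubcs_dmat.
Qed.

Section matching.
Context {R : realType}.
Variables (Zs : nat -> mmspace R) (Z : mmspace R).
Hypotheses (finZs : forall n, (mm_meas (Zs n) setT < +oo)%E)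
  (finZ : (mm_meas Z setT < +oo)%E).
Hypothesis ZsZ : iint_cvg Zs Z.

Definition functional := forall Y : mmspace R, seq Y -> R.

(** With k = 1 these are the W(z) of the overview; with k = 0 they are functions of the distances
    within z. *)
Definition dfun (k : nat) (Psi : (nat -> nat -> R) -> R) : functional :=
  fun Y z => iint k (fun w => Psi (dmat (z ++ w))).

Lemma dfun_ubcs N k Psi (Y : mmspace R) : (mm_meas Y setT < +oo)%E ->
  ubcm Psi -> ubcs N (@dfun k Psi Y).
Proof.
move=> finY uPsi; apply: (@ubcs_iint R Y finY N k (fun s => Psi (dmat s))).
exact: ubcs_dmat.
Qed.

Lemma mass_cvg : mass (Zs n) @[n --> \oo] --> mass Z.
Proof.
have E (Y : mmspace R) : iint 1 (fun s : seq Y => (fun _ => 1) (dmat s)) = mass Y.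
  by rewrite (iint_cst Y 1 1) mul1r expr1.
have := @ZsZ 1%N _ (@ubc_cst R _ (fun _ => True) near_mat 1).
by rewrite (E Z); under eq_fun do rewrite E.
Qed.

Variable N : nat.

(* A functional integrates its own variables besides [z]; the product of two of
   them is again a functional, on disjoint extra variables, hence a multiplier. *)
Definition stable_cvg (G : functional) :=
  (forall Y, (mm_meas Y setT < +oo)%E -> ubcs N (G Y)) /\
  forall m Phi, ubcm Phi ->
    iint N (fun z => G (Zs n) z * dfun m Phi z) @[n --> \oo] -->
    iint N (fun z => G Z z * dfun m Phi z).

(** Quantifying over G makes multipliers closed under products by mere composition; convergence of
    the integrals of V and W would say nothing about V * W. *)
Definition multiplier (V : functional) :=
  forall G, stable_cvg G -> stable_cvg (fun Y z => G Y z * V Y z).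

Lemma stable_cvg1 : stable_cvg (fun _ _ => 1).
Proof.
split => [Y _|m Phi uPhi]; first exact: ubc_cst.
have E (Y : mmspace R) : iint N (fun z : seq Y => 1 * dfun m Phi z) =
    iint (N + m) (fun s : seq Y => Phi (dmat s)).
  by rewrite iint_cat; apply: eq_iint => s _; rewrite mul1r.
by rewrite E; under eq_fun do rewrite E; exact: ZsZ.
Qed.

Lemma ubcsM (Y : mmspace R) (F G : seq Y -> R) : ubcs N F -> ubcs N G ->
  ubcs N (fun s => F s * G s).
Proof. exact/ubcM/near_seq_mono. Qed.

Lemma multiplier_cst c : multiplier (fun _ _ => c).
Proof.
move=> G [uG cG]; split => [Y finY|m Phi uPhi].
  by apply: ubcsM; [exact: uG|exact: ubc_cst].
have E (Y : mmspace R) : (mm_meas Y setT < +oo)%E ->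
    iint N (fun z : seq Y => G Y z * c * dfun m Phi z) =
    c * iint N (fun z : seq Y => G Y z * dfun m Phi z).
  move=> finY; rewrite -iintZ//; last by apply: ubcsM; [exact: uG|exact: dfun_ubcs].
  by apply: eq_iint => s _; ring.
rewrite E//; under eq_fun do rewrite E//.
by apply: cvgMr; exact: cG.
Qed.

Lemma multiplierD V W : multiplier V -> multiplier W ->
  multiplier (fun Y z => V Y z + W Y z).
Proof.
move=> mV mW G cG; have [uGV cGV] := mV G cG; have [uGW cGW] := mW G cG.
split => [Y finY|m Phi uPhi].
  under [X in ubcs _ X]eq_fun do rewrite mulrDr.
  by apply: (ubcD (@near_seq_mono _ _)); [exact: uGV|exact: uGW].
have E (Y : mmspace R) : (mm_meas Y setT < +oo)%E ->
    iint N (fun z : seq Y => G Y z * (V Y z + W Y z) * dfun m Phi z) =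
    iint N (fun z : seq Y => G Y z * V Y z * dfun m Phi z) +
    iint N (fun z : seq Y => G Y z * W Y z * dfun m Phi z).
  move=> finY; rewrite -iintD//.
  - by apply: eq_iint => s _; ring.
  - by apply: ubcsM; [exact: uGV|exact: dfun_ubcs].
  - by apply: ubcsM; [exact: uGW|exact: dfun_ubcs].
rewrite E//; under eq_fun do rewrite E//.
by apply: cvgD; [exact: cGV|exact: cGW].
Qed.

Lemma eq_multiplier V W : (forall Y z, V Y z = W Y z) -> multiplier V -> multiplier W.
Proof.
move=> VW; have -> // : V = W.
by apply: functional_extensionality_dep => Y; apply/funext => z.
Qed.

Lemma multiplierM V W : multiplier V -> multiplier W ->
  multiplier (fun Y z => V Y z * W Y z).
Proof.
move=> mV mW G cG; have := mW _ (mV _ cG).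
have -> // : (fun (Y : mmspace R) (z : seq Y) => G Y z * V Y z * W Y z) =
  (fun Y z => G Y z * (V Y z * W Y z)).
by apply: functional_extensionality_dep => Y; apply/funext => z; rewrite mulrA.
Qed.

Lemma multiplierX V k : multiplier V -> multiplier (fun Y z => V Y z ^+ k).
Proof.
move=> mV; elim: k => [|k IH]; first exact: multiplier_cst.
apply: eq_multiplier (multiplierM mV IH) => Y z.
by rewrite exprS.
Qed.

Lemma multiplier_sum (I : Type) (r : seq I) (V : I -> functional) :
  (forall i, multiplier (V i)) -> multiplier (fun Y z => \sum_(i <- r) V i Y z).
Proof.
move=> mV; elim: r => [|i r IH].
  by apply: eq_multiplier (multiplier_cst 0) => Y z; rewrite big_nil.
by apply: eq_multiplier (multiplierD (mV i) IH) => Y z; rewrite big_cons.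
Qed.

(** The k points of this functional and the m points of the later test function form k + m fresh
    points, and each of Psi and Phi reads its own block through [reindex]. *)
Lemma multiplier_dfun k Psi : ubcm Psi -> multiplier (dfun k Psi).
Proof.
move=> uPsi G [uG cG]; split => [Y finY|m Phi uPhi].
  by apply: ubcsM; [exact: uG|exact: dfun_ubcs].
(* Behind the root at index 0 stands [z ++ w ++ u], in blocks of N, k and m points: s1 reads z and
   w, s2 reads z and skips over w to u. Whatever is out of range for the shorter list is sent back
   to the root. *)
pose s1 i := if (i <= N + k)%N then i else 0%N.
pose s2 i := if (i <= N)%N then i else if (i <= N + m)%N then (i + k)%N else 0%N.
pose Chi := (fun D => Psi (reindex s1 D) * Phi (reindex s2 D)).
have uChi : ubcm Chi.
  by apply: (ubcM (@near_mat_mono _)); [exact: (ubcm_reindex s1 uPsi)|exact: (ubcm_reindex s2 uPhi)].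
have E (Y : mmspace R) : (mm_meas Y setT < +oo)%E ->
    iint N (fun z : seq Y => G Y z * dfun k Psi z * dfun m Phi z) =
    iint N (fun z : seq Y => G Y z * dfun (k + m) Chi z).
  move=> finY; apply: eq_iint => z zN; rewrite -mulrA; congr (_ * _).
  rewrite /dfun iint_cat mulrC -iintZ//; last first.
    exact: ubcs_dmat_cat.
  apply: eq_iint => w wk; rewrite mulrC -iintZ//; last first.
    exact: ubcs_dmat_cat.
  apply: eq_iint => u um; rewrite /Chi.
  have nthE1 i : nth point (point :: z ++ w) i = nth point (point :: z ++ w ++ u) (s1 i).
    rewrite /s1; case: leqP => [iNk|Nki]; last by rewrite nth_default//= size_cat zN wk.
    by rewrite -!cat_cons catA [RHS]nth_cat /= size_cat zN wk ltnS iNk.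
  have nthE2 i : nth point (point :: z ++ u) i = nth point (point :: z ++ w ++ u) (s2 i).
    rewrite /s2; case: leqP => [iN|Ni]; first by rewrite -!cat_cons !nth_cat /= zN ltnS iN.
    case: leqP => [iNm|Nmi]; last by rewrite nth_default//= size_cat zN um.
    rewrite -!cat_cons catA !nth_cat /= size_cat zN wk !ltnS leqNgt Ni /=.
    by rewrite leq_add2r leqNgt Ni /= -addSn subnDr.
  by congr (Psi _ * Phi _); apply/funext => i; apply/funext => j;
    rewrite /reindex /dmat ?nthE1 ?nthE2.
rewrite E//; under eq_fun do rewrite E//.
exact: cG.
Qed.

Lemma stable_cvgX V k : multiplier V ->
  (forall Y, (mm_meas Y setT < +oo)%E -> ubcs N (fun z => V Y z ^+ k)) /\
  iint N (fun z => V (Zs n) z ^+ k) @[n --> \oo] --> iint N (fun z => V Z z ^+ k).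
Proof.
move=> mV; have [u c] := multiplierX k mV stable_cvg1.
split => [Y finY|].
  by have := u Y finY; under [X in ubcs _ X -> _]eq_fun do rewrite mul1r.
have E (Y : mmspace R) : iint N (fun z : seq Y => 1 * V Y z ^+ k * dfun 0 (fun _ => 1) z) =
    iint N (fun z : seq Y => V Y z ^+ k).
  by apply: eq_iint => z _; rewrite mul1r /dfun /= mulr1.
have := c 0%N _ (@ubc_cst R _ (fun _ => True) near_mat 1).
by rewrite E; under eq_fun do rewrite E.
Qed.

End matching.

(** A geometric gap beats every constant factor; this selects the power in [matching]. *)
Lemma expr_ratio_lt {R : realType} (q1 q2 a b : R) : 0 <= q2 -> q2 < q1 -> 0 < a ->
  exists k, q2 ^+ k * b < q1 ^+ k * a.
Proof.
move=> q20 q21 a0; have q10 : 0 < q1 by exact: le_lt_trans q21.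
have r1 : `|q2 / q1| < 1 by rewrite ger0_norm ?divr_ge0 ?(ltW q10)// ltr_pdivrMr// mul1r.
have b0 : 0 < `|b| + 1 by rewrite ltr_wpDl.
have /cvgrPdist_lt/(_ _ (divr_gt0 a0 b0)) := cvg_expr r1.
move=> /filter_ex[k]; rewrite /= sub0r normrN ger0_norm; last first.
  by rewrite exprn_ge0// divr_ge0// ltW.
move=> h; exists k.
have q1k : 0 < q1 ^+ k by rewrite exprn_gt0.
apply: (@le_lt_trans _ _ (q2 ^+ k * (`|b| + 1))).
  rewrite ler_wpM2l ?exprn_ge0// (le_trans (ler_norm _))// lerDl//.
move: h; rewrite expr_div_n ltr_pdivrMr// mulrAC ltr_pdivlMr//.
by rewrite [a * _]mulrC.
Qed.

(* If no list of points of [Zs n] reproduced the values of the functionals at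
   [y] up to [eta], then Q >= eta ^ 2 for the squared error Q, so that the
   integral of (1 - Q / C) ^ k would be exponentially smaller in k than its
   limit, which only sees the neighbourhood of [y] where Q is small. *)
Lemma matching {R : realType} (Zs : nat -> mmspace R) (Z : mmspace R) (I : finType)
    (k : I -> nat) (Psi : I -> (nat -> nat -> R) -> R) (y : seq Z) (eta : R) :
  (forall n, (mm_meas (Zs n) setT < +oo)%E) -> (mm_meas Z setT < +oo)%E ->
  iint_cvg Zs Z -> (forall i, ubcm (Psi i)) -> (forall x, x \in y -> supp Z x) ->
  0 < eta ->
  \forall n \near \oo, exists z : seq (Zs n),
    [/\ size z = size y, forall x, x \in z -> supp (Zs n) x &
      forall i, `|dfun (k i) (Psi i) z - dfun (k i) (Psi i) y| < eta].
Proof.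
move=> finZs finZ ZsZ uPsi sy eta0; set N := size y.
pose V i : functional (R := R) := dfun (k i) (Psi i).
pose a i := V i Z y.
pose Q : functional (R := R) := fun Y z => \sum_i (V i Y z - a i) ^+ 2.
have mQ : multiplier Zs Z N Q.
  apply: multiplier_sum => // i; apply: multiplierX => //.
  apply: multiplierD => //; last exact: multiplier_cst.
  exact: multiplier_dfun.
pose M0 := mass Z + 1.
have M01 : 1 <= M0 by rewrite /M0 lerDr mass_ge0.
have M00 : 0 <= M0 by exact: le_trans M01.
have bPsi i : exists M, forall D, `|Psi i D| <= M.
  by have [[M H] _] := uPsi i; exists M => D; exact: H.
pose b i := sval (cid (bPsi i)).
have Vb (Y : mmspace R) (z : seq Y) i : (mm_meas Y setT < +oo)%E -> size z = N ->
    mass Y <= M0 -> `|V i Y z| <= `|b i| * M0 ^+ k i.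
  move=> finY zN YM.
  have : `|V i Y z - @iint R Y (k i) (fun=> 0)| <= `|b i| * mass Y ^+ k i.
    apply: iint_dist => //; [|exact: ubc_cst|].
      exact: ubcs_dmat_cat.
    move=> s sk _; rewrite subr0; apply: le_trans (ler_norm _).
    exact: (svalP (cid (bPsi i))).
  rewrite (iint_cst Y (k i) 0) mul0r subr0 => h; apply: (le_trans h).
  by rewrite ler_wpM2l// lerXn2r// ?nnegrE ?mass_ge0.
pose C0 : R := \sum_i (`|b i| * M0 ^+ k i *+ 2) ^+ 2.
have Q0 (Y : mmspace R) (z : seq Y) : 0 <= Q Y z by apply: sumr_ge0 => i _; exact: sqr_ge0.
have QC (Y : mmspace R) (z : seq Y) : (mm_meas Y setT < +oo)%E -> size z = N ->
    mass Y <= M0 -> Q Y z <= C0.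
  move=> finY zN YM; apply: ler_sum => i _; rewrite -real_normK ?num_real//.
  rewrite lerXn2r// ?nnegrE//; first by rewrite mulrn_wge0// mulr_ge0// exprn_ge0.
  apply: (le_trans (ler_normB _ _)); rewrite mulr2n lerD//; first exact: Vb.
  by apply: Vb => //; rewrite /M0 lerDl.
have C00 : 0 <= C0 by apply: sumr_ge0 => i _; exact: sqr_ge0.
pose kap := eta ^+ 2; have kap0 : 0 < kap by rewrite exprn_gt0.
(* C exceeds the bound C0 of Q, whence F >= 0, and also kap, whence q2 >= 0 below. *)
pose C := C0 + kap + 1; have CC : 0 < C by rewrite /C; lra.
pose F : functional (R := R) := fun Y z => 1 + - C^-1 * Q Y z.
have FE (Y : mmspace R) (z : seq Y) : F Y z = 1 - Q Y z / C.
  by rewrite /F mulNr mulrC.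
have mF : multiplier Zs Z N F.
  apply: multiplierD => //; first exact: multiplier_cst.
  by apply: multiplierM => //; exact: multiplier_cst.
have F0 (Y : mmspace R) (z : seq Y) : (mm_meas Y setT < +oo)%E -> size z = N ->
    mass Y <= M0 -> 0 <= F Y z.
  move=> finY zN YM; rewrite FE subr_ge0 ler_pdivrMr// mul1r.
  by apply: le_trans (QC _ _ finY zN YM) _; rewrite /C; lra.
have [uF _] := stable_cvgX finZs finZ ZsZ 1 mF.
have [d d0 Fd] := (uF Z finZ).2 _ (divr_gt0 (divr_gt0 kap0 (ltr0n R 2)) CC).
have Fy : F Z y = 1.
  by rewrite FE /Q big1 ?mul0r ?subr0// => i _; rewrite subrr expr0n.
(* F is at least q1 on the lists d-near y, by the choice of d and F(y) = 1. Without a match, F is at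
   most q2 on all lists of N points of the support of [Zs n]. *)
pose q1 := 1 - kap / 2 / C; pose q2 := 1 - kap / C.
have kC : kap / C <= 1 by rewrite ler_pdivrMr// mul1r /C; lra.
have kC0 : 0 < kap / C by rewrite divr_gt0.
have kC2 : kap / 2 / C = kap / C / 2 by rewrite mulrAC.
have q20 : 0 <= q2 by rewrite /q2; lra.
have q21 : q2 < q1 by rewrite /q1 /q2 kC2; lra.
pose p := \prod_(x <- y) fine (mm_meas Z (ball x d)).
have p0 : 0 < p.
  rewrite /p big_seq; apply: prodr_gt0 => x xy; rewrite fine_gt0//.
  apply/andP; split; last by rewrite -ge0_fin_numE//; apply: meas_fin => //; exact: measurable_ball.
  exact: (sy _ xy _ (metric_ball_open x d) (ballxx x d0)).
have [l ql] := expr_ratio_lt (M0 ^+ N) q20 q21 p0.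
have [uFl cFl] := stable_cvgX finZs finZ ZsZ l mF.
have lim_ge : q1 ^+ l * p <= iint N (fun z => F Z z ^+ l).
  apply: iint_ge_box => //; first exact: uFl.
  - by rewrite exprn_ge0//; lra.
  - by move=> s sN; rewrite exprn_ge0// F0// /M0 lerDl.
  move=> s ys; have sN : size s = N.
    by move: ys; rewrite /near_seq all2E => /andP[/eqP].
  have q10 : 0 <= q1 by lra.
  rewrite lerXn2r// ?nnegrE//; first by rewrite F0// /M0 lerDl.
  have := Fd _ _ erefl sN ys; rewrite !expr1 Fy /q1.
  by rewrite ltr_norml => /andP[_]; lra.
have /(_ _) ev1 := cvgr_gt (iint N (fun z => F Z z ^+ l)) cFl.
have {}ev1 := ev1 _ (lt_le_trans ql lim_ge).
have ev2 : \forall n \near \oo, mass (Zs n) <= M0.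
  have := mass_cvg ZsZ => /(cvgr_lt (mass Z))/(_ M0).
  by rewrite /M0 ltrDl ltr01 => /(_ isT); apply: filterS => n /ltW.
near=> n.
have YM : mass (Zs n) <= M0 by near: n.
have big : q2 ^+ l * M0 ^+ N < iint N (fun z => F (Zs n) z ^+ l) by near: n.
apply: contrapT => no; move: big; apply/negP; rewrite -leNgt.
have : iint N (fun z => F (Zs n) z ^+ l) <= @iint R (Zs n) N (fun=> q2 ^+ l).
  apply: iint_le => //; [exact: uFl|exact: ubc_cst|move=> z zN sz].
  rewrite lerXn2r// ?nnegrE//; first exact: F0.
  rewrite FE /q2 lerB// ler_pM2r ?invr_gt0// leNgt; apply/negP => Qk.
  apply: no; exists z; split => // i.
  rewrite -(@ltr_pXn2r _ 2)// ?nnegrE ?(ltW eta0)// real_normK ?num_real//.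
  apply: le_lt_trans Qk; rewrite /Q (bigD1 i)//= lerDl.
  by apply: sumr_ge0 => j _; exact: sqr_ge0.
rewrite (iint_cst (Zs n)) => h; apply: (le_trans h).
by rewrite ler_wpM2l ?exprn_ge0// lerXn2r// ?nnegrE ?mass_ge0.
Unshelve. all: by end_near. Qed.

(** * Gluing metric spaces *)

Section metric_quotient.
Context {R : realType} (Z : Type).

Record pseudometric := Pseudometric {
  pdist : Z -> Z -> R ;
  pdistxx : forall x, pdist x x = 0 ;
  pdist_sym : forall x y, pdist x y = pdist y x ;
  pdist_triangle : forall y x z, pdist x z <= pdist x y + pdist y z }.

Variables (D : pseudometric) (z0 : Z).

(* [z0] is a phantom argument, recording the class that serves as the point. *)
Definition metric_quotient : Type :=
  (fun _ : Z => {A : set Z | exists z, A = [set w | pdist D z w = 0]}) z0.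

HB.instance Definition _ := gen_eqMixin metric_quotient.
HB.instance Definition _ := gen_choiceMixin metric_quotient.

Definition quotient_proj (z : Z) : metric_quotient :=
  exist _ [set w | pdist D z w = 0] (ex_intro _ z erefl).

HB.instance Definition _ := isPointed.Build metric_quotient (quotient_proj z0).

Definition quotient_repr (A : metric_quotient) : Z := sval (cid (svalP A)).

Definition quotient_dist (A B : metric_quotient) : R :=
  pdist D (quotient_repr A) (quotient_repr B).

Lemma quotient_eq (A B : metric_quotient) : sval A = sval B -> A = B.
Proof. by case: A B => [A p] [B q] /= AB; exact: eq_exist. Qed.

Lemma quotient_reprK A : quotient_proj (quotient_repr A) = A.
Proof.
apply: quotient_eq; exact/esym/(svalP (cid (svalP A))).
Qed.

Lemma pdist0_eq x y z : pdist D x y = 0 -> pdist D x z = pdist D y z.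
Proof.
move=> xy; apply/eqP; rewrite eq_le; apply/andP; split.
  by apply: le_trans (pdist_triangle D y x z) _; rewrite xy add0r.
by apply: le_trans (pdist_triangle D x y z) _; rewrite pdist_sym xy add0r.
Qed.

Lemma quotient_projP z : pdist D (quotient_repr (quotient_proj z)) z = 0.
Proof.
have := quotient_reprK (quotient_proj z) => /(congr1 sval) /= E.
have : [set w | pdist D z w = 0] z by exact: pdistxx.
by rewrite -E.
Qed.

Let distxx A : quotient_dist A A = 0. Proof. exact: pdistxx. Qed.

Let dist_sym A B : quotient_dist A B = quotient_dist B A.
Proof. exact: pdist_sym. Qed.

Let dist_triangle B A C : quotient_dist A C <= quotient_dist A B + quotient_dist B C.
Proof. exact: pdist_triangle. Qed.

Let dist_positivity A B : quotient_dist A B = 0 -> A = B.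
Proof.
move=> AB; rewrite -(quotient_reprK A) -(quotient_reprK B); apply: quotient_eq.
by apply/funext => w /=; rewrite (pdist0_eq w AB).
Qed.

HB.instance Definition _ := isMetric.Build R metric_quotient
  distxx dist_positivity dist_sym dist_triangle.

Lemma mdist_quotient x y : mdist (quotient_proj x) (quotient_proj y) = pdist D x y.
Proof.
rewrite [LHS](pdist0_eq _ (quotient_projP x)) pdist_sym.
by rewrite (pdist0_eq _ (quotient_projP y)) pdist_sym.
Qed.

End metric_quotient.

Lemma le_inf2 {R : realType} (A B : set R) c : A !=set0 -> B !=set0 ->
  (forall s t, A s -> B t -> c <= s + t) -> c <= inf A + inf B.
Proof.
move=> A0 B0 H; rewrite -lerBlDr; apply: lb_le_inf => // s As.
rewrite lerBlDr -lerBlDl; apply: lb_le_inf => // t Bt.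
by rewrite lerBlDl; exact: H.
Qed.

(** * Gluing a family of spaces through a common hub *)

Section gluing.
Context {R : realType} (X : pmetricType R) (Y : nat -> pmetricType R).

Section hub.
(** [H x u] is the intended distance from x to the hub point u; the four hypotheses are the triangle
    inequalities for triples made of points of one [Y i] and of the hub. *)
Variable H : forall i, Y i -> X -> R.
Hypotheses
  (H1 : forall i (x x' : Y i) u, H x u <= mdist x x' + H x' u)
  (H2 : forall i (x : Y i) u v, H x u <= H x v + mdist v u)
  (H3 : forall i (x : Y i) u v, mdist u v <= H x u + H x v)
  (H4 : forall i (x x' : Y i) u, mdist x x' <= H x u + H x' u).

Let T := {i : nat & Y i}.

Definition glue_in i (x : Y i) : T := existT (fun i => Y i : Type) i x.

Let hub (p : T) (u : X) : R := H (tagged p) u.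

Let hub_ge0 p u : 0 <= hub p u.
Proof. have := H3 (tagged p) u u; rewrite mdistxx /hub; lra. Qed.

Definition via (p q : T) : set R := [set hub p u + hub q u | u in [set: X]].

Let via_ge0 p q : lbound (via p q) 0.
Proof. by move=> _ [u _ <-]; rewrite addr_ge0. Qed.

Let via_neq0 p q : via p q !=set0.
Proof. by exists (hub p point + hub q point), point. Qed.

Let via_le p q u : inf (via p q) <= hub p u + hub q u.
Proof. by apply: ge_inf; [exists 0; exact: via_ge0|exists u]. Qed.

Definition glue_dist (p q : T) : R :=
  if tag p == tag q then mdist (tagged p) (tagged_as p q) else inf (via p q).

Lemma glue_dist_same i (x y : Y i) :
  glue_dist (glue_in x) (glue_in y) = mdist x y.
Proof. by rewrite /glue_dist /= eqxx; congr mdist; exact: (@tagged_asE _ _ (glue_in x) y). Qed.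

Lemma glue_dist_diff p q : tag p != tag q -> glue_dist p q = inf (via p q).
Proof. by rewrite /glue_dist => /negbTE ->. Qed.

Lemma glue_distxx p : glue_dist p p = 0.
Proof. by case: p => i x; rewrite glue_dist_same mdistxx. Qed.

Lemma glue_dist_sym p q : glue_dist p q = glue_dist q p.
Proof.
have [pq|pq] := eqVneq (tag p) (tag q); last first.
  rewrite !glue_dist_diff// 1?eq_sym//; congr inf.
  by apply/seteqP; split => _ [u _ <-]; exists u => //; rewrite addrC.
case: p q pq => i x [j y] /= ij; case: _ / ij y => y.
by rewrite !glue_dist_same metric_sym.
Qed.

Let same_diff i (x y : Y i) (r : T) : i != tag r ->
  glue_dist (glue_in x) r <= mdist x y + glue_dist (glue_in y) r.
Proof.
move=> ir; rewrite !glue_dist_diff//.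
rewrite -lerBlDl; apply: lb_le_inf; first exact: via_neq0.
move=> _ [u _ <-]; rewrite lerBlDl addrA.
by apply: le_trans (via_le _ _ u) _; rewrite lerD2r; exact: H1.
Qed.

(** The main case has q in a component different from those of p and r. The path enters the hub at
    u, visits q and re-enters at v; by [H3] the visit is no shorter than the hub distance from u to
    v, so by [H2] p can cross at v directly. If p and r share a component, [H4] compares with its
    own metric. *)
Lemma glue_dist_triangle q p r : glue_dist p r <= glue_dist p q + glue_dist q r.
Proof.
have [pq|pq] := eqVneq (tag p) (tag q).
  case: p q pq => i x [j y] /= ij; case: _ / ij y => y.
  have [ir|ir] := eqVneq i (tag r).
    case: r ir => k z /= ik; case: _ / ik z => z.
    by rewrite !glue_dist_same; exact: metric_triangle.
  by rewrite glue_dist_same; exact: same_diff.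
have [qr|qr] := eqVneq (tag q) (tag r).
  case: r q qr pq => k z [j y] /= jk; case: _ / jk z => z pj.
  rewrite glue_dist_same glue_dist_sym addrC metric_sym [X in _ + X]glue_dist_sym.
  by apply: same_diff; rewrite eq_sym.
rewrite [X in _ <= X + _]glue_dist_diff// [X in _ <= _ + X]glue_dist_diff//.
apply: le_inf2 => [||_ _ [u _ <-] [v _ <-]]; [exact: via_neq0|exact: via_neq0|].
have uv : hub p v <= hub p u + (hub q u + hub q v).
  by apply: le_trans (H2 _ v u) _; rewrite lerD2l; exact: H3.
have [pr|pr] := eqVneq (tag p) (tag r).
  case: p r pr uv {pq qr} => i x [j y] /= ij; case: _ / ij y => y uv.
  rewrite glue_dist_same; apply: le_trans (H4 x y v) _.
  rewrite /hub /= in uv *; lra.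
rewrite glue_dist_diff//; apply: le_trans (via_le _ _ v) _; lra.
Qed.

Definition glue_pseudometric : pseudometric (R := R) T :=
  Pseudometric glue_distxx glue_dist_sym glue_dist_triangle.

End hub.

End gluing.

(* A triple [(a, b, e)] of [L n] prescribes a bridge of length [e] from
   [a : Xs n] to [b : X]. *)
Section bridges.
Context {R : realType} (X : pmetricType R) (Xs : nat -> pmetricType R).
Variable L : forall n, set (Xs n * X * R).
Hypotheses (Lroot : forall n, L (point : Xs n, point, 0))
  (Lge0 : forall n (a : Xs n) b e, L (a, b, e) -> 0 <= e)
  (Ldist : forall n (a a' : Xs n) b b' e e', L (a, b, e) -> L (a', b', e') ->
     `|mdist a a' - mdist b b'| <= e + e').

(** X is both the hub and component 0; the bridges of length zero in [M 0] join each of its points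
    to itself in the hub. *)
Let Y (i : nat) : pmetricType R := if i is n.+1 then Xs n else X.

Let M (i : nat) : set (Y i * X * R) :=
  match i with
  | 0 => [set p : X * X * R | p.1.1 = p.1.2 /\ p.2 = 0]
  | n.+1 => @L n
  end.

Let Mroot i : M (point : Y i, point, 0).
Proof. by case: i => [|n] //=. Qed.

Let Mge0 i (a : Y i) b e : M (a, b, e) -> 0 <= e.
Proof. by case: i a => [a [_ /= ->]|n a /Lge0]. Qed.

Let Mdist i (a a' : Y i) b b' e e' : M (a, b, e) -> M (a', b', e') ->
  `|mdist a a' - mdist b b'| <= e + e'.
Proof.
case: i a a' => [a a' [/= -> ->] [/= -> ->]|n a a']; first by rewrite subrr normr0 addr0.
exact: Ldist.
Qed.

Let len i (x : Y i) (u : X) (p : Y i * X * R) : R := mdist x p.1.1 + p.2 + mdist p.1.2 u.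

Let lens i (x : Y i) u : set R := [set len x u p | p in @M i].

Let H i (x : Y i) (u : X) : R := inf (lens x u).

Let lens_neq0 i (x : Y i) u : lens x u !=set0.
Proof. by exists (len x u (point, point, 0)), (point, point, 0). Qed.

Let H_le i (x : Y i) u p : M p -> H x u <= len x u p.
Proof.
move=> Mp; apply: ge_inf; last by exists p.
exists 0 => _ [[[a b] e] Mabe <-].
by rewrite /len /= !addr_ge0 ?mdist_ge0//; exact: Mge0 Mabe.
Qed.

Let H1 i (x x' : Y i) u : H x u <= mdist x x' + H x' u.
Proof.
rewrite -lerBlDl; apply: lb_le_inf => // _ [p Mp <-].
rewrite lerBlDl; apply: le_trans (H_le _ _ Mp) _.
rewrite /len; have := metric_triangle x x' p.1.1; lra.
Qed.

Let H2 i (x : Y i) u v : H x u <= H x v + mdist v u.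
Proof.
rewrite -lerBlDr; apply: lb_le_inf => // _ [p Mp <-].
rewrite lerBlDr; apply: le_trans (H_le _ _ Mp) _.
rewrite /len; have := metric_triangle p.1.2 v u; lra.
Qed.

(** Here and in [H4] the distortion bound [Mdist] enters: crossing by one bridge and returning by
    another cannot be a shortcut. *)
Let H3 i (x : Y i) u v : mdist u v <= H x u + H x v.
Proof.
apply: le_inf2 => // _ _ [[[a b] e] p <-] [[[a' b'] e'] p' <-]; rewrite /len /=.
have := Mdist p p'; rewrite ler_norml => /andP[h _].
have h1 := metric_triangle u b v; have h2 := metric_triangle b b' v.
have h3 := metric_triangle a x a'; rewrite (metric_sym u b) in h1.
rewrite (metric_sym a x) in h3; lra.
Qed.

Let H4 i (x x' : Y i) u : mdist x x' <= H x u + H x' u.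
Proof.
apply: le_inf2 => // _ _ [[[a b] e] p <-] [[[a' b'] e'] p' <-]; rewrite /len /=.
have := Mdist p p'; rewrite ler_norml => /andP[_ h].
have h1 := metric_triangle x a x'; have h2 := metric_triangle a a' x'.
have h3 := metric_triangle b u b'; rewrite (metric_sym u b') in h3.
rewrite (metric_sym a' x') in h2; lra.
Qed.

Lemma glue_bridges : exists (E : pmetricType R) (phi_ : forall n, Xs n -> E) (phi : X -> E),
  [/\ (forall n, isometric (phi_ n)) /\ isometric phi,
    (forall n, phi_ n point = point) /\ phi point = point &
    forall n a b e, L (a, b, e) -> mdist (phi_ n a) (phi b) <= e].
Proof.
pose D := glue_pseudometric H1 H2 H3 H4.
pose root : {i : nat & Y i} := @glue_in R Y 0 point.
pose E : pmetricType R := metric_quotient D root.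
pose phi (u : X) : E := quotient_proj D root (@glue_in R Y 0 u).
pose phi_ n (x : Xs n) : E := quotient_proj D root (@glue_in R Y n.+1 x).
have bridge n a b e : L (a, b, e) -> mdist (phi_ n a) (phi b) <= e.
  move=> Labe; rewrite /phi_ /phi mdist_quotient.
  have -> : pdist D (@glue_in R Y n.+1 a) (@glue_in R Y 0 b) =
    inf (via H (@glue_in R Y n.+1 a) (@glue_in R Y 0 b)).
    exact: glue_dist_diff.
  apply: (@le_trans _ _ (H (a : Y n.+1) b + H (b : Y 0%N) b)).
    apply: ge_inf; last by exists b.
    exists 0 => _ [u _ <-]; apply: le_inf2 => // _ _ [[[a1 b1] e1] p <-] [[[a' b'] e'] p' <-].
    rewrite /len /= !addr_ge0 ?mdist_ge0//; [exact: Mge0 p|exact: Mge0 p'].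
  have h1 : H (a : Y n.+1) b <= e.
    by apply: (le_trans (@H_le n.+1 a b (a, b, e) Labe)); rewrite /len /= !mdistxx addr0 add0r.
  have h2 : H (b : Y 0%N) b <= 0.
    by apply: (le_trans (@H_le 0%N b b (b, b, 0) (conj erefl erefl))); rewrite /len /= !mdistxx !addr0.
  lra.
exists E, phi_, phi; split => //.
- split=> [n|] x y; rewrite /phi_ /phi mdist_quotient; exact: glue_dist_same.
(* The bridge of length zero between the roots identifies them in the quotient. *)
- split => [n|//]; apply: mdist_positivity; apply/eqP; rewrite eq_le mdist_ge0 andbT.
  exact: bridge (Lroot n).
Qed.

End bridges.

(** * Total boundedness, restrictions and Hausdorff distance *)

Section totally_bounded.
Context {R : realType}.

Definition tbounded {T : metricType R} (A : set T) := forall e : R, 0 < e ->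
  exists s : seq T, (forall x, x \in s -> A x) /\
    forall x, A x -> exists2 y, y \in s & mdist x y < e.

(** A centre outside A is replaced by some point of A within e / 2 of it, and dropped if there is
    none. *)
Lemma tbounded_ext {T : metricType R} (A : set T) :
  (forall e : R, 0 < e -> exists s : seq T,
    forall x, A x -> exists2 y, y \in s & mdist x y < e) -> tbounded A.
Proof.
move=> H e e0; have e20 : 0 < e / 2 by rewrite divr_gt0.
have [s sA] := H _ e20.
pose pick (y : T) : option T :=
  if pselect (exists x, A x /\ mdist x y < e / 2) is left h then Some (sval (cid h)) else None.
exists (pmap pick s); split.
  move=> x; rewrite mem_pmap => /mapP[y _]; rewrite /pick; case: pselect => // h [->].
  by have [] := svalP (cid h).
move=> x Ax; have [y ys xy] := sA x Ax.
have [z zE] : exists z, pick y = Some z.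
  by rewrite /pick; case: pselect => [h|[]]; [eexists|exists x].
exists z; first by rewrite mem_pmap -zE map_f.
move: zE; rewrite /pick; case: pselect => // h [<-].
have [_ zy] := svalP (cid h).
apply: le_lt_trans (metric_triangle x y _) _.
by rewrite [ltRHS]splitr ltrD// metric_sym.
Qed.

Lemma tbounded_image {S T : metricType R} (f : S -> T) (A : set T) (B : set S) :
  tbounded B -> (forall x y, B x -> B y -> mdist (f x) (f y) <= mdist x y) ->
  (A `<=` f @` B) -> tbounded A.
Proof.
move=> tB fi AB; apply: tbounded_ext => e e0; have [s [sB Bs]] := tB e e0.
exists (map f s) => x /AB[b Bb <-]; have [y ys by_] := Bs b Bb.
exists (f y); first exact: map_f.
by apply: le_lt_trans by_; apply: fi => //; exact: sB.
Qed.

Lemma tbounded_sub {T : metricType R} (A B : set T) : A `<=` B -> tbounded B -> tbounded A.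
Proof. by move=> AB tB; apply: (tbounded_image (f := id) tB) => // x /AB Bx; exists x. Qed.

Lemma compact_tbounded {T : metricType R} (A : set T) : compact A -> tbounded A.
Proof.
move=> /compact_near_coveringP cA; apply: tbounded_ext => e e0.
(* Finite lists directed by inclusion: near-covering along this filter merges local centres into a
   single list. *)
pose F := filter_from [set: seq T] (fun s => [set s' : seq T | {subset s <= s'}]).
have FF : Filter F.
  apply: filter_from_filter; first by exists [::].
  move=> s t _ _; exists (s ++ t) => // u stu; split => x xs; apply: stu;
    by rewrite mem_cat xs ?orbT.
pose P (s : seq T) x := exists2 y, y \in s & mdist x y < e.
have [x _|s _ As] := cA _ F P FF; last by exists s => x Ax; exact: (As s (fun _ => id) x Ax).
exists (ball x e, [set s : seq T | {subset [:: x] <= s}]) => /=.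
  by split; [exact: nbhsx_ballx|exists [:: x]].
move=> [z s] /= []; rewrite ballEmdist /= => xz sx.
by exists x; [apply: sx; rewrite inE|rewrite metric_sym].
Qed.

(** An ultrafilter on A contains a member of every finite cover, hence balls of every radius; it is
    Cauchy, and completeness gives the limit. *)
Lemma tbounded_compact {T : completePMetricType R} (A : set T) :
  closed A -> tbounded A -> compact A.
Proof.
move=> clA tA; rewrite compact_ultra => F FU FA.
have cF : cauchy F.
  apply: cauchy_exP => e e0; have [s [_ As]] := tA e e0.
  have : F (\bigcup_(y in [set` s]) ball y e).
    apply: filterS FA => x /As[y ys xy]; exists y => //.
    by rewrite ballEmdist /= metric_sym.
  elim: s {As} => [|y s IH].
    rewrite (_ : \bigcup_(_ in _) _ = set0); first by move/filter_not_empty.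
    by rewrite -subset0 => x [].
  have [Fy _|Fy Fs] := in_ultra_setVsetC (ball y e) FU; first by exists y.
  apply: IH; apply: filterS2 Fy Fs => x yx [z]; rewrite /= inE => /predU1P[->//|zs zx].
  by exists z.
have Fx : cvg F by exact: cauchy_cvg.
exists (lim F); split => //.
apply: (closed_cvg _ clA) Fx => //.
Qed.

End totally_bounded.

(** * Restrictions to closed balls and their supports *)

Section restriction.
Context {R : realType} (X : mmspace R).
Implicit Type r : R.

Lemma mm_restrE r (A : set (borel X)) :
  mm_meas (mm_restr X r) A = mm_meas X (A `&` cball point r).
Proof. by []. Qed.

Lemma bounded_cball {T : metricType R} (x : T) r : metric_bounded (cball x r).
Proof.
exists (r + r) => y z xy xz; apply: le_trans (metric_triangle y x z) _.
by rewrite metric_sym lerD.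
Qed.

Lemma mm_restr_finite r : boundedly_finite X -> (mm_meas (mm_restr X r) setT < +oo)%E.
Proof.
move=> bfX; rewrite mm_restrE setTI.
by apply: bfX; [exact: measurable_cball|exact: bounded_cball].
Qed.

Lemma supp_restr r x : supp (mm_restr X r) x -> supp X x /\ mdist point x <= r.
Proof.
move=> sx; split.
  move=> U oU Ux; apply: lt_le_trans (sx U oU Ux) _; rewrite mm_restrE.
  apply: le_measure; rewrite ?inE; last exact: subIsetl.
    by apply: measurableI; [exact: open_borel|exact: measurable_cball].
  exact: open_borel.
rewrite leNgt; apply/negP => rx.
have oC : open (~` cball (point : X) r) by rewrite openC; exact: closed_cball.
have /(_ _) := sx _ oC; rewrite mm_restrE setICl measure0 ltxx => /(_ _).
have : (~` cball (point : X) r) x by rewrite /cball /=; apply/negP; rewrite -ltNge.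
by move=> h /(_ h).
Qed.

(** The inequality is strict because a point at distance exactly r may have all its nearby mass
    outside the closed ball; [countable_supp_restr] deals with the radii at which this happens. *)
Lemma supp_restr_lt r x : supp X x -> mdist point x < r -> supp (mm_restr X r) x.
Proof.
move=> sx xr U oU Ux; rewrite mm_restrE.
have oUB : open (U `&` ball (point : X) r) by apply: openI => //; exact: metric_ball_open.
have := sx _ oUB; rewrite ballEmdist => /(_ (conj Ux xr)) h.
apply: lt_le_trans h _; apply: le_measure; rewrite ?inE.
- by apply: open_borel; rewrite -(ballEmdist (point : X)).
- by apply: measurableI; [exact: open_borel|exact: measurable_cball].
by move=> y [Uy /ltW].
Qed.

End restriction.

(** * Measure-preserving pointed embeddings *)

Section embeddings.
Context {R : realType}.

Definition mm_embed (S Z : mmspace R) (i : S -> Z) :=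
  [/\ isometric i, i point = point &
    forall B : set (borel Z), measurable B -> mm_meas S (i @^-1` B) = mm_meas Z B].

Lemma mm_embed_comp (S Z W : mmspace R) (i : S -> Z) (j : Z -> W) :
  mm_embed i -> mm_embed j -> mm_embed (j \o i).
Proof.
move=> [ii i0 im] [ji j0 jm]; split => [x y|/=|B mB]; first by rewrite /= ji ii.
  by rewrite i0 j0.
rewrite comp_preimage im ?jm//.
rewrite -[X in measurable X]setTI.
by apply: (continuous_borel_measurable_map (isometric_continuous ji)).
Qed.

Lemma mm_embed_finite (S Z : mmspace R) (i : S -> Z) : mm_embed i ->
  (mm_meas Z setT < +oo)%E -> (mm_meas S setT < +oo)%E.
Proof. by move=> [_ _ im]; rewrite -(im setT measurableT) preimage_setT. Qed.

Lemma mm_embed_Int (S Z : mmspace R) (i : S -> Z) (f : Z -> R) : mm_embed i ->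
  (mm_meas Z setT < +oo)%E -> bcont f -> Int (f \o i) = Int f.
Proof.
move=> iE finZ bf; have [ii i0 im] := iE.
have ci := isometric_continuous ii.
have mi := continuous_borel_measurable_map ci.
have mf := continuous_borel_measurable bf.1.
congr fine; rewrite -(@integral_pushforward _ _ _ _ _ _ mi (mm_meas S) setT (EFin \o f))//; last 2 first.
- exact/measurable_EFinP.
- rewrite preimage_setT; apply: (bcont_integrable (mm_embed_finite iE finZ)).
  exact: bcont_comp.
by apply: eq_measure_integral => B mB _; exact: im.
Qed.

Lemma mm_embed_supp (S Z : mmspace R) (i : S -> Z) x : mm_embed i ->
  supp S x <-> supp Z (i x).
Proof.
move=> [ii i0 im]; have ci := isometric_continuous ii; split => sx U oU Ux.
  rewrite -im; last exact: open_borel.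
  by apply: sx => //; move/continuousP : ci; exact.
have /nbhs_ballP[e /= e0 xU] : nbhs x U by exact: open_nbhs_nbhs.
apply: (@lt_le_trans _ _ (mm_meas Z (ball (i x) e))).
  by apply: sx; [exact: metric_ball_open|exact: ballxx].
rewrite -im; last exact: measurable_ball.
have -> : i @^-1` (ball (i x) e) = ball x e.
  by apply/seteqP; split => y; rewrite /= !ballEmdist /= ii.
by apply: le_measure; rewrite ?inE//; [exact: measurable_ball|exact: open_borel].
Qed.

Lemma meas_rsupp (Z : mmspace R) (B : set (borel Z)) : measurable B ->
  mm_meas Z (B `&` rsupp Z) = mm_meas Z B.
Proof.
move=> mB; have mS := @measurable_rsupp R Z.
apply/eqP; rewrite eq_le; apply/andP; split.
  by apply: le_measure; rewrite ?inE//; exact: measurableI.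
have -> : mm_meas Z B = mm_meas Z ((B `&` rsupp Z) `|` (B `&` ~` rsupp Z)).
  by rewrite -setIUr setUv setIT.
apply: le_trans (measureU2 _ _ _) _.
- exact: measurableI.
- by apply: measurableI => //; exact: measurableC.
rewrite -[leRHS]adde0 leeD2l// -(supp_conull Z).
apply: le_measure; rewrite ?inE//.
- by apply: measurableI => //; exact: measurableC.
- by apply: measurableC; exact: measurable_supp.
by move=> x [_ nx] sx; apply: nx; left.
Qed.

Lemma image_rsupp_val (Z : mmspace R) (B : set Z) :
  (set_val : rsupp_space Z -> Z) @` (set_val @^-1` B) = B `&` rsupp Z.
Proof.
apply/seteqP; split => [_ [x Bx <-]|x [Bx Sx]].
  by split => //; exact/set_mem/(valP x).
by exists (exist _ x (mem_set Sx)).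
Qed.

Lemma mm_embed_rsupp (Z : mmspace R) : mm_embed (set_val : rsupp_space Z -> Z).
Proof.
split => // B mB; rewrite -[RHS]meas_rsupp// -image_rsupp_val.
by [].
Qed.

Lemma mm_embed_restr_rsupp (X : mmspace R) r :
  mm_embed (set_val : mm_restr (rsupp_space X) r -> mm_restr X r).
Proof.
split => // B mB; rewrite !mm_restrE -[RHS]meas_rsupp -?image_rsupp_val//.
by apply: measurableI => //; exact: measurable_cball.
Qed.

(** In (2) supports are taken twice: the spaces are replaced by [rsupp_space], and
    [gromov_hausdorff_weak] takes [rsupp_space] again after the restriction. This map undoes
    both. *)
Definition rsupp_restr (X : mmspace R) r (x : rsupp_space (mm_restr (rsupp_space X) r)) :
  mm_restr X r := set_val (set_val x : mm_restr (rsupp_space X) r).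

Lemma mm_embed_rsupp_restr (X : mmspace R) r : mm_embed (@rsupp_restr X r).
Proof. exact: mm_embed_comp (mm_embed_rsupp _) (mm_embed_restr_rsupp X r). Qed.

Lemma rsupp_restr_surj (X : mmspace R) r x : supp (mm_restr X r) x ->
  exists2 s, supp (mm_restr (rsupp_space X) r) (set_val s) & rsupp_restr s = x.
Proof.
move=> sx; have Sx : rsupp X x by left; have [] := supp_restr sx.
pose y : mm_restr (rsupp_space X) r := exist _ x (mem_set Sx).
have sy : supp (mm_restr (rsupp_space X) r) y.
  by apply/(mm_embed_supp _ (mm_embed_restr_rsupp X r)).
by exists (exist _ y (mem_set (or_introl sy))).
Qed.

Lemma borel_pushforward_Int (S : mmspace R) (E : pmetricType R) (phi : S -> E) (f : E -> R) :
  (mm_meas S setT < +oo)%E -> isometric phi -> bcont f ->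
  (\int[borel_pushforward (mm_meas S) phi]_x (f x)%:E = (Int (f \o phi))%:E)%E.
Proof.
move=> finS ip bf; have cp := isometric_continuous ip.
have mp := continuous_borel_measurable_map cp.
have mf := continuous_borel_measurable bf.1.
rewrite /borel_pushforward integral_pushforward//; last 2 first.
- exact/measurable_EFinP.
- by rewrite preimage_setT; apply: (bcont_integrable finS); exact: bcont_comp.
by rewrite preimage_setT IntE//; exact: bcont_comp.
Qed.

End embeddings.

Section hausdorff.
Context {R : realType} {T : metricType R}.
Implicit Types A B : set T.

Definition close_sets e A B := forall a, A a -> exists2 b, B b & mdist a b < e.

Lemma close_thickening e A B : close_sets e A B -> A `<=` thickening B e.
Proof.
move=> H a /H[b Bb ab]; rewrite /thickening /= /set_dist.
apply: (@le_trans _ _ (mdist a b)%:E); last by rewrite lee_fin ltW.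
by apply: ereal_inf_lbound; exists b.
Qed.

Lemma thickening_close e e' A B : e < e' -> A `<=` thickening B e -> close_sets e' A B.
Proof.
move=> ee' AB a /AB; rewrite /thickening /= /set_dist => h.
have : (set_dist a B < e'%:E)%E by apply: le_lt_trans h _; rewrite lte_fin.
by move=> /ereal_inf_lt[_ [b Bb <-]]; rewrite lte_fin => ab; exists b.
Qed.

Lemma hausdorff_dist_ge0 A B : (0 <= hausdorff_dist A B)%E.
Proof. by apply: le_ereal_inf_tmp => _ [e [e0 _ _] <-]; rewrite lee_fin ltW. Qed.

Lemma hausdorff_cvg0 (An : nat -> set T) A :
  hausdorff_dist (An n) A @[n --> \oo] --> 0%E <->
  forall e, 0 < e -> \forall n \near \oo, close_sets e (An n) A /\ close_sets e A (An n).
Proof.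
split => [H e e0|H].
  have /fine_cvgP[Hf Hc] := H.
  have /cvgrPdist_lt/(_ _ e0) := Hc.
  apply: filterS2 Hf => n fn; rewrite sub0r normrN /= ger0_norm; last first.
    by rewrite fine_ge0// hausdorff_dist_ge0.
  rewrite -lte_fin fineK// => /ereal_inf_lt[_ [d [d0 dA dB] <-]]; rewrite lte_fin => de.
  by split; exact: thickening_close de _.
have small e : 0 < e -> \forall n \near \oo, (hausdorff_dist (An n) A <= e%:E)%E.
  move=> e0; have := H e e0; apply: filterS => n [h1 h2].
  apply: ereal_inf_lbound; exists e => //; split => //; exact: close_thickening.
apply/fine_cvgP; split.
  have := small 1 ltr01; apply: filterS => n h.
  by rewrite ge0_fin_numE ?hausdorff_dist_ge0// (le_lt_trans h)// ltry.
apply/cvgrPdist_le => e e0; have := small e e0; apply: filterS => n h.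
rewrite sub0r normrN /= ger0_norm; last by rewrite fine_ge0// hausdorff_dist_ge0.
by rewrite -lee_fin fineK// ge0_fin_numE ?hausdorff_dist_ge0// (le_lt_trans h)// ltry.
Qed.

End hausdorff.

(** * Convergence in a common space *)

Section preliminaries.
Context {R : realType}.

Lemma tbounded_preimage {S Z : metricType R} (i : S -> Z) (A : set S) (B : set Z) :
  isometric i -> tbounded B -> A `<=` i @^-1` B -> tbounded A.
Proof.
move=> ii tB AB e e0.
have tA : tbounded (i @` A) by apply: tbounded_sub tB => _ [x Ax <-]; exact: AB.
have [s [sA As]] := tA e e0.
have [s' [s'A ss']] : exists s', (forall x, x \in s' -> A x) /\ s = map i s'.
  elim: s sA {As} => [|x s IH] sA; first by exists [::].
  have [|s' [s'A sE]] := IH; first by move=> z zs; apply: sA; rewrite inE zs orbT.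
  have [a Aa ax] := sA x (mem_head _ _).
  exists (a :: s'); rewrite /= ax sE; split => // z; rewrite inE => /predU1P[->//|]; exact: s'A.
exists s'; split => // x Ax; have [? ] := As (i x) (ex_intro2 _ _ x Ax erefl).
by rewrite ss' => /mapP[y ys ->]; rewrite ii => xy; exists y.
Qed.

Lemma near_all_seq {T : eqType} (s : seq T) (P : nat -> T -> Prop) :
  (forall x, x \in s -> \forall n \near \oo, P n x) ->
  \forall n \near \oo, forall x, x \in s -> P n x.
Proof.
elim: s => [|x s IH] H; first by near=> n.
have h1 := H x (mem_head _ _).
have h2 : \forall n \near \oo, forall y, y \in s -> P n y.
  by apply: IH => y ys; apply: H; rewrite inE ys orbT.
by apply: filterS2 h1 h2 => n Px Ps y; rewrite inE => /predU1P[->//|]; exact: Ps.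
Unshelve. all: by end_near. Qed.

Lemma limn_einf_gt0P (u : nat -> \bar R) : (0 < limn_einf u)%E <->
  exists2 c : R, 0 < c & \forall n \near \oo, (c%:E <= u n)%E.
Proof.
have ndu : nondecreasing_seq (einfs u) by exact: nondecreasing_einfs.
rewrite limn_einf_lim (cvg_lim _ (ereal_nondecreasing_cvgn ndu))//; split.
  move=> /ereal_sup_gt[_ [n _ <-] un].
  have [c c0 cu] : exists2 c : R, 0 < c & (c%:E <= einfs u n)%E.
    (* The value +oo does occur, for instance when no support point lies in the ball; any positive
       constant is then a lower bound. *)
    case: (einfs u n) un => [x|_|//]; last by exists 1 => //; rewrite leey.
    by rewrite lte_fin => x0; exists x.
  exists c => //; exists n => // m /= nm; apply: (le_trans cu).
  by apply: ereal_inf_lbound; exists m.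
move=> [c c0 [N _ Nu]]; apply: (@lt_le_trans _ _ c%:E); first by rewrite lte_fin.
apply: (@le_trans _ _ (einfs u N)).
  by apply: le_ereal_inf_tmp => _ [m /= Nm <-]; exact: Nu.
by apply: ereal_sup_ubound; exists N.
Qed.

Definition bump {E : metricType R} (p : E) (r : R) (x : E) : R :=
  Num.max 0 (1 - mdist x p / r).

Lemma max0_dist (x y : R) : `|Num.max 0 x - Num.max 0 y| <= `|x - y|.
Proof.
have h1 := ler_norm (x - y); have h2 := ler_norm (y - x); rewrite distrC in h2.
by rewrite ler_norml; case: (leP 0 x) => ?; case: (leP 0 y) => ?; apply/andP; split; lra.
Qed.

Lemma bump_ge0 {E : metricType R} (p : E) r x : 0 <= bump p r x.
Proof. by rewrite /bump le_max lexx. Qed.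

Lemma bump_le1 {E : metricType R} (p : E) r x : 0 < r -> bump p r x <= 1.
Proof. by move=> r0; rewrite /bump ge_max ler01 gerBl divr_ge0 ?mdist_ge0// ltW. Qed.

Lemma bump_eq0 {E : metricType R} (p : E) r x : 0 < r -> r <= mdist x p -> bump p r x = 0.
Proof. by move=> r0 rx; apply/max_idPl; rewrite subr_le0 ler_pdivlMr// mul1r. Qed.

Lemma bump_bcont {E : metricType R} (p : E) r : 0 < r -> bcont (bump p r).
Proof.
move=> r0; split; last by exists 1 => x; rewrite ger0_norm ?bump_le1// bump_ge0.
apply/continuous_mdist => x e e0; exists (e * r); first by rewrite mulr_gt0.
move=> y xy; apply: le_lt_trans (max0_dist _ _) _.
have -> : 1 - mdist x p / r - (1 - mdist y p / r) = (mdist y p - mdist x p) / r by ring.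
rewrite normrM [`|r^-1|]gtr0_norm ?invr_gt0// ltr_pdivrMr//.
apply: le_lt_trans (mdist_quad _ _ _ _) _.
by rewrite mdistxx addr0 metric_sym.
Qed.

Lemma bump_Int_gt0 (S : mmspace R) (p : S) r : (mm_meas S setT < +oo)%E ->
  0 < r -> supp S p -> 0 < Int (bump p r).
Proof.
move=> finS r0 sp; have r20 : 0 < r / 2 by rewrite divr_gt0.
apply: (@lt_le_trans _ _ (2^-1 * fine (mm_meas S (ball p (r / 2))))).
  rewrite mulr_gt0 ?invr_gt0// fine_gt0//; apply/andP; split.
    by apply: sp; [exact: metric_ball_open|exact: ballxx].
  by rewrite -ge0_fin_numE//; apply: meas_fin => //; exact: measurable_ball.
apply: Int_ge_meas => //; [exact: bump_bcont|exact: measurable_ball|exact: bump_ge0|].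
move=> x; rewrite ballEmdist /= => px; rewrite /bump le_max; apply/orP; right.
rewrite lerBrDl -lerBrDr ler_pdivrMr// metric_sym.
by apply: ltW; apply: (lt_le_trans px); lra.
Qed.

Lemma Int_le_meas (S : mmspace R) (f : S -> R) (A : set (borel S)) :
  (mm_meas S setT < +oo)%E -> bcont f -> measurable A ->
  (forall x, 0 <= f x <= 1) -> (forall x, ~ A x -> f x = 0) ->
  ((Int f)%:E <= mm_meas S A)%E.
Proof.
move=> finS bf mA f01 fA; rewrite IntE// -[A in mm_meas S A]setIT -integral_indic//.
apply: ge0_le_integral => //.
- by move=> x _; rewrite lee_fin; have /andP[] := f01 x.
- by apply/measurable_EFinP; apply: continuous_borel_measurable; case: bf.
- by apply/measurable_EFinP; exact: measurable_indic.
move=> x _; rewrite lee_fin indicE; case: (boolP (x \in A)) => [_|/negP xA].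
  by have /andP[] := f01 x.
by rewrite fA// => Ax; apply: xA; rewrite inE.
Qed.

Lemma mm_embed_iint (S Z : mmspace R) (i : S -> Z) m (F : seq Z -> R) : mm_embed i ->
  (mm_meas Z setT < +oo)%E -> ubcs m F ->
  iint m (fun s : seq S => F (map i s)) = iint m F.
Proof.
move=> iE finZ; elim: m F => [//|m IH] F bF /=.
rewrite -[RHS](mm_embed_Int iE)//; last exact: iint_bcont.
congr (Int _); apply/funext => x /=; rewrite -IH//; exact: ubcs_cons.
Qed.

Lemma dmat_isometric (S Z : pmetricType R) (i : S -> Z) (s : seq S) :
  isometric i -> i point = point -> dmat (map i s) = dmat s.
Proof.
move=> ii i0; have E k : nth point (point :: map i s) k = i (nth point (point :: s) k).
  rewrite -[X in X :: _]i0 -map_cons.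
  have [ks|sk] := ltnP k (size (point :: s)); first exact: nth_map.
  by rewrite !nth_default ?size_map.
by apply/funext => j; apply/funext => k; rewrite /dmat !E ii.
Qed.

Lemma near_seq_map (S Z : metricType R) (i : S -> Z) d s s' : isometric i ->
  near_seq d s s' -> near_seq d (map i s) (map i s').
Proof.
by move=> ii; rewrite /near_seq; elim: s s' => [|x s IH] [|y s']//= /andP[xy /IH ->]; rewrite ii xy.
Qed.

Lemma ubcs_map (S Z : metricType R) (i : S -> Z) m (g : seq Z -> R) : isometric i ->
  ubcs m g -> ubcs m (fun s => g (map i s)).
Proof.
move=> ii [[M gM] cg]; split; first by exists M => s sm; apply: gM; rewrite size_map.
move=> e e0; have [d d0 gd] := cg e e0; exists d => // s s' sm s'm ss'.
by apply: gd; rewrite ?size_map//; exact: near_seq_map.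
Qed.

End preliminaries.

Section common_space.
Context {R : realType} (E : pmetricType R).
Variables (Ss : nat -> mmspace R) (S : mmspace R).
Variables (phi_ : forall n, Ss n -> E) (phi : S -> E).
Hypotheses (finSs : forall n, (mm_meas (Ss n) setT < +oo)%E)
  (finS : (mm_meas S setT < +oo)%E)
  (iso_ : forall n, isometric (@phi_ n)) (iso : isometric phi)
  (root_ : forall n, @phi_ n point = point) (root : phi point = point).
Hypothesis weak : forall f : E -> R, bcont f ->
  Int (f \o @phi_ n) @[n --> \oo] --> Int (f \o phi).
Hypothesis close : forall e, 0 < e -> \forall n \near \oo,
  forall x, supp (Ss n) x -> exists2 y, supp S y & mdist (phi_ x) (phi y) < e.
Hypothesis tS : tbounded (supp S).

Lemma weak_mass : mass (Ss n) @[n --> \oo] --> mass S.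
Proof.
have H (Y : mmspace R) (p : Y -> E) : Int ((fun _ : E => 1) \o p) = mass Y.
  by rewrite (Int_cst Y 1) mul1r.
by have := weak (bcont_cst E 1); rewrite (H S phi); under eq_fun do rewrite H.
Qed.

(** One finite net of the limit serves all large n, turning pointwise convergence on the net into
    uniform estimates. *)
Lemma net_close e : 0 < e -> exists s : seq S, (forall y, y \in s -> supp S y) /\
  \forall n \near \oo, forall x, supp (Ss n) x ->
    exists2 y, y \in s & mdist (phi_ x) (phi y) < e.
Proof.
move=> e0; have e20 : 0 < e / 2 by rewrite divr_gt0.
have [s [sS Ss']] := tS e20; exists s; split => //.
apply: filterS (close e20) => n H x /H[y /Ss'[z zs yz] xy]; exists z => //.
apply: le_lt_trans (metric_triangle _ (phi y) _) _.
by rewrite [ltRHS]splitr ltrD// iso.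
Qed.

(** Induction on m. The inner integrals [Gn n] converge to G pointwise by the induction hypothesis,
    and uniformly on the supports because all of them share a modulus of continuity and a finite net
    comes close to every support point. Weak convergence handles the outer integral of G. *)
Lemma common_space_iint m (g : seq E -> R) : ubcs m g ->
  iint m (fun s : seq (Ss n) => g (map (@phi_ n) s)) @[n --> \oo] -->
  iint m (fun s : seq S => g (map phi s)).
Proof.
elim: m g => [|m IH] g ug /=; first exact: cvg_cst.
pose Gn n (e : E) := iint m (fun t : seq (Ss n) => g (e :: map (@phi_ n) t)).
pose G (e : E) := iint m (fun t : seq S => g (e :: map phi t)).
have ug' (Y : mmspace R) (p : Y -> E) e : isometric p -> ubcs m (fun t => g (e :: map p t)).
  by move=> ip; apply: (ubcs_map ip (g := fun t => g (e :: t))); exact: ubcs_cons.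
have Gcv e : Gn n e @[n --> \oo] --> G e by exact: (IH (fun t => g (e :: t)) (ubcs_cons e ug)).
pose M := mass S + 1.
have M0 : 0 < M by rewrite /M ltr_wpDl// mass_ge0.
have M1 : 0 < M ^+ m by rewrite exprn_gt0.
have massM : \forall n \near \oo, mass (Ss n) <= M.
  have /(cvgr_lt (mass S))/(_ M) := weak_mass.
  by rewrite /M ltrDl ltr01 => /(_ isT); apply: filterS => n /ltW.
have modulus (Y : mmspace R) (p : Y -> E) eps d : (mm_meas Y setT < +oo)%E -> isometric p ->
    mass Y <= M -> 0 < d -> (forall s s', size s = m.+1 -> size s' = m.+1 ->
      near_seq d s s' -> `|g s - g s'| < eps) -> forall e e', mdist e e' < d ->
    `|iint m (fun t : seq Y => g (e :: map p t)) -
      iint m (fun t : seq Y => g (e' :: map p t))| <= eps * M ^+ m.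
  move=> finY ip YM d0 gd e e' ee'.
  have eps0 : 0 <= eps.
    apply: (le_trans (normr_ge0 (g (nseq m.+1 e) - g (nseq m.+1 e)))).
    by apply/ltW/gd; rewrite ?size_nseq//; exact: near_seq_refl.
  apply: (@le_trans _ _ (eps * mass Y ^+ m)); last first.
    by rewrite ler_wpM2l// lerXn2r// ?nnegrE ?mass_ge0// ltW.
  apply: iint_dist => //; [exact: ug'|exact: ug'|move=> s sm _].
  apply/ltW/gd; rewrite /= ?size_map ?sm// /near_seq /= ee' /=.
  exact: near_seq_refl.
have bG : bcont G.
  split.
    apply/continuous_mdist => x e e0.
    have [d d0 gd] := ug.2 _ (divr_gt0 (divr_gt0 e0 (ltr0n R 2)) M1); exists d => // y xy.
    have MS : mass S <= M by rewrite /M lerDl.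
    apply: le_lt_trans (modulus S phi _ _ finS iso MS d0 gd x y xy) _.
    by rewrite divfK ?gt_eqF//; lra.
  have [B gB] := ug.1; exists (B * mass S ^+ m) => e.
  have : `|G e - @iint R S m (fun=> 0)| <= B * mass S ^+ m.
    apply: iint_dist => //; [exact: ug'|exact: ubc_cst|].
    by move=> s sm _; rewrite subr0 gB//= size_map sm.
  by rewrite (iint_cst S m 0) mul0r subr0.
have bGn n : bcont (fun x : Ss n => Gn n (phi_ x)).
  exact: (iint_bcont (finSs n) (ubcs_map (@iso_ n) ug)).
have wG := weak bG.
apply/cvgrPdist_lt => e e0.
(* Replacing G by [Gn n] costs two moduli of eps * M ^+ m and one eps from the net, integrated
   against a mass of at most M; eps * K = e / 2 exceeds that total, and the other e / 2 is spent on
   weak convergence. *)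
pose K := 3 * M ^+ m * M + 1 + 3 * M.
have K0 : 0 < K.
  by rewrite /K; have := mulr_gt0 (mulr_gt0 (ltr0n R 3) M1) M0; have := M0; lra.
pose eps := e / 2 / K; have eps0 : 0 < eps by rewrite !divr_gt0.
have [d d0 gd] := ug.2 _ eps0.
have [s [sS sclose]] := net_close d0.
have finite_cv : \forall n \near \oo, forall y, y \in s -> `|G (phi y) - Gn n (phi y)| < eps.
  apply: near_all_seq => y _; have /cvgrPdist_lt/(_ _ eps0) := Gcv (phi y); exact.
have e20 : 0 < e / 2 by rewrite divr_gt0.
have /cvgrPdist_lt/(_ _ e20) wG2 := wG.
near=> n.
have MY : mass (Ss n) <= M by near: n.
have MS : mass S <= M by rewrite /M lerDl.
have -> : Int (fun x : S => iint m (fun t : seq S => g (phi x :: map phi t))) = Int (G \o phi) by [].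
have -> : Int (fun x : Ss n => iint m (fun t : seq (Ss n) => g (phi_ x :: map (@phi_ n) t))) =
  Int (fun x : Ss n => Gn n (phi_ x)) by [].
have bGphi : bcont (fun x : Ss n => G (phi_ x)).
  exact: bcont_comp (isometric_continuous (@iso_ n)) bG.
have step : `|Int (fun x : Ss n => G (phi_ x)) - Int (fun x : Ss n => Gn n (phi_ x))| <=
    (eps * M ^+ m *+ 2 + eps) * mass (Ss n).
  apply: Int_dist => // x sx.
  have [y ys xy] : exists2 y, y \in s & mdist (phi_ x) (phi y) < d.
    by move: x sx {bGphi}; near: n; exact: sclose.
  have h1 := modulus S phi _ _ finS iso MS d0 gd _ _ xy.
  have h2 := modulus (Ss n) (@phi_ n) _ _ (finSs n) (@iso_ n) MY d0 gd _ _ xy.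
  have h3 : `|G (phi y) - Gn n (phi y)| < eps by move: y ys {xy h1 h2}; near: n.
  rewrite -/(G _) -/(G _) in h1; rewrite -/(Gn n _) -/(Gn n _) in h2.
  have -> : G (phi_ x) - Gn n (phi_ x) = (G (phi_ x) - G (phi y)) +
    (G (phi y) - Gn n (phi y)) - (Gn n (phi_ x) - Gn n (phi y)) by ring.
  apply: le_trans (ler_normB _ _) _; have := ler_normD (G (phi_ x) - G (phi y)) (G (phi y) - Gn n (phi y)).
  by rewrite mulr2n; lra.
have w : `|Int (G \o phi) - Int (G \o @phi_ n)| < e / 2 by near: n.
have -> : Int (G \o phi) - Int (fun x : Ss n => Gn n (phi_ x)) =
  (Int (G \o phi) - Int (G \o @phi_ n)) +
  (Int (fun x : Ss n => G (phi_ x)) - Int (fun x : Ss n => Gn n (phi_ x))) by rewrite addrA subrK.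
apply: le_lt_trans (ler_normD _ _) _; rewrite [ltRHS]splitr ltrD//.
apply: (le_lt_trans step); apply: (@le_lt_trans _ _ (eps * (3 * M ^+ m * M + 3 * M))).
  apply: (@le_trans _ _ ((eps * M ^+ m *+ 2 + eps) * M)).
    by rewrite ler_wpM2l// mulr2n; have := mulr_gt0 eps0 M1; lra.
  have -> : (eps * M ^+ m *+ 2 + eps) * M = eps * (2 * M ^+ m * M + M) by rewrite mulr2n; ring.
  rewrite ler_wpM2l ?(ltW eps0)//; have := mulr_gt0 M1 M0; have := M0; lra.
apply: (@lt_le_trans _ _ (eps * K)); last by rewrite /eps divfK// gt_eqF.
by rewrite ltr_pM2l// /K; lra.
Unshelve. all: by end_near. Qed.

Lemma common_space_iint_cvg : iint_cvg Ss S.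
Proof.
move=> m Phi uPhi; have H (Y : mmspace R) (p : Y -> E) : isometric p -> p point = point ->
    iint m (fun s : seq Y => Phi (dmat s)) = iint m (fun s : seq Y => Phi (dmat (map p s))).
  by move=> ip p0; apply: eq_iint => s _; rewrite dmat_isometric.
rewrite (H S phi iso root); under eq_fun do rewrite (H _ _ (@iso_ _) (root_ _)).
apply: (common_space_iint (g := fun s => Phi (dmat s))); exact: ubcs_dmat.
Qed.

(** The ball of radius delta around a point within delta / 2 of a net point y contains everything
    where the bump at y is positive, and the finitely many bump integrals have positive limits. *)
Lemma common_space_lower_mass delta : 0 < delta -> exists2 c, 0 < c &
  \forall n \near \oo, forall x, supp (Ss n) x -> (c%:E <= mm_meas (Ss n) (cball x delta))%E.
Proof.
move=> d0; have d20 : 0 < delta / 2 by rewrite divr_gt0.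
have [s [sS sclose]] := net_close d20.
have [c c0 cs] : exists2 c, 0 < c & forall y, y \in s -> c < Int (bump y (delta / 2)).
  elim: s sS {sclose} => [|y s IH] sS; first by exists 1.
  have [|c c0 cs] := IH; first by move=> z zs; apply: sS; rewrite inE zs orbT.
  have y0 : 0 < Int (bump y (delta / 2)) by apply: bump_Int_gt0 => //; apply: sS; exact: mem_head.
  exists (Num.min c (Int (bump y (delta / 2)) / 2)); first by rewrite lt_min c0 divr_gt0.
  move=> z; rewrite inE => /predU1P[->|/cs h]; last by rewrite gt_min h.
  by rewrite gt_min; apply/orP; right; lra.
exists c => //.
have ev : \forall n \near \oo, forall y, y \in s ->
    c < Int (bump (phi y) (delta / 2) \o @phi_ n).
  apply: near_all_seq => y ys.
  have w := weak (bump_bcont (phi y) d20).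
  have Ey : Int (bump (phi y) (delta / 2) \o phi) = Int (bump y (delta / 2)).
    by congr (Int _); apply/funext => x; rewrite /= /bump iso.
  rewrite Ey in w.
  by have /(cvgr_gt (Int (bump y (delta / 2))))/(_ c (cs y ys)) := w.
near=> n => x sx.
have [y ys xy] : exists2 y, y \in s & mdist (phi_ x) (phi y) < delta / 2.
  by move: x sx; near: n; exact: sclose.
have cy : c < Int (bump (phi y) (delta / 2) \o @phi_ n) by move: y ys {xy}; near: n.
apply: (@le_trans _ _ (Int (bump (phi y) (delta / 2) \o @phi_ n))%:E).
  by rewrite lee_fin ltW.
apply: Int_le_meas => //.
- exact: bcont_comp (isometric_continuous (@iso_ n)) (bump_bcont _ d20).
- exact: measurable_cball.
- by move=> z /=; rewrite bump_ge0 bump_le1.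
move=> z nz /=; apply: bump_eq0 => //; rewrite leNgt; apply/negP => zy; apply: nz.
rewrite /cball /= -(@iso_ n); apply: le_trans (metric_triangle _ (phi y) _) _.
by rewrite [leRHS]splitr lerD// ?ltW// metric_sym.
Unshelve. all: by end_near. Qed.

End common_space.

(** * Closed balls of varying radius *)

Section cut.
Context {R : realType}.

Definition cut (rho t : R) : R := Num.max 0 (Num.min 1 (2 - t / rho)).

Lemma cut_ge0 rho t : 0 <= cut rho t.
Proof. by rewrite /cut le_max lexx. Qed.

Lemma cut_le1 rho t : cut rho t <= 1.
Proof. by rewrite /cut ge_max ler01 ge_min lexx. Qed.

Lemma cut_dist rho s t : 0 < rho -> `|cut rho s - cut rho t| <= `|s - t| / rho.
Proof.
move=> r0; apply: le_trans (max0_dist _ _) _; apply: le_trans (min_dist _ _ _) _.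
have -> : 2 - s / rho - (2 - t / rho) = - ((s - t) / rho) by ring.
by rewrite normrN normrM [`|rho^-1|]gtr0_norm ?invr_gt0.
Qed.

Lemma cut1 rho t : 0 < rho -> t <= rho -> cut rho t = 1.
Proof.
move=> r0 tr; have h : 1 <= 2 - t / rho.
  by rewrite lerBrDl -lerBrDr ler_pdivrMr//; lra.
by rewrite /cut (min_idPl h) (max_idPr ler01).
Qed.

Lemma cut0 rho t : 0 < rho -> 2 * rho <= t -> cut rho t = 0.
Proof.
move=> r0 tr; have h : 2 - t / rho <= 0 by rewrite subr_le0 ler_pdivlMr.
by rewrite /cut; apply/max_idPl; rewrite ge_min h orbT.
Qed.

Lemma ubcm_lipschitz (h : R -> R) K B i j : 0 <= K -> (forall t, `|h t| <= B) ->
  (forall s t, `|h s - h t| <= K * `|s - t|) -> ubcm (fun D => h (D i j)).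
Proof.
move=> K0 hB hK; split; first by exists B => D _; exact: hB.
move=> e e0; have K1 : 0 < K + 1 by rewrite ltr_wpDl.
exists (e / (K + 1)); first by rewrite divr_gt0.
move=> D D' _ _ /(_ i j); rewrite ltr_pdivlMr// => DD'.
apply: le_lt_trans (hK _ _) _; apply: le_lt_trans DD'.
by rewrite mulrC ler_wpM2l// lerDl.
Qed.

Lemma ubcm_cut (rho : R) i j : 0 < rho -> ubcm (fun D => cut rho (D i j)).
Proof.
move=> r0; apply: (@ubcm_lipschitz _ rho^-1 1); first by rewrite invr_ge0 ltW.
  by move=> t; rewrite ger0_norm ?cut_le1 ?cut_ge0.
by move=> s t; rewrite mulrC; exact: cut_dist.
Qed.

(** A distance is not a bounded function of the matrix; clamping makes it a test function, and
    [clamp_id] recovers it for points of a ball. *)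
Lemma ubcm_clamp (B : R) i j : 0 <= B -> ubcm (fun D => Num.max (- B) (Num.min B (D i j))).
Proof.
move=> B0; apply: (@ubcm_lipschitz (fun t => Num.max (- B) (Num.min B t)) 1 B) => //.
  by move=> t; rewrite ler_norml le_max lexx ge_max ge_min lexx /= andbT; lra.
by move=> s t; rewrite mul1r; exact: clamp_dist.
Qed.

Lemma clamp_id (B t : R) : 0 <= t <= B -> Num.max (- B) (Num.min B t) = t.
Proof.
by move=> /andP[t0 tB]; rewrite (min_idPr tB); apply/max_idPr; lra.
Qed.

Lemma cut_bcont {T : metricType R} (p : T) rho : 0 < rho -> @bcont R T (fun x => cut rho (mdist p x)).
Proof.
move=> r0; split; last by exists 1 => x; rewrite ger0_norm ?cut_le1 ?cut_ge0.
apply/continuous_mdist => x e e0; exists (e * rho); first by rewrite mulr_gt0.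
move=> y xy; apply: le_lt_trans (cut_dist _ _ r0) _; rewrite ltr_pdivrMr//.
apply: le_lt_trans (mdist_quad _ _ _ _) _.
by rewrite mdistxx add0r.
Qed.

End cut.

(** * Dependence of restrictions on the radius *)

Section restriction_integral.
Context {R : realType} (X : mmspace R).
Hypothesis bfX : boundedly_finite X.

(** The measure on the larger ball is the one on the smaller ball plus the one on the shell between
    them, and f gains at most the mass of the shell. *)
Lemma Int_restr_mono (f : X -> R) r r' : r <= r' -> bcont f -> (forall x, 0 <= f x <= 1) ->
  @Int R (mm_restr X r) f <= @Int R (mm_restr X r') f /\
  @Int R (mm_restr X r') f <= @Int R (mm_restr X r) f + (mass (mm_restr X r') - mass (mm_restr X r)).
Proof.
move=> rr' bf f01.
have mD : measurable (cball point r' `\` cball point r : set (borel X)).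
  by apply: measurableD; exact: measurable_cball.
pose m2 : {measure set (borel X) -> \bar R} := mrestr (mm_meas X) mD.
pose m12 : {measure set (borel X) -> \bar R} := measure_add (mm_meas (mm_restr X r)) m2.
have E (A : set (borel X)) : measurable A -> A `<=` setT -> mm_meas (mm_restr X r') A = m12 A.
  move=> mA _; have -> : m12 A = (mm_meas (mm_restr X r) A + m2 A)%E by exact: measure_addE.
  have -> : m2 A = mm_meas X (A `&` (cball point r' `\` cball point r)) by [].
  rewrite !mm_restrE -measureU; last 3 first.
  - by apply: measurableI => //; exact: measurable_cball.
  - exact: measurableI.
  - by apply/seteqP; split => // x [[_ h] [_ [_ /(_ h)]]].
  congr (mm_meas X _); rewrite -setIUr; congr (_ `&` _).
  apply/seteqP; split => [x h|x [h|[]//]].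
    by have [|] := pselect (cball point r x); [left|right].
  exact: le_trans h rr'.
have f0 x : 0 <= f x by have /andP[] := f01 x.
have mf : measurable_fun setT (f : borel X -> R) by apply: continuous_borel_measurable; case: bf.
have finr := mm_restr_finite r bfX; have finr' := mm_restr_finite r' bfX.
have S (g : X -> R) : bcont g -> (forall x, 0 <= g x) -> (@Int R (mm_restr X r') g)%:E =
    ((@Int R (mm_restr X r) g)%:E + \int[m2]_x (g x)%:E)%E.
  move=> bg g0; rewrite !IntE// (eq_measure_integral m12)//.
  rewrite ge0_integral_measure_add//.
    by move=> x _; rewrite lee_fin.
  by apply/measurable_EFinP; apply: continuous_borel_measurable; case: bg.
have m2E : (mass (mm_restr X r') - mass (mm_restr X r))%:E = m2 setT.
  have := S (fun _ => 1) (bcont_cst _ 1) (fun _ => ler01).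
  rewrite !(@Int_cst R) !mul1r integral_cst// mul1e EFinB => ->.
  by rewrite [X in (X - _)%E]addeC addeK.
split; first by rewrite -lee_fin (S f)// leeDl// integral_ge0// => x _; rewrite lee_fin.
rewrite -lee_fin EFinD (S f)// leeD2l// m2E.
apply: (@le_trans _ _ (\int[m2]_x (1 : \bar R))%E).
  apply: ge0_le_integral => //.
  - by move=> x _; rewrite lee_fin.
  - exact/measurable_EFinP.
  - by move=> x _; rewrite lee_fin; have /andP[] := f01 x.
by rewrite integral_cst// mul1e.
Qed.

(** Continuity from above: the closed balls of radius r + 1/(k+1) have finite mass and decrease to
    the closed ball of radius r. *)
Lemma mass_restr_right r eta : 0 < eta -> exists2 r1, r < r1 &
  forall r', r < r' < r1 -> mass (mm_restr X r') - mass (mm_restr X r) < eta.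
Proof.
move=> eta0; pose F k : set (borel X) := cball point (r + k.+1%:R^-1).
have mF k : measurable (F k) by exact: measurable_cball.
have FE : \bigcap_k F k = cball point r.
  apply/seteqP; split => [x Fx|x xr k _]; last first.
    by apply: (le_trans xr); rewrite lerDl.
  rewrite /cball /=; apply/ler_addgt0Pr => e e0.
  have := @near_infty_natSinv_lt R (PosNum e0) => /filter_ex[k /= ke].
  by apply: (le_trans (Fx k Logic.I)); rewrite lerD2l ltW.
have := @nonincreasing_cvg_mu _ _ _ (mm_meas X) F.
have F0 : (mm_meas X (F 0%N) < +oo)%E by apply: bfX => //; exact: bounded_cball.
have decF : nonincreasing_seq F.
  move=> m n mn; apply/subsetPset => x xF; apply: (le_trans xF).
  by rewrite lerD2l lef_pV2 ?posrE// ler_nat.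
move=> /(_ F0 mF _ decF); rewrite FE => /(_ (measurable_cball _ _)).
have massE' s : mm_meas X (cball point s) = (mass (mm_restr X s))%:E.
  by rewrite (massE (mm_restr_finite s bfX)) mm_restrE setTI.
rewrite massE' => /fine_cvgP[_] /cvgrPdist_lt/(_ _ eta0) /filter_ex[k].
rewrite /= /F massE' /= => h; exists (r + k.+1%:R^-1); first by rewrite ltrDl.
move=> r' /andP[rr' r'k]; move: h; rewrite distrC; apply: le_lt_trans.
apply: le_trans (ler_norm _); rewrite lerD2r.
rewrite -lee_fin -!massE'; apply: le_measure; rewrite ?inE; [exact: measurable_cball|exact: measurable_cball|].
by move=> x xr'; apply: (le_trans xr'); exact: ltW.
Qed.

(* Each exceptional radius [r] is the last one for which some ball of a
   countable base has no mass in the closed ball of radius [r]. *)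
Lemma countable_supp_restr :
  countable [set r : R | exists x, [/\ supp X x, mdist point x <= r & ~ supp (mm_restr X r) x]].
Proof.
have [s ds] := dense_sequence X.
pose U (p : nat * nat) : set X := ball (s p.1) p.2.+1%:R^-1.
pose P r p := mm_meas X (U p `&` cball point r) = 0%E /\
  forall r', r < r' -> (0 < mm_meas X (U p `&` cball point r'))%E.
have inj r r' p : r < r' -> P r p -> P r' p -> False.
  by move=> rr' [_ /(_ _ rr')] + [h _]; rewrite h ltxx.
have ex r : (exists x, [/\ supp X x, mdist point x <= r & ~ supp (mm_restr X r) x]) ->
    exists p, P r p.
  move=> [x [sx xr /existsNP[V /not_implyP[oV /not_implyP[Vx /negP]]]]].
  rewrite -leNgt mm_restrE => V0.
  have /nbhs_ballP[e /= e0 xV] : nbhs x V by exact: open_nbhs_nbhs.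
  have e20 : 0 < e / 2 by rewrite divr_gt0.
  have := @near_infty_natSinv_lt R (PosNum e20) => /filter_ex[k /= ke].
  have k0 : 0 < k.+1%:R^-1 :> R by rewrite invr_gt0.
  have [i xi] := ds x _ k0; exists (i, k).
  have Ux : U (i, k) x by rewrite /U ballEmdist /= metric_sym.
  have mU r0 : measurable (U (i, k) `&` cball point r0 : set (borel X)).
    by apply: measurableI; [exact: measurable_ball|exact: measurable_cball].
  split.
    apply/eqP; rewrite eq_le measure_ge0 andbT; apply: le_trans V0.
    apply: le_measure; rewrite ?inE//.
      by apply: measurableI; [exact: open_borel|exact: measurable_cball].
    move=> y [Uy yr]; split => //; apply: xV; rewrite ballEmdist /=.
    move: Uy; rewrite /U ballEmdist /= => Uy.
    apply: le_lt_trans (metric_triangle _ (s i) _) _.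
    by rewrite [ltRHS]splitr ltrD// (lt_trans _ ke).
  move=> r' rr'.
  have oW : open (U (i, k) `&` ball (point : X) r').
    by apply: openI; exact: metric_ball_open.
  have Wx : (U (i, k) `&` ball (point : X) r') x.
    by split => //; rewrite ballEmdist /=; exact: le_lt_trans rr'.
  apply: lt_le_trans (sx _ oW Wx) _; apply: le_measure; rewrite ?inE//.
    by apply: measurableI; exact: measurable_ball.
  by move=> y [Uy]; rewrite ballEmdist /= => /ltW.
apply/countable_injP; exists (fun r => pickle (xget (0%N, 0%N) [set p | P r p])).
move=> r r'; rewrite !inE => /ex rP /ex r'P /(pcan_inj pickleK_inv) E.
have h1 : P r (xget (0%N, 0%N) [set p | P r p]).
  by have [p Pp] := rP; exact: (@xgetPex _ _ [set p | P r p]).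
have h2 : P r' (xget (0%N, 0%N) [set p | P r' p]).
  by have [p Pp] := r'P; exact: (@xgetPex _ _ [set p | P r' p]).
rewrite E in h1; have [rr'|r'r|//] := ltgtP r r'.
  by have := inj _ _ _ rr' h1 h2.
by have := inj _ _ _ r'r h2 h1.
Qed.

(** Near-covering along r1 decreasing to r: around a support point within r the point itself serves
    as a, by the hypothesis on r, and around a point beyond r the claim is vacuous once r1 is close
    to r. *)
Lemma supp_restr_right r e : compact (supp X `&` cball point (r + 1)) ->
  (forall x, supp X x -> mdist point x <= r -> supp (mm_restr X r) x) -> 0 < e ->
  exists2 r1, r < r1 & forall x, supp X x -> mdist point x <= r1 ->
    exists2 a, supp (mm_restr X r) a & mdist x a < e.
Proof.
move=> /compact_near_coveringP cK good e0.
pose P r1 (x : X) := mdist point x <= r1 -> exists2 a, supp (mm_restr X r) a & mdist x a < e.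
have : \forall r1 \near r^'+, (supp X `&` cball point (r + 1)) `<=` P r1.
  apply: cK => x [sx _]; have [xr|rx] := leP (mdist point x) r.
    exists (ball x e, setT) => /=.
      by split; [exact: nbhsx_ballx|exact: filterT].
    move=> [z r1] /= [xz _] _; exists x; first exact: good.
    by move: xz; rewrite ballEmdist /= metric_sym.
  pose m := (mdist point x - r) / 2; have m0 : 0 < m by rewrite divr_gt0// subr_gt0.
  exists (ball x m, [set r1 | r < r1 < r + m]) => /=.
    split; first exact: nbhsx_ballx.
    near=> r1; apply/andP; split; near: r1; first exact: nbhs_right_gt.
    by apply: nbhs_right_lt; rewrite ltrDl.
  move=> [z r1] /= [xz /andP[_ r1m]] zr1; exfalso.
  move: xz; rewrite ballEmdist /= metric_sym => zx.
  have := metric_triangle point z x; rewrite /m in zx r1m *; lra.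
move=> H; have /filter_ex[r1 [rr1 r11 Hr1]] : \forall r1 \near r^'+,
    [/\ r < r1, r1 < r + 1 & (supp X `&` cball point (r + 1)) `<=` P r1].
  near=> r1; split; near: r1 => //; first exact: nbhs_right_gt.
  by apply: nbhs_right_lt; rewrite ltrDl.
exists r1 => // x sx xr1; apply: Hr1 => //; split => //.
by apply: (le_trans xr1); exact: ltW.
Unshelve. all: by end_near. Qed.

End restriction_integral.

Lemma countable_avoid {R : realType} (B : set R) (a b : R) : countable B -> a < b ->
  exists r, a < r < b /\ ~ B r.
Proof.
move=> cB ab; apply: contrapT => no.
have sub : `]a, b[%classic `<=` B.
  by move=> r; rewrite /= in_itv /= => arb; apply: contrapT => nB; apply: no; exists r.
have := countable_lebesgue_measure0 (sub_countable (subset_card_le sub) cB).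
by rewrite lebesgue_measure_itv /= lte_fin ab -EFinB => /eqP; rewrite eqe subr_eq0 gt_eqF.
Qed.

(** * Consequences of the lower mass bound *)

Lemma countable_setU {T : Type} (A B : set T) :
  countable A -> countable B -> countable (A `|` B).
Proof.
move=> cA cB; have -> : A `|` B = \bigcup_(b in [set: bool]) (if b then A else B).
  apply/seteqP; split => [x [Ax|Bx]|x [[] _ ?]]; [by exists true|by exists false|by left|by right].
by apply: bigcup_countable => // -[].
Qed.

Section gromov_vague_lower_mass.
Context {R : realType} (X : mmspace R) (Xs : nat -> mmspace R).
Hypotheses (bfX : boundedly_finite X) (bfXs : forall n, boundedly_finite (Xs n)).
Hypothesis vague : gromov_vague Xs X.
Hypothesis lower : forall delta r : R, 0 < delta -> 0 < r -> exists2 c, 0 < c &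
  \forall n \near \oo, forall x, supp (Xs n) x -> mdist point x < r ->
    (c%:E <= mm_meas (Xs n) (cball x delta))%E.

Lemma vague_radius (B : set R) a b : countable B -> 0 <= a -> a < b ->
  exists r, [/\ a < r < b, ~ B r &
    iint_cvg (fun n => mm_restr (Xs n) r) (mm_restr X r)].
Proof.
move=> cB a0 ab.
have [r [/andP[ar rb] nB]] := countable_avoid (countable_setU cB vague) ab.
exists r; split; [by rewrite ar|by move=> Br; apply: nB; left|].
apply: gromov_weak_iint => [n||]; [exact: mm_restr_finite|exact: mm_restr_finite|].
apply: contrapT => nw; apply: nB; right; split => //; exact: le_lt_trans ar.
Qed.

Lemma dfun_cut1 (Y : mmspace R) (x : Y) rho :
  dfun 1 (fun D => cut rho (D 1%N 2)) [:: x] = Int (fun w => cut rho (mdist x w)).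
Proof. by []. Qed.

(** The one-point list x is matched by some z of [Xs n] with almost the same distance to the root
    and almost the same integral of the cutoff centred at it. As the cutoff is 1 up to delta / 2 and
    0 from delta on, the bound at z for radius delta / 2 becomes one at x for radius delta. *)
Lemma limit_lower_mass delta r : 0 < delta -> 0 < r -> exists2 c, 0 < c &
  forall x, supp X x -> mdist point x <= r -> (c%:E <= mm_meas X (cball x delta))%E.
Proof.
move=> d0 r0; pose d := delta / 2; have d'0 : 0 < d by rewrite divr_gt0.
have r10 : 0 < r + 1 by rewrite addr_gt0.
have [c c0 cn] := lower d'0 r10; exists (c / 2); first by rewrite divr_gt0.
move=> x sx xr.
have a0 : 0 <= r + 1 + d by rewrite !addr_ge0// ltW.
have ab : r + 1 + d < r + 1 + d + 1 by rewrite ltrDl.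
have [r' [/andP[rr' _] _ cv]] := vague_radius (@countable0 R) a0 ab.
pose k (b : bool) := if b then 1%N else 0%N.
(* Since x is within r of the root and the error is below 1, a clamped value of r + 2 is impossible
   for z; clamping is thus harmless and z lies within r + 1. *)
pose B := r + 2.
have B0 : 0 <= B by rewrite /B addr_ge0// ltW.
pose Psi (b : bool) (D : nat -> nat -> R) :=
  if b then cut d (D 1%N 2) else Num.max (- B) (Num.min B (D 0%N 1%N)).
have uPsi b : ubcm (Psi b) by case: b; [exact: ubcm_cut|exact: ubcm_clamp].
have sy y : y \in [:: x] -> supp (mm_restr X r') y.
  by rewrite inE => /eqP ->; apply: supp_restr_lt => //; lra.
have eta0 : 0 < Num.min 1 (c / 2) by rewrite lt_min ltr01 divr_gt0.
have finr n := mm_restr_finite r' (@bfXs n).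
have H := matching k finr (mm_restr_finite r' bfX) cv uPsi sy eta0.
have [n [[zs [zs1 szs zsV]] cz]] := filter_ex (filterI H cn).
case: zs zs1 szs zsV => [//|z [|//]] _ sz zV.
have {}sz : supp (mm_restr (Xs n) r') z by apply: sz; rewrite inE.
have [sz' zr'] := supp_restr sz.
have zr : mdist point z < r + 1.
  have := zV false; rewrite /dfun /= /dmat /=.
  rewrite (@clamp_id _ B (mdist point x)); last by rewrite mdist_ge0 /B; lra.
  rewrite lt_min => /andP[+ _].
  have [zB|] := boolP (mdist point z <= B).
    by rewrite clamp_id ?mdist_ge0// ltr_norml; lra.
  rewrite -ltNge => Bz; rewrite (min_idPl (ltW Bz)) (max_idPr _); last by lra.
  by rewrite ltr_norml /B; lra.
have := zV true; rewrite !dfun_cut1 lt_min => /andP[_].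
set V := Int _; set W := Int _ => VW.
have cV : c <= V.
  rewrite -[c]mul1r.
  apply: (@le_trans _ _ (1 * fine (mm_meas (mm_restr (Xs n) r') (cball z d)))); last first.
    apply: Int_ge_meas => //; [exact: cut_bcont|exact: measurable_cball| |].
      by move=> w; exact: cut_ge0.
    by move=> w zw; rewrite cut1.
  rewrite !mul1r -lee_fin fineK; last first.
    by apply: meas_fin; [exact: finr|exact: measurable_cball].
  rewrite mm_restrE (_ : _ `&` _ = cball z d); first exact: cz.
  apply/setIidPl => w zw; apply: le_trans (metric_triangle _ z _) _.
  by move: zw; rewrite /cball /=; lra.
have WX : (W%:E <= mm_meas X (cball x delta))%E.
  apply: (@le_trans _ _ (mm_meas (mm_restr X r') (cball x delta))); last first.
    rewrite mm_restrE; apply: le_measure; rewrite ?inE; last exact: subIsetl.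
      by apply: measurableI; exact: measurable_cball.
    exact: measurable_cball.
  apply: Int_le_meas.
  - exact: mm_restr_finite.
  - exact: cut_bcont.
  - exact: measurable_cball.
  - by move=> w; rewrite cut_ge0 cut_le1.
  move=> w nw; apply: cut0 => //; rewrite leNgt; apply/negP => xw; apply: nw.
  by rewrite /cball /=; move: xw; rewrite /d; lra.
apply: le_trans WX; rewrite lee_fin.
by move: VW; rewrite ltr_norml; lra.
Qed.

(** Balls around a dense sequence exhaust the finite mass, so finitely many of them leave less than
    c uncovered. A ball with mass at least c around a support point must then meet one of these. *)
Lemma tbounded_supp r : tbounded (supp X `&` cball point r).
Proof.
apply: tbounded_ext => e e0.
pose d := e / 4; have d0 : 0 < d by rewrite divr_gt0.
pose r1 := `|r| + 1; have r10 : 0 < r1 by rewrite ltr_wpDl.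
have [c c0 cX] := limit_lower_mass d0 r10.
have [s ds] := dense_sequence X.
pose Y := mm_restr X (r1 + d).
pose F (k : nat) : set (borel X) := ~` \big[setU/set0]_(i < k) ball (s i) d.
have mF k : measurable (F k).
  by apply: measurableC; apply: bigsetU_measurable => i _; exact: measurable_ball.
have decF : nonincreasing_seq F.
  move=> m n mn; apply/subsetPset; apply: subsetC.
  exact: (@subset_bigsetU _ (fun i => ball (s i) d)).
have F0 : (mm_meas Y (F 0%N) < +oo)%E.
  apply: le_lt_trans (mm_restr_finite (r1 + d) bfX).
  by apply: le_measure; rewrite ?inE.
have capF : \bigcap_k F k = set0.
  rewrite -subset0 => x Fx; have [n xn] := ds x d d0.
  apply: (Fx n.+1 Logic.I); rewrite -(bigcup_mkord n.+1 (fun i => ball (s i) d)).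
  by exists n => //=; rewrite ballEmdist /= metric_sym.
have := @nonincreasing_cvg_mu _ _ _ (mm_meas Y) F F0 mF _ decF.
rewrite capF measure0 => /(_ measurable0) /fine_cvgP[finF] /cvgrPdist_lt/(_ _ c0) cvF.
have [k [fk]] := filter_ex (filterI finF cvF).
rewrite sub0r normrN /= ger0_norm ?fine_ge0// => Fkc.
exists [seq s i | i <- iota 0 k] => x [sx xr].
have : exists w, cball x d w /\ ~ F k w.
  apply: contrapT => no.
  have sub : cball x d `<=` F k.
    by move=> w xw; apply: contrapT => nF; apply: no; exists w.
  have xr1 : mdist point x <= r1.
    by apply: (le_trans xr); rewrite /r1; have := ler_norm r; lra.
  have := cX x sx xr1; apply/negP; rewrite -ltNge.
  apply: (@le_lt_trans _ _ (mm_meas Y (F k))); last by have /= <- := fineK fk; rewrite lte_fin.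
  apply: (@le_trans _ _ (mm_meas Y (cball x d))).
    rewrite /Y mm_restrE (_ : _ `&` _ = cball x d)//.
    apply/setIidPl => w xw; apply: le_trans (metric_triangle _ x _) _.
    by apply: lerD.
  by apply: le_measure; rewrite ?inE//; exact: measurable_cball.
move=> [w [xw]]; rewrite /F => /contrapT; rewrite -(bigcup_mkord k (fun i => ball (s i) d)).
move=> [i /= ik]; rewrite ballEmdist /= => iw; exists (s i).
  by apply/mapP; exists i => //; rewrite mem_iota.
apply: le_lt_trans (metric_triangle _ w _) _; rewrite (metric_sym w).
by move: xw iw; rewrite /cball /= /d; lra.
Qed.

Lemma compact_supp r : compact (supp X `&` cball point r).
Proof.
apply: tbounded_compact; last exact: tbounded_supp.
by apply: closedI; [exact: closed_supp|exact: closed_cball].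
Qed.

End gromov_vague_lower_mass.

Section partition.
Context {R : realType}.

(* A partition of unity subordinate to the balls of radius [2 rho] around N
   points, as a function of the distances [t] to these points; the last member
   [pou_rest] lives off the balls of radius [rho]. *)
Definition pou_rest (rho : R) (N : nat) (t : nat -> R) : R :=
  \prod_(j < N) (1 - cut rho (t j)).

Definition pou (rho : R) (i : nat) (t : nat -> R) : R :=
  cut rho (t i) * pou_rest rho i t.

Lemma pou_sum rho N t : \sum_(i < N) pou rho i t + pou_rest rho N t = 1.
Proof.
elim: N => [|N IH]; first by rewrite big_ord0 /pou_rest big_ord0 add0r.
rewrite big_ord_recr /= -addrA /pou.
have -> : pou_rest rho N.+1 t = pou_rest rho N t * (1 - cut rho (t N)).
  by rewrite /pou_rest big_ord_recr.
have -> : cut rho (t N) * pou_rest rho N t + pou_rest rho N t * (1 - cut rho (t N)) =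
  pou_rest rho N t by ring.
exact: IH.
Qed.

Lemma pou_rest_ge0 rho N t : 0 <= pou_rest rho N t.
Proof. by apply: prodr_ge0 => j _; rewrite subr_ge0 cut_le1. Qed.

Lemma pou_rest_le1 rho N t : pou_rest rho N t <= 1.
Proof. by apply: prodr_ile1 => j _; rewrite subr_ge0 cut_le1 gerBl cut_ge0. Qed.

Lemma pou_ge0 rho i t : 0 <= pou rho i t.
Proof. by rewrite mulr_ge0 ?cut_ge0 ?pou_rest_ge0. Qed.

Lemma pou_le1 rho i t : pou rho i t <= 1.
Proof. by rewrite mulr_ile1 ?cut_ge0 ?cut_le1 ?pou_rest_ge0 ?pou_rest_le1. Qed.

Lemma pou_rest_eq0 rho N t i : 0 < rho -> (i < N)%N -> t i <= rho -> pou_rest rho N t = 0.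
Proof.
by move=> r0 iN ti; rewrite /pou_rest (bigD1 (Ordinal iN))//= cut1// subrr mul0r.
Qed.

Lemma pou_rest_eq1 rho N t : 0 < rho -> (forall i, (i < N)%N -> 2 * rho <= t i) ->
  pou_rest rho N t = 1.
Proof.
by move=> r0 tN; rewrite /pou_rest big1// => i _; rewrite cut0 ?subr0//; exact: tN.
Qed.

Lemma pou_eq0 rho i t : 0 < rho -> 2 * rho <= t i -> pou rho i t = 0.
Proof. by move=> r0 ti; rewrite /pou cut0// mul0r. Qed.

Lemma ubcm_pou_rest rho N (f : nat -> nat * nat) : 0 < rho ->
  ubcm (fun D => pou_rest rho N (fun j => D (f j).1 (f j).2)).
Proof.
move=> r0; elim: N => [|N IH].
  by under [X in ubcm X]eq_fun do rewrite /pou_rest big_ord0; exact: ubc_cst.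
under [X in ubcm X]eq_fun do rewrite /pou_rest big_ord_recr /=.
apply: (ubcM (@near_mat_mono _)); first exact: IH.
by apply: (ubcB (@near_mat_mono _)); [exact: ubc_cst|exact: ubcm_cut].
Qed.

Lemma ubcm_pou rho i (f : nat -> nat * nat) : 0 < rho ->
  ubcm (fun D => pou rho i (fun j => D (f j).1 (f j).2)).
Proof.
by move=> r0; apply: (ubcM (@near_mat_mono _)); [exact: ubcm_cut|exact: ubcm_pou_rest].
Qed.

Definition dist_to {T : pmetricType R} (z : seq T) (w : T) (j : nat) : R :=
  mdist (nth point z j) w.

Lemma pou_rest_bcont {T : pmetricType R} rho N (z : seq T) : 0 < rho ->
  bcont (fun w : T => pou_rest rho N (dist_to z w)).
Proof.
move=> r0; elim: N => [|N IH].
  by under [X in bcont X]eq_fun do rewrite /pou_rest big_ord0; exact: bcont_cst.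
under [X in bcont X]eq_fun do rewrite /pou_rest big_ord_recr /=.
by apply: bcontM => //; apply: bcontB; [exact: bcont_cst|exact: cut_bcont].
Qed.

Lemma pou_bcont {T : pmetricType R} rho i (z : seq T) : 0 < rho ->
  bcont (fun w : T => pou rho i (dist_to z w)).
Proof. by move=> r0; apply: bcontM; [exact: cut_bcont|exact: pou_rest_bcont]. Qed.

Definition weight (Y : mmspace R) (rho : R) (z : seq Y) (i : nat) : R :=
  Int (fun w : Y => pou rho i (dist_to z w)).

Definition weight_rest (Y : mmspace R) (rho : R) (z : seq Y) : R :=
  Int (fun w : Y => pou_rest rho (size z) (dist_to z w)).

Lemma Int_sum (Y : mmspace R) N (f : nat -> Y -> R) : (mm_meas Y setT < +oo)%E ->
  (forall i, bcont (f i)) ->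
  bcont (fun w => \sum_(i < N) f i w) /\
  Int (fun w => \sum_(i < N) f i w) = \sum_(i < N) Int (f i).
Proof.
move=> finY bf; elim: N => [|N [bN IH]].
  under [X in bcont X]eq_fun do rewrite big_ord0.
  split; first exact: bcont_cst.
  rewrite big_ord0 (_ : (fun _ => _) = fun=> 0) ?(Int_cst Y 0) ?mul0r//.
  by apply/funext => w; rewrite big_ord0.
under [X in bcont X]eq_fun do rewrite big_ord_recr /=.
split; first exact: bcontD.
rewrite big_ord_recr /= -IH -IntD//.
by congr (Int _); apply/funext => w; rewrite big_ord_recr.
Qed.

(** On each member of the partition g is almost constant, and on the remainder it is at most B. The
    constants c are free, so that two spaces can be compared through the same ones. *)
Lemma pou_estimate (Y : mmspace R) (rho kap B : R) (z : seq Y) (g : Y -> R) (c : nat -> R) :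
  (mm_meas Y setT < +oo)%E -> 0 < rho -> 0 <= kap -> bcont g -> (forall w, `|g w| <= B) ->
  (forall w i, supp Y w -> (i < size z)%N -> mdist (nth point z i) w < 2 * rho ->
    `|g w - c i| <= kap) ->
  `|Int g - \sum_(i < size z) c i * weight rho z i| <= kap * mass Y + B * weight_rest rho z.
Proof.
move=> finY r0 k0 bg gB gc; set N := size z.
have bp i : bcont (fun w : Y => pou rho i (dist_to z w)) by exact: pou_bcont.
have br : bcont (fun w : Y => pou_rest rho N (dist_to z w)) by exact: pou_rest_bcont.
have [bS IS] := Int_sum N finY (fun i => bcontM (bcont_cst Y (c i)) (bp i)).
have -> : \sum_(i < N) c i * weight rho z i =
    Int (fun w => \sum_(i < N) c i * pou rho i (dist_to z w)).
  by rewrite IS; apply: eq_bigr => i _; rewrite -IntZ.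
have -> : kap * mass Y + B * weight_rest rho z =
    Int (fun w : Y => kap + B * pou_rest rho N (dist_to z w)).
  rewrite IntD// ?(Int_cst Y kap) ?IntZ//; first exact: bcont_cst.
  by apply: bcontM => //; exact: bcont_cst.
have bR : bcont (fun w : Y => kap + B * pou_rest rho N (dist_to z w)).
  by apply: bcontD; [exact: bcont_cst|apply: bcontM => //; exact: bcont_cst].
have pt w : supp Y w -> `|g w - \sum_(i < N) c i * pou rho i (dist_to z w)| <=
    kap + B * pou_rest rho N (dist_to z w).
  move=> sw; have S1 := pou_sum rho N (dist_to z w).
  have -> : g w - \sum_(i < N) c i * pou rho i (dist_to z w) =
      \sum_(i < N) (g w - c i) * pou rho i (dist_to z w) + g w * pou_rest rho N (dist_to z w).
    rewrite -[g w in LHS]mulr1 -S1 mulrDr mulr_sumr addrAC; congr (_ + _).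
    by rewrite -sumrB; apply: eq_bigr => i _; rewrite mulrBl.
  apply: le_trans (ler_normD _ _) _; rewrite lerD//; last first.
    by rewrite normrM (ger0_norm (pou_rest_ge0 _ _ _)) ler_wpM2r ?pou_rest_ge0.
  apply: le_trans (ler_norm_sum _ _ _) _.
  apply: (@le_trans _ _ (\sum_(i < N) kap * pou rho i (dist_to z w))).
    apply: ler_sum => i _; rewrite normrM (ger0_norm (pou_ge0 _ _ _)).
    have [close|far] := ltP (mdist (nth point z i) w) (2 * rho).
      by rewrite ler_wpM2r ?pou_ge0// gc.
    by rewrite pou_eq0// !mulr0.
  rewrite -mulr_sumr -[leRHS]mulr1 ler_wpM2l//.
  by rewrite -S1 lerDl pou_rest_ge0.
rewrite -IntB// ler_norml; apply/andP; split.
  rewrite -[X in - X <= _]mul1r -mulNr -IntZ//; apply: Int_le => //.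
  - by apply: bcontM => //; exact: bcont_cst.
  - exact: bcontB.
  by move=> w /pt; rewrite ler_norml mulN1r => /andP[].
by apply: Int_le => //; [exact: bcontB|move=> w /pt; rewrite ler_norml => /andP[]].
Qed.

End partition.

(** * Matched nets and the common space *)

Section matched_nets.
Context {R : realType} (X : mmspace R) (Xs : nat -> mmspace R).
Hypotheses (bfX : boundedly_finite X) (bfXs : forall n, boundedly_finite (Xs n)).

(** Index 0 of [dmat] makes the second condition cover the distances to the root. The points of z
    may lie slightly outside the ball of radius r, as they are found at a larger radius. *)
Definition matched (r e : R) n (y : seq X) (z : seq (Xs n)) :=
  [/\ size z = size y,
    forall i j, `|dmat z i j - dmat y i j| <= e,
    forall x, x \in y -> supp (mm_restr X r) x &
    forall x, supp (mm_restr (Xs n) r) x -> exists2 a, a \in z & mdist x a < 5 * e] /\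
  [/\ \sum_(i < size y) `|@weight R (mm_restr (Xs n) r) (2 * e) z i -
        @weight R (mm_restr X r) (2 * e) y i| <= e,
    @weight_rest R (mm_restr (Xs n) r) (2 * e) z <= e &
    @weight_rest R (mm_restr X r) (2 * e) y <= e].

Lemma dmat_ge0 (T : pmetricType R) (s : seq T) i j : 0 <= dmat s i j.
Proof. exact: mdist_ge0. Qed.

Lemma dmat_le (T : pmetricType R) (s : seq T) r i j : 0 <= r ->
  (forall x, x \in s -> mdist point x <= r) -> dmat s i j <= 2 * r.
Proof.
move=> r0 sr; have H l : mdist point (nth point (point :: s) l) <= r.
  have [ls|sl] := ltnP l (size (point :: s)); last by rewrite nth_default// mdistxx.
  have := mem_nth (point : T) ls; rewrite inE => /predU1P[->|/sr//].
  by rewrite mdistxx.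
apply: le_trans (metric_triangle _ point _) _; rewrite metric_sym.
by rewrite mulr_natl mulr2n lerD.
Qed.

Lemma pou_rest_ext (rho : R) N t t' : (forall j, (j < N)%N -> t j = t' j) ->
  pou_rest rho N t = pou_rest rho N t'.
Proof. by move=> tt'; apply: eq_bigr => j _; rewrite tt'. Qed.

Lemma pou_ext (rho : R) i t t' : (forall j, (j <= i)%N -> t j = t' j) ->
  pou rho i t = pou rho i t'.
Proof. by move=> tt'; rewrite /pou tt'// (pou_rest_ext _ (t' := t'))// => j /ltnW; exact: tt'. Qed.

(** Behind the root, the j-th point of z has index j.+1 and the integrated point has index N.+1. *)
Lemma weight_dfun (Y : mmspace R) rho (z : seq Y) N i : size z = N -> (i < N)%N ->
  dfun 1 (fun D => pou rho i (fun j => D j.+1 N.+1)) z = weight rho z i.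
Proof.
move=> zN iN; rewrite /dfun /weight /=; congr (Int _); apply/funext => w.
apply: pou_ext => j ji; rewrite /dmat /dist_to /= !nth_cat zN ltnn subnn /=.
by rewrite (leq_ltn_trans ji iN).
Qed.

Lemma weight_rest_dfun (Y : mmspace R) rho (z : seq Y) N : size z = N ->
  dfun 1 (fun D => pou_rest rho N (fun j => D j.+1 N.+1)) z = weight_rest rho z.
Proof.
move=> zN; rewrite /dfun /weight_rest /= zN; congr (Int _); apply/funext => w.
apply: pou_rest_ext => j jN; rewrite /dmat /dist_to /= !nth_cat zN ltnn subnn /=.
by rewrite jN.
Qed.

Lemma matching_weights r rho eta (y : seq X) :
  iint_cvg (fun n => mm_restr (Xs n) r) (mm_restr X r) -> 0 <= r -> 0 < rho -> 0 < eta ->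
  (forall x, x \in y -> supp (mm_restr X r) x) ->
  \forall n \near \oo, exists z : seq (Xs n),
    [/\ size z = size y, forall x, x \in z -> supp (mm_restr (Xs n) r) x,
      forall i j, `|dmat z i j - dmat y i j| <= eta,
      forall i, (i < size y)%N ->
        `|@weight R (mm_restr (Xs n) r) rho z i - @weight R (mm_restr X r) rho y i| < eta &
      `|@weight_rest R (mm_restr (Xs n) r) rho z - @weight_rest R (mm_restr X r) rho y| < eta].
Proof.
move=> cv r0 rho0 eta0 sy; set N := size y.
(* The left summand stands for the distances, root included; in the right one, indices below N stand
   for the weights and N for the remainder. *)
pose I : finType := (('I_N.+1 * 'I_N.+1) + 'I_N.+1)%type.
pose k (i : I) := if i is inr _ then 1%N else 0%N.
pose B := 2 * r; have B0 : 0 <= B by rewrite mulr_ge0.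
pose Psi (i : I) : (nat -> nat -> R) -> R := match i with
  | inl ab => fun D => Num.max (- B) (Num.min B (D ab.1 ab.2))
  | inr a => if (a < N)%N then fun D => pou rho a (fun j => D j.+1 N.+1)
             else fun D => pou_rest rho N (fun j => D j.+1 N.+1)
  end.
have uPsi i : ubcm (Psi i).
  case: i => [ab|a] /=; first exact: ubcm_clamp.
  case: ifP => _; first exact: (ubcm_pou a (fun j => (j.+1, N.+1)) rho0).
  exact: (ubcm_pou_rest N (fun j => (j.+1, N.+1)) rho0).
have H := matching k (fun n => mm_restr_finite r (@bfXs n)) (mm_restr_finite r bfX) cv uPsi sy eta0.
apply: filterS H => n [z [zN sz zV]]; exists z; split => //.
- move=> i j.
  (* Every index beyond N reads the root, so finitely many distances control the infinite matrix. *)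
  have nthE (l : nat) : exists a : 'I_N.+1,
      nth point (point :: z) l = nth point (point :: z) a /\
      nth point (point :: y) l = nth point (point :: y) a.
    have [lN|Nl] := leqP l N; first by exists (inord l); rewrite inordK.
    by exists ord0; split; rewrite nth_default//= ?zN.
  have [a [za ya]] := nthE i; have [b [zb yb]] := nthE j.
  have -> : dmat z i j = dmat z a b by rewrite /dmat za zb.
  have -> : dmat y i j = dmat y a b by rewrite /dmat ya yb.
  have := zV (inl (a, b)); rewrite /dfun /= !cats0.
  rewrite !clamp_id; first exact: ltW.
    rewrite dmat_ge0 dmat_le// => x /sy /supp_restr[]//.
  by rewrite dmat_ge0 dmat_le// => x /sz /supp_restr[].
- move=> i iN; have := zV (inr (Ordinal (ltnW iN : (i < N.+1)%N))); rewrite /= iN.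
  by rewrite !weight_dfun.
- have := zV (inr ord_max); rewrite /= ltnn.
  by rewrite !weight_rest_dfun.
Qed.

Hypothesis vague : gromov_vague Xs X.
Hypothesis lower : forall delta r : R, 0 < delta -> 0 < r -> exists2 c, 0 < c &
  \forall n \near \oo, forall x, supp (Xs n) x -> mdist point x < r ->
    (c%:E <= mm_meas (Xs n) (cball x delta))%E.

(** The net y is taken at radius r and matched at a radius r' > r chosen after it: so close to r
    that y is still a net of the support within r' and that the shell has little mass. Convergence
    of masses at both radii makes the shells of the [Xs n] light as well. *)
Lemma matched_exists r e : 0 < r -> 0 < e ->
  (forall x, supp X x -> mdist point x <= r -> supp (mm_restr X r) x) ->
  iint_cvg (fun n => mm_restr (Xs n) r) (mm_restr X r) ->
  \forall n \near \oo, exists y z, @matched r e n y z.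
Proof.
move=> r0 e0 good cvr.
have rho0 : 0 < 2 * e by rewrite mulr_gt0.
have tA : tbounded (supp (mm_restr X r)).
  apply: tbounded_sub (@tbounded_supp _ _ _ bfX bfXs vague lower r).
  by move=> x /supp_restr.
have [y [sy yA]] := tA e e0; set N := size y.
have [r1 rr1 near1] := supp_restr_right (@compact_supp _ _ _ bfX bfXs vague lower (r + 1)) good e0.
(* Each of the N weights is off by at most 5 * eta1: one from matching at r', one from the shell of
   X, and three from the shell of [Xs n], whose mass differs from that of X by two errors. *)
pose eta1 := e / N.+1%:R / 5.
have eta10 : 0 < eta1 by rewrite !divr_gt0.
have [r2 rr2 mass2] := mass_restr_right bfX r eta10.
have rr12 : r < Num.min r1 r2 by rewrite lt_min rr1.
have [r' [/andP[rr' r'12] _ cvr']] := vague_radius bfX bfXs vague (@countable0 R) (ltW r0) rr12.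
have [r'1 r'2] : r' < r1 /\ r' < r2 by move: r'12; rewrite lt_min => /andP[].
have r'0 : 0 < r' by lra.
pose d0 := Num.min e (r' - r).
have d00 : 0 < d0 by rewrite lt_min e0 subr_gt0.
have r10 : 0 < r + 1 by lra.
have [c c0 cn] := lower d00 r10.
pose eta := Num.min eta1 (Num.min e c).
have eta0 : 0 < eta by rewrite !lt_min eta10 e0.
have eta_le : [/\ eta <= eta1, eta <= e & eta <= c].
  by rewrite /eta !ge_min !lexx ?orbT.
have sy' x : x \in y -> supp (mm_restr X r') x.
  by move=> /sy /supp_restr[sx xr]; apply: supp_restr_lt => //; lra.
have mw := matching_weights cvr' (ltW r'0) rho0 eta0 sy'.
have finr n s := mm_restr_finite s (@bfXs n).
have massr := mass_cvg cvr; have massr' := mass_cvg cvr'.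
have /cvgrPdist_lt/(_ _ eta10) massn := massr.
have /cvgrPdist_lt/(_ _ eta10) massn' := massr'.
(* A support point within r1 is e-close to the support at radius r, which is e-close to y; hence the
   cutoff radius 2 * e. *)
have rest0 s : s <= r1 -> @weight_rest R (mm_restr X s) (2 * e) y = 0.
  move=> sr1; apply/eqP; rewrite eq_le; apply/andP; split; last first.
    apply: Int_ge0; [exact: mm_restr_finite|exact: pou_rest_bcont|].
    by move=> x _; exact: pou_rest_ge0.
  rewrite -(mul0r (mass (mm_restr X s))); apply: Int_le_cst.
  - exact: mm_restr_finite.
  - exact: pou_rest_bcont.
  move=> x /supp_restr[sx xs]; have [a sa xa] := near1 x sx (le_trans xs sr1).
  have [b bb ab] := yA a sa.
  rewrite (@pou_rest_eq0 _ _ _ _ (index b y))// ?index_mem//.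
  rewrite /dist_to nth_index// metric_sym.
  by have := metric_triangle x a b; lra.
near=> n.
have [z [zN sz zD zW zR]] : exists z : seq (Xs n),
    [/\ size z = size y, forall x, x \in z -> supp (mm_restr (Xs n) r') x,
      forall i j, `|dmat z i j - dmat y i j| <= eta,
      forall i, (i < size y)%N ->
        `|@weight R (mm_restr (Xs n) r') (2 * e) z i - @weight R (mm_restr X r') (2 * e) y i| < eta &
      `|@weight_rest R (mm_restr (Xs n) r') (2 * e) z - @weight_rest R (mm_restr X r') (2 * e) y| < eta].
  by near: n.
have [eta_1 eta_e eta_c] := eta_le.
have cn' : forall x, supp (Xs n) x -> mdist point x < r + 1 ->
    (c%:E <= mm_meas (Xs n) (cball x d0))%E by near: n.
have mn : `|mass (mm_restr X r) - mass (mm_restr (Xs n) r)| < eta1 by near: n.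
have mn' : `|mass (mm_restr X r') - mass (mm_restr (Xs n) r')| < eta1 by near: n.
have mX := mass2 r'; rewrite rr' r'2 in mX; have {}mX := mX isT.
rewrite rest0 ?subr0 in zR; last exact: ltW.
have restn : @weight_rest R (mm_restr (Xs n) r') (2 * e) z < eta.
  by move: zR; rewrite ltr_norml => /andP[].
have pou01 (T : pmetricType R) (s : seq T) i x : 0 <= pou (2 * e) i (dist_to s x) <= 1.
  by rewrite pou_ge0 pou_le1.
have rest01 (T : pmetricType R) (s : seq T) i x : 0 <= pou_rest (2 * e) i (dist_to s x) <= 1.
  by rewrite pou_rest_ge0 pou_rest_le1.
exists y, z; split; split => //.
- by move=> i j; apply: le_trans (zD i j) _.
(* Otherwise the remainder would equal 1 on the ball of radius d0 around x, whose mass is at least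
   c, although its integral is below eta <= c. The 5 * e is d0 <= e plus the reach 4 * e of the
   cutoffs; d0 <= r' - r keeps this ball inside radius r'. *)
- move=> x sx; apply: contrapT => no.
  have [sx' xr] := supp_restr sx.
  have xr1 : mdist point x < r + 1 by lra.
  have := cn' x sx' xr1; apply/negP; rewrite -ltNge.
  have sub : cball x d0 `<=` cball point r'.
    move=> w xw; apply: le_trans (metric_triangle _ x _) _.
    have : d0 <= r' - r by rewrite /d0 ge_min lexx orbT.
    by move: xw; rewrite /cball /=; lra.
  have -> : mm_meas (Xs n) (cball x d0) = mm_meas (mm_restr (Xs n) r') (cball x d0).
    by rewrite mm_restrE; congr (mm_meas (Xs n) _); exact/esym/setIidPl.
  have mfin : mm_meas (mm_restr (Xs n) r') (cball x d0) \is a fin_num.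
    by apply: meas_fin; [exact: finr|exact: measurable_cball].
  rewrite -(fineK mfin) lte_fin; apply: le_lt_trans (lt_le_trans restn eta_c).
  rewrite -[leLHS]mul1r; apply: Int_ge_meas => //.
  - exact: pou_rest_bcont.
  - exact: measurable_cball.
  - by move=> w; exact: pou_rest_ge0.
  move=> w xw; rewrite pou_rest_eq1// => i iz; rewrite leNgt; apply/negP => iw.
  apply: no; exists (nth point z i); first exact: mem_nth.
  have : d0 <= e by rewrite /d0 ge_min lexx.
  have := metric_triangle x w (nth point z i).
  by move: xw iw; rewrite /dist_to /cball /= (metric_sym w); lra.
- have bound i : (i < N)%N -> `|@weight R (mm_restr (Xs n) r) (2 * e) z i -
      @weight R (mm_restr X r) (2 * e) y i| <= 5 * eta1.
    move=> iN; have := zW i iN; rewrite ltr_norml.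
    have [h1 h2] := Int_restr_mono (@bfXs n) (ltW rr') (pou_bcont i z rho0) (pou01 _ z i).
    have [h3 h4] := Int_restr_mono bfX (ltW rr') (pou_bcont i y rho0) (pou01 _ y i).
    move: mn mn'; rewrite /weight !ltr_norml ler_norml => /andP[a1 a2] /andP[a3 a4] /andP[a5 a6].
    apply/andP; split; lra.
  apply: (@le_trans _ _ (\sum_(i < N) 5 * eta1)); first by apply: ler_sum => i _; exact: bound.
  rewrite sumr_const card_ord -[_ *+ N]mulr_natl /eta1.
  rewrite [5 * _]mulrC divfK ?pnatr_eq0// mulrCA.
  by rewrite ler_piMr ?(ltW e0)// ler_pdivrMr// mul1r ler_nat.
- have [h1 h2] := Int_restr_mono (@bfXs n) (ltW rr') (pou_rest_bcont (size z) z rho0)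
    (rest01 _ z (size z)).
  by apply: (le_trans h1); apply/ltW/(lt_le_trans restn).
- by rewrite rest0 ?ltW.
Unshelve. all: by end_near. Qed.

End matched_nets.

Lemma diagonal_cvg0 {R : realType} (P : nat -> R -> Prop) :
  (forall e, 0 < e -> \forall n \near \oo, P n e) ->
  exists e : nat -> R, [/\ forall n, 0 < e n, e n @[n --> \oo] --> 0 &
    \forall n \near \oo, P n (e n)].
Proof.
move=> H; have H' j : exists N, forall n, (N <= n)%N -> P n j.+1%:R^-1.
  by have [|N _ NP] := H j.+1%:R^-1; [rewrite invr_gt0|exists N => n; exact: NP].
pose N j := sval (cid (H' j)).
have NP j n : (N j <= n)%N -> P n j.+1%:R^-1 by move=> h; exact: (svalP (cid (H' j))).
(* The finest scale already available at n. Below N 0 there is none and the value is arbitrary, so P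
   is claimed only eventually. *)
pose J n : nat := [arg max_(i > (ord0 : 'I_n.+1) | (N i <= n)%N) (i : nat)].
have JP n : (N 0 <= n)%N -> (N (J n) <= n)%N /\
    forall j, (j <= n)%N -> (N j <= n)%N -> (j <= J n)%N.
  move=> n0; rewrite /J; case: arg_maxnP => // i iN imax; split => // j jn Nj.
  by have := imax (Ordinal (jn : (j < n.+1)%N)) Nj.
exists (fun n => (J n).+1%:R^-1); split.
- by move=> n; rewrite invr_gt0.
- apply/cvgrPdist_lt => e e0.
  have := @near_infty_natSinv_lt R (PosNum e0) => /filter_ex[j /= je].
  near=> n; rewrite sub0r normrN gtr0_norm ?invr_gt0//.
  apply: le_lt_trans je; rewrite lef_pV2 ?posrE// ler_nat ltnS.
  have n0 : (N 0 <= n)%N by near: n; exact: nbhs_infty_ge.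
  have [_ h] := JP n n0; apply: h; near: n; exact: nbhs_infty_ge.
- near=> n; apply: NP.
  have n0 : (N 0 <= n)%N by near: n; exact: nbhs_infty_ge.
  by have [] := JP n n0.
Unshelve. all: by end_near. Qed.

Section embedding.
Context {R : realType} (X : mmspace R) (Xs : nat -> mmspace R).
Hypotheses (bfX : boundedly_finite X) (bfXs : forall n, boundedly_finite (Xs n)).

Lemma rsupp_restr_finite (Y : mmspace R) r : boundedly_finite Y ->
  (mm_meas (rsupp_space (mm_restr (rsupp_space Y) r)) setT < +oo)%E.
Proof.
by move=> bfY; apply: (mm_embed_finite (mm_embed_rsupp_restr Y r)); exact: mm_restr_finite.
Qed.

Lemma supp_rsupp_restr (Y : mmspace R) r (s : rsupp_space (mm_restr (rsupp_space Y) r)) :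
  supp (mm_restr (rsupp_space Y) r) (set_val s) <-> supp (mm_restr Y r) (rsupp_restr s).
Proof. exact: (mm_embed_supp _ (mm_embed_restr_rsupp Y r)). Qed.

Lemma ghw_of_embeddings (E : pmetricType R) (phi_ : forall n, Xs n -> E) (phi : X -> E) r :
  (forall n, isometric (@phi_ n)) -> isometric phi ->
  (forall n, @phi_ n point = point) -> phi point = point ->
  (forall f : E -> R, bcont f ->
    @Int R (mm_restr (Xs n) r) (f \o @phi_ n) @[n --> \oo] --> @Int R (mm_restr X r) (f \o phi)) ->
  (forall e, 0 < e -> \forall n \near \oo,
    (forall x, supp (mm_restr (Xs n) r) x ->
      exists2 y, supp (mm_restr X r) y & mdist (phi_ n x) (phi y) < e) /\
    (forall y, supp (mm_restr X r) y ->
      exists2 x, supp (mm_restr (Xs n) r) x & mdist (phi y) (phi_ n x) < e)) ->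
  gromov_hausdorff_weak (fun n => mm_restr (rsupp_space (Xs n)) r) (mm_restr (rsupp_space X) r).
Proof.
move=> iso_ iso root_ root weak close.
exists E, (fun n => @phi_ n \o @rsupp_restr R (Xs n) r), (phi \o @rsupp_restr R X r).
have [ie0 re0 _] := mm_embed_rsupp_restr X r.
have emb n : mm_embed (@rsupp_restr R (Xs n) r) by exact: mm_embed_rsupp_restr.
have iso' n : isometric (@phi_ n \o @rsupp_restr R (Xs n) r).
  by have [ie _ _] := emb n => x y; rewrite /= iso_ ie.
have iso'' : isometric (phi \o @rsupp_restr R X r) by move=> x y; rewrite /= iso ie0.
split => //.
- move=> f cf bf; have bcf : bcont f by [].
  have S (Y : mmspace R) (p : Y -> E) : boundedly_finite Y -> isometric p ->
      (\int[borel_pushforward (mm_meas (rsupp_space (mm_restr (rsupp_space Y) r)))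
         (p \o @rsupp_restr R Y r)]_x (f x)%:E = (@Int R (mm_restr Y r) (f \o p))%:E)%E.
    move=> bfY ip; have [ie _ _] := mm_embed_rsupp_restr Y r.
    rewrite borel_pushforward_Int//.
    - have bfp : bcont (f \o p) by exact: bcont_comp (isometric_continuous ip) bcf.
      congr EFin; rewrite -(mm_embed_Int (mm_embed_rsupp_restr Y r))//.
      exact: mm_restr_finite.
    - exact: rsupp_restr_finite.
    - by move=> x y; rewrite /= ip ie.
  rewrite S// (_ : (fun n => _) = fun n => (@Int R (mm_restr (Xs n) r) (f \o @phi_ n))%:E).
    by apply: cvg_EFin; [exact: nearW|exact: weak].
  by apply/funext => n; rewrite S.
apply/hausdorff_cvg0 => e e0; apply: filterS (close e e0) => n [h1 h2]; split.
  move=> _ [s /= /supp_rsupp_restr ss <-]; have [y sy xy] := h1 _ ss.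
  have [s' ss' s'y] := rsupp_restr_surj sy.
  by exists (phi y) => //; exists s' => //=; rewrite s'y.
move=> _ [s /= /supp_rsupp_restr ss <-]; have [y sy xy] := h2 _ ss.
have [s' ss' s'y] := rsupp_restr_surj sy.
by exists (phi_ n y) => //; exists s' => //=; rewrite s'y.
Qed.

(** Both integrals of a test function are compared with sums over the same constants [c i], its
    values at the images of [y n]. Once weak convergence is known, it yields the half of Hausdorff
    convergence that the nets z do not give. *)
Lemma ghw_of_matched r : tbounded (supp (mm_restr X r)) ->
  mass (mm_restr (Xs n) r) @[n --> \oo] --> mass (mm_restr X r) ->
  (forall e, 0 < e -> \forall n \near \oo, exists y z, @matched R X Xs r e n y z) ->
  gromov_hausdorff_weak (fun n => mm_restr (rsupp_space (Xs n)) r) (mm_restr (rsupp_space X) r).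
Proof.
move=> tA mcv /diagonal_cvg0[e [e0 ecv mat]].
(* For the finitely many n without a matched pair, empty lists leave only the bridge between the
   roots, so that all spaces can still be glued. *)
have D n : exists yz : seq X * seq (Xs n),
    [/\ size yz.2 = size yz.1, forall i j, `|dmat yz.2 i j - dmat yz.1 i j| <= e n &
      (exists y z, @matched R X Xs r (e n) n y z) -> @matched R X Xs r (e n) n yz.1 yz.2].
  have [[y [z m]]|no] := pselect (exists y z, @matched R X Xs r (e n) n y z).
    by exists (y, z); have [[? ? _ _] _] := m.
  exists ([::], [::]); split => // i j.
  have E (T : pmetricType R) k : nth (point : T) [:: point] k = point by case: k => [|[]].
  by rewrite /dmat !E !mdistxx subrr normr0 ltW.
pose y n := (sval (cid (D n))).1; pose z n := (sval (cid (D n))).2.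
have zy n : size (z n) = size (y n) by have [] := svalP (cid (D n)).
have dis n i j : `|dmat (z n) i j - dmat (y n) i j| <= e n.
  by have [] := svalP (cid (D n)).
have {}mat : \forall n \near \oo, @matched R X Xs r (e n) n (y n) (z n).
  by apply: filterS mat => n; have [] := svalP (cid (D n)).
(* The root bridge has length zero, as the embeddings must send root to root. *)
pose len n (i : nat) : R := if i is 0%N then 0 else e n.
pose L n : set (Xs n * X * R) := [set p | exists i,
  p = (nth point (point :: z n) i, nth point (point :: y n) i, len n i)].
have len0 n i : 0 <= len n i by case: i => //= _; exact: ltW.
have [||n a a' b b' d d' [i [-> -> ->]] [j [-> -> ->]]|E [phi_ [phi [[iso_ iso] [root_ root] bridge]]]] :=
    @glue_bridges R X Xs L.
- by move=> n; exists 0%N.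
- by move=> n a b d [i [_ _ ->]]; exact: len0.
- case: i j => [|i] [|j]; rewrite /len.
  + by rewrite !mdistxx subrr normr0 addr0.
  + by rewrite add0r; exact: (dis n 0%N j.+1).
  + by rewrite addr0; exact: (dis n i.+1 0%N).
  + by apply: le_trans (dis n i.+1 j.+1) _; rewrite lerDl ltW.
have zye n i : mdist (phi_ n (nth point (z n) i)) (phi (nth point (y n) i)) <= e n.
  by apply: bridge; exists i.+1.
pose A := supp (mm_restr X r).
have cA : compact A by apply: tbounded_compact => //; exact: closed_supp.
have finX := mm_restr_finite r bfX; have finXs n := mm_restr_finite r (@bfXs n).
have esmall d : 0 < d -> \forall n \near \oo, e n < d.
  move=> d0; have /cvgrPdist_lt/(_ _ d0) := ecv; apply: filterS => n.
  by rewrite sub0r normrN gtr0_norm.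
pose M := mass (mm_restr X r) + 1.
have M0 : 0 < M by rewrite ltr_wpDl// mass_ge0.
have massM : \forall n \near \oo, mass (mm_restr (Xs n) r) <= M.
  have /(cvgr_lt (mass (mm_restr X r)))/(_ M) := mcv.
  by rewrite /M ltrDl ltr01 => /(_ isT); apply: filterS => n /ltW.
have weak (f : E -> R) : bcont f ->
    @Int R (mm_restr (Xs n) r) (f \o phi_ n) @[n --> \oo] --> @Int R (mm_restr X r) (f \o phi).
  move=> bf; have [B0 fB0] := bf.2; pose B := `|B0| + 1.
  have B1 : 0 < B by rewrite ltr_wpDl.
  have fB x : `|f x| <= B.
    by apply: le_trans (fB0 x) _; apply: le_trans (ler_norm _) _; rewrite lerDl.
  apply/cvgrPdist_lt => k k0; pose kap := k / 4 / M.
  have kap0 : 0 < kap by rewrite !divr_gt0.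
  have cK : compact (phi @` A).
    by apply: continuous_compact cA; apply: continuous_subspaceT; exact: isometric_continuous.
  have [d d0 fd] := compact_unif_continuous cK bf.1 kap0.
  (* A point within 4 * e n of [z n] is within 5 * e n < d of the image of [y n]. In the final sum,
     two terms kap * M = k / 4 and three terms B * e n < k / 6 stay below k. *)
  have d50 : 0 < d / 5 by rewrite divr_gt0.
  have k6 : 0 < k / 6 / B by rewrite !divr_gt0.
  near=> n.
  have [[_ _ sy _] [W Wn W0]] : @matched R X Xs r (e n) n (y n) (z n) by near: n.
  have en1 : e n < d / 5 by near: n; exact: esmall.
  have en2 : e n < k / 6 / B by near: n; exact: esmall.
  have mM : mass (mm_restr (Xs n) r) <= M by near: n.
  have mX : mass (mm_restr X r) <= M by rewrite /M lerDl.
  pose c i := f (phi (nth point (y n) i)).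
  have en0 := e0 n.
  have r20 : 0 < 2 * e n by rewrite mulr_gt0.
  have bfn : bcont (f \o phi_ n) := bcont_comp (isometric_continuous (iso_ n)) bf.
  have bfX' : bcont (f \o phi) := bcont_comp (isometric_continuous iso) bf.
  have fy w i : (i < size (y n))%N -> mdist (phi (nth point (y n) i)) w < d ->
      `|f w - c i| <= kap.
    move=> iy yw; rewrite distrC; apply/ltW/fd; last by rewrite ballEmdist.
    by exists (nth point (y n) i) => //; apply: sy; exact: mem_nth.
  have E1 := @pou_estimate R (mm_restr (Xs n) r) (2 * e n) kap B (z n) (f \o phi_ n) c
    (finXs n) r20 (ltW kap0) bfn (fun w => fB _).
  have E2 := @pou_estimate R (mm_restr X r) (2 * e n) kap B (y n) (f \o phi) c
    finX r20 (ltW kap0) bfX' (fun w => fB _).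
  have {}E1 := E1 _; have {}E2 := E2 _.
  have h1 : `|@Int R (mm_restr (Xs n) r) (f \o phi_ n) -
      \sum_(i < size (y n)) c i * @weight R (mm_restr (Xs n) r) (2 * e n) (z n) i| <=
      kap * M + B * e n.
    rewrite zy in E1; apply: le_trans (E1 _) _; last first.
      by rewrite lerD// ler_wpM2l// ltW.
    move=> w i _ iy zw; apply: fy => //.
    apply: le_lt_trans (metric_triangle _ (phi_ n (nth point (z n) i)) _) _.
    rewrite iso_ metric_sym; have := zye n i.
    by move: zw; lra.
  have h2 : `|@Int R (mm_restr X r) (f \o phi) -
      \sum_(i < size (y n)) c i * @weight R (mm_restr X r) (2 * e n) (y n) i| <=
      kap * M + B * e n.
    apply: le_trans (E2 _) _; last first.
      by rewrite lerD// ler_wpM2l// ltW.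
    move=> w i _ iy yw; apply: fy => //.
    by rewrite iso; move: yw; lra.
  have h3 : `|\sum_(i < size (y n)) c i * @weight R (mm_restr X r) (2 * e n) (y n) i -
      \sum_(i < size (y n)) c i * @weight R (mm_restr (Xs n) r) (2 * e n) (z n) i| <= B * e n.
    rewrite distrC -sumrB; apply: le_trans (ler_norm_sum _ _ _) _.
    apply: (@le_trans _ _ (\sum_(i < size (y n)) B *
       `|@weight R (mm_restr (Xs n) r) (2 * e n) (z n) i - @weight R (mm_restr X r) (2 * e n) (y n) i|)).
      by apply: ler_sum => i _; rewrite -mulrBr normrM ler_wpM2r//; exact: fB.
    by rewrite -mulr_sumr ler_wpM2l// ltW.
  have kM : kap * M = k / 4 by rewrite /kap divfK// gt_eqF.
  have Be : B * e n < k / 6 by rewrite mulrC -ltr_pdivlMr.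
  move: h1 h2 h3; rewrite !ler_norml ltr_norml => /andP[a1 a2] /andP[a3 a4] /andP[a5 a6].
  apply/andP; split; lra.
apply: (ghw_of_embeddings iso_ iso root_ root weak) => eps eps0.
have eps20 : 0 < eps / 2 by rewrite divr_gt0.
have [s [sA As]] := tA _ eps20.
(* If a point of the limit support had no point of the nth support within eps, the bump at its net
   point would vanish on that support and have integral zero. *)
have bumps : \forall n \near \oo, forall u, u \in s ->
    0 < @Int R (mm_restr (Xs n) r) (bump (phi u) (eps / 2) \o phi_ n).
  apply: near_all_seq => u us; have w := weak _ (bump_bcont (phi u) eps20).
  have u0 : 0 < @Int R (mm_restr X r) (bump (phi u) (eps / 2) \o phi).
    have -> : @Int R (mm_restr X r) (bump (phi u) (eps / 2) \o phi) = @Int R (mm_restr X r) (bump u (eps / 2)).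
      by congr (Int _); apply/funext => x; rewrite /= /bump iso.
    by apply: bump_Int_gt0 => //; exact: sA.
  by have /(cvgr_gt _)/(_ 0 u0) := w.
near=> n.
have [[_ _ sy zA] _] : @matched R X Xs r (e n) n (y n) (z n) by near: n.
split.
  move=> x /zA[a az xa].
  have iz : (index a (z n) < size (y n))%N by rewrite -zy index_mem.
  exists (nth point (y n) (index a (z n))); first by apply: sy; exact: mem_nth.
  have := zye n (index a (z n)); rewrite nth_index// => ya.
  apply: le_lt_trans (metric_triangle _ (phi_ n a) _) _; rewrite iso_.
  have en : e n < eps / 6 by near: n; apply: esmall; rewrite divr_gt0.
  by lra.
move=> u /As[v vs uv].
have v0 : 0 < @Int R (mm_restr (Xs n) r) (bump (phi v) (eps / 2) \o phi_ n).
  by move: v vs {uv}; near: n.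
apply: contrapT => no; move: v0; apply/negP; rewrite -leNgt.
rewrite -(mul0r (mass (mm_restr (Xs n) r))); apply: Int_le_cst => //.
  exact: bcont_comp (isometric_continuous (iso_ n)) (bump_bcont _ eps20).
move=> x sx /=; rewrite bump_eq0// leNgt; apply/negP => xv; apply: no; exists x => //.
apply: le_lt_trans (metric_triangle _ (phi v) _) _.
by rewrite [ltRHS]splitr ltrD// ?iso// metric_sym.
Unshelve. all: by end_near. Qed.

End embedding.

(** * The equivalences *)

Section heine_borel_spaces.
Context {R : realType}.

Lemma compact_set_type {T : metricType R} (S : set T) (A : set (set_type S)) (K : set T) :
  closed A -> compact K -> K `<=` S -> (forall x, A x -> K (set_val x)) -> compact A.
Proof.
move=> clA cK KS AK F FF FA.
pose v : set_type S -> T := set_val.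
have FK : F (v @^-1` K) by apply: filterS FA => x /AK.
have [x [Kx clx]] := cK (v @ F) _ FK.
pose a : set_type S := exist _ x (mem_set (KS x Kx)).
have cla : cluster F a.
  move=> V U FV /nbhs_ballP[e /= e0 aU].
  have FV' : F (v @^-1` (v @` V)) by apply: filterS FV => w Vw; exists w.
  have [_ [[w Vw <-] xw]] := clx _ _ FV' (nbhsx_ballx x e e0).
  by exists w; split => //; apply: aU; move: xw; rewrite !ballEmdist.
exists a; split => //; apply: clA => U aU.
by have [b [Ab Ub]] := cla _ _ FA aU; exists b.
Qed.

Lemma heine_borel_supp (X : mmspace R) :
  (forall r, compact (supp X `&` cball point r)) -> heine_borel (set_type (supp X)).
Proof.
move=> cX A clA [M AM]; have [[a Aa]|no] := pselect (A !=set0); last first.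
  have -> : A = set0 by apply/seteqP; split => // x Ax; apply: no; exists x.
  exact: compact0.
apply: (compact_set_type clA (cX (mdist point (set_val a) + M))); first by move=> x [].
move=> x Ax; split; first exact/set_mem/(valP x).
apply: le_trans (metric_triangle _ (set_val a) _) _.
by rewrite lerD2l; exact: AM.
Qed.

Lemma tbounded_heine_borel (X : mmspace R) r : heine_borel (set_type (supp X)) ->
  tbounded (supp X `&` cball point r).
Proof.
move=> hb; pose B : set (set_type (supp X)) := set_val @^-1` (cball point r).
have cv : continuous (set_val : set_type (supp X) -> X) by exact: isometric_continuous.
have cB : compact B.
  apply: hb; first by apply: closed_comp => [x _|]; [exact: cv|exact: closed_cball].
  exists (r + r) => x y; rewrite /B /= /cball /= => xr yr.
  apply: le_trans (metric_triangle (set_val x : X) point (set_val y)) _.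
  by rewrite metric_sym lerD.
apply: (tbounded_image (f := (set_val : set_type (supp X) -> X)) (compact_tbounded cB)) => //.
by move=> x [sx xr]; exists (exist _ x (mem_set sx)).
Qed.

(** Only a representative W of the class is Heine-Borel; its compact balls make the bounded part of
    [rsupp X] totally bounded through the isometry. The minimum of finitely many positive masses of
    half-radius balls is then a bound. *)
Lemma heine_borel_lower_mass (X : mmspace R) delta r : boundedly_finite X ->
  heine_borel_class X -> 0 < delta -> exists2 c : R, 0 < c &
    (c%:E <= lower_mass delta r X)%E.
Proof.
move=> bfX [W [phi [iphi _ phi0 _]] hbW] d0.
have d20 : 0 < delta / 2 by rewrite divr_gt0.
pose v : rsupp_space X -> X := set_val.
pose A := [set x : rsupp_space X | supp X (v x) /\ mdist (point : rsupp_space X) x < r].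
pose i (x : rsupp_space X) : W := (set_val : rsupp_space W -> W) (phi x).
have ii : isometric i by move=> x y; rewrite -iphi.
have tA : tbounded A.
  apply: (tbounded_preimage ii (B := cball point r)).
    by apply/compact_tbounded/hbW; [exact: closed_cball|exact: bounded_cball].
  move=> x [_ xr]; rewrite /cball /=.
  have -> : (point : W) = i point by rewrite /i phi0.
  by rewrite ii ltW.
have [s [sA As]] := tA _ d20.
have mfin (x : X) : mm_meas X (ball x (delta / 2)) \is a fin_num.
  rewrite ge0_fin_numE//; apply: (@le_lt_trans _ _ (mm_meas X (cball x delta))).
    apply: le_measure; rewrite ?inE; [exact: measurable_ball|exact: measurable_cball|].
    by move=> y; rewrite ballEmdist /cball /=; lra.
  by apply: bfX; [exact: measurable_cball|exact: bounded_cball].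
have [c c0 cs] : exists2 c : R, 0 < c & forall y, y \in s ->
    c <= fine (mm_meas X (ball (v y) (delta / 2))).
  elim: s sA {As} => [|y s IH] sA; first by exists 1.
  have [|c c0 cs] := IH; first by move=> z zs; apply: sA; rewrite inE zs orbT.
  have [sy _] := sA y (mem_head _ _).
  have y0 : 0 < fine (mm_meas X (ball (v y) (delta / 2))).
    rewrite fine_gt0//; apply/andP; split.
      by apply: sy; [exact: metric_ball_open|exact: ballxx].
    by rewrite -ge0_fin_numE.
  exists (Num.min c (fine (mm_meas X (ball (v y) (delta / 2))))).
    by rewrite lt_min c0.
  move=> z; rewrite inE => /predU1P[->|/cs h]; first by rewrite ge_min lexx orbT.
  by rewrite ge_min h.
exists c => //; apply: le_ereal_inf_tmp => _ [x [xr sx] <-].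
pose x' : rsupp_space X := exist _ x (mem_set (or_introl sx)).
have [|y ys xy] := As x'; first by split => //; move: xr; rewrite ballEmdist.
apply: (@le_trans _ _ (mm_meas X (ball (v y) (delta / 2)))).
  by rewrite -(fineK (mfin _)) lee_fin cs.
apply: le_measure; rewrite ?inE; [exact: measurable_ball|exact: measurable_cball|].
move=> z; rewrite ballEmdist /cball /= => yz.
have h : mdist x (v y) < delta / 2 := xy.
by have := metric_triangle x (v y) z; lra.
Qed.

End heine_borel_spaces.

Section equivalences.
Context {R : realType} (X : mmspace R) (Xs : nat -> mmspace R).
Hypotheses (bfX : boundedly_finite X) (bfXs : forall n, boundedly_finite (Xs n)).

Lemma lower_massP (Y : mmspace R) delta r (c : R) : (c%:E <= lower_mass delta r Y)%E <->
  forall x, supp Y x -> mdist point x < r -> (c%:E <= mm_meas Y (cball x delta))%E.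
Proof.
split => [h x sx xr|h].
  by apply: (le_trans h); apply: ereal_inf_lbound; exists x => //; split => //; rewrite ballEmdist.
apply: le_ereal_inf_tmp => _ [x [xr sx] <-]; apply: h => //.
by move: xr; rewrite ballEmdist.
Qed.

Lemma lower_mass_mono (Y : mmspace R) delta delta' r (c : R) : delta <= delta' ->
  (c%:E <= lower_mass delta r Y)%E -> (c%:E <= lower_mass delta' r Y)%E.
Proof.
move=> dd' /lower_massP h; apply/lower_massP => x sx xr; apply: (le_trans (h x sx xr)).
apply: le_measure; rewrite ?inE; [exact: measurable_cball|exact: measurable_cball|].
by move=> y xy; exact: le_trans xy dd'.
Qed.

Let liminf_mass := forall delta r : R, 0 < delta -> 0 < r ->
  (0 < limn_einf (fun n => lower_mass delta r (Xs n)))%E.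

Let inf_mass := forall delta r : R, 0 < delta -> delta < r ->
  (0 < ereal_inf (range (fun n => lower_mass delta r (Xs n))))%E.

Lemma ghv_of_gromov_vague : gromov_vague Xs X -> liminf_mass ->
  heine_borel (set_type (supp X)) /\
  gromov_hausdorff_vague (fun n => rsupp_space (Xs n)) (rsupp_space X).
Proof.
move=> vague lm.
have lower delta r : 0 < delta -> 0 < r -> exists2 c, 0 < c &
    \forall n \near \oo, forall x, supp (Xs n) x -> mdist point x < r ->
      (c%:E <= mm_meas (Xs n) (cball x delta))%E.
  move=> d0 r0; have /limn_einf_gt0P[c c0 cn] := lm _ _ d0 r0; exists c => //.
  by apply: filterS cn => n /lower_massP.
split; first by apply: heine_borel_supp => r; exact: (@compact_supp _ _ _ bfX bfXs vague lower r).
apply: sub_countable (countable_setU vague (countable_supp_restr X)).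
apply: subset_card_le => r [r0 nghw].
have [[x bad]|good] := pselect (exists x, [/\ supp X x, mdist point x <= r & ~ supp (mm_restr X r) x]).
  by right; exists x.
left; split => // gw; apply: nghw.
have cv : iint_cvg (fun n => mm_restr (Xs n) r) (mm_restr X r).
  by apply: gromov_weak_iint => [n||]; [exact: mm_restr_finite|exact: mm_restr_finite|].
apply: ghw_of_matched => //.
- apply: tbounded_sub (@tbounded_supp _ _ _ bfX bfXs vague lower r).
  by move=> x /supp_restr.
- exact: mass_cvg cv.
move=> e e0; apply: (matched_exists bfX bfXs vague lower r0 e0) => // x sx xr.
by apply: contrapT => nx; apply: good; exists x.
Qed.

(** Results in the common space concern the doubly nested supports; they are carried to the
    restrictions along [rsupp_restr]. The Heine-Borel property supplies the total boundedness of the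
    limit. *)
Lemma common_space_of_ghw r : heine_borel (set_type (supp X)) ->
  gromov_hausdorff_weak (fun n => mm_restr (rsupp_space (Xs n)) r) (mm_restr (rsupp_space X) r) ->
  iint_cvg (fun n => mm_restr (Xs n) r) (mm_restr X r) /\
  forall delta, 0 < delta -> exists2 c, 0 < c & \forall n \near \oo,
    forall x, supp (mm_restr (Xs n) r) x -> (c%:E <= mm_meas (Xs n) (cball x delta))%E.
Proof.
move=> hb [E [phi_ [phi [[iso_ iso] [root_ root] weak haus]]]].
pose S := rsupp_space (mm_restr (rsupp_space X) r).
pose Ss n := rsupp_space (mm_restr (rsupp_space (Xs n)) r).
have finS : (mm_meas S setT < +oo)%E by exact: rsupp_restr_finite.
have finSs n : (mm_meas (Ss n) setT < +oo)%E by exact: rsupp_restr_finite.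
have embS := mm_embed_rsupp_restr X r.
have embSs n := mm_embed_rsupp_restr (Xs n) r.
have suppS (Y : mmspace R) (s : rsupp_space (mm_restr (rsupp_space Y) r)) :
    supp (rsupp_space (mm_restr (rsupp_space Y) r)) s <-> supp (mm_restr (rsupp_space Y) r) (set_val s).
  exact: (mm_embed_supp _ (mm_embed_rsupp _)).
have weak' f : bcont f -> Int (f \o phi_ n) @[n --> \oo] --> Int (f \o phi).
  move=> bf; have := weak f bf.1 bf.2.
  rewrite borel_pushforward_Int//.
  rewrite (_ : (fun n => _) = fun n => (Int (f \o phi_ n))%:E); first by move/fine_cvg.
  by apply/funext => n; rewrite borel_pushforward_Int//; exact: finSs.
have close e : 0 < e -> \forall n \near \oo, forall x, supp (Ss n) x ->
    exists2 y, supp S y & mdist (phi_ n x) (phi y) < e.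
  move=> e0; have /hausdorff_cvg0/(_ e e0) := haus.
  apply: filterS => n [h _] x /suppS sx; have [_ [y /= sy <-] xy] := h _ (ex_intro2 _ _ x sx erefl).
  by exists y => //; exact/suppS.
have tS : tbounded (supp S).
  have [ie _ _] := embS.
  apply: (tbounded_preimage ie (tbounded_heine_borel r hb)) => s /(mm_embed_supp _ embS) /supp_restr[].
  by split.
split.
  have cvS := common_space_iint_cvg finSs finS iso_ iso root_ root weak' close tS.
  move=> m Phi uPhi; have T (Y : mmspace R) : boundedly_finite Y ->
      iint m (fun s : seq (mm_restr Y r) => Phi (dmat s)) =
      iint m (fun s : seq (rsupp_space (mm_restr (rsupp_space Y) r)) => Phi (dmat s)).
    move=> bfY; have emb := mm_embed_rsupp_restr Y r; have [ie re _] := emb.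
    have uP : ubcs m (fun s : seq (mm_restr Y r) => Phi (dmat s)) by exact: ubcs_dmat.
    rewrite -(mm_embed_iint emb (mm_restr_finite r bfY) uP).
    by apply: eq_iint => s _; rewrite dmat_isometric.
  rewrite T// (_ : (fun n => _) = fun n => iint m (fun s : seq (Ss n) => Phi (dmat s))); first exact: cvS.
  by apply/funext => n; rewrite T.
move=> delta d0.
have [c c0 cn] := common_space_lower_mass finSs finS iso_ iso weak' close tS d0.
exists c => //; apply: filterS cn => n h x sx.
have [s ss sx'] := rsupp_restr_surj sx.
have {}ss : supp (Ss n) s by exact/suppS.
apply: (le_trans (h s ss)).
have [ie _ im] := embSs n.
have -> : cball s delta = @rsupp_restr R (Xs n) r @^-1` (cball x delta).
  by apply/seteqP; split => t; rewrite /cball /= -sx' ie.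
rewrite im; last exact: measurable_cball.
rewrite mm_restrE; apply: le_measure; rewrite ?inE; last exact: subIsetl.
  by apply: measurableI; exact: measurable_cball.
exact: measurable_cball.
Qed.

Lemma gromov_vague_of_ghv : heine_borel (set_type (supp X)) ->
  gromov_hausdorff_vague (fun n => rsupp_space (Xs n)) (rsupp_space X) ->
  gromov_vague Xs X /\ liminf_mass.
Proof.
move=> hb ghv; split.
  apply: sub_countable ghv; apply: subset_card_le => r [r0 ngw]; split => // ghw; apply: ngw.
  have [cv _] := common_space_of_ghw hb ghw.
  apply: (@iint_gromov_weak _ _ _ _ _ r) cv.
  - by move=> n; exact: mm_restr_finite.
  - exact: mm_restr_finite.
  - by move=> x /supp_restr[].
  - by move=> n x /supp_restr[].
move=> delta r d0 r0.
have rr1 : r < r + 1 by rewrite ltrDl.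
(* With r' > r, every support point in the open ball of radius r stays in the support of the
   restriction to radius r'. *)
have [r' [/andP[rr' _] nB]] := countable_avoid ghv rr1.
have ghw : gromov_hausdorff_weak (fun n => mm_restr (rsupp_space (Xs n)) r')
    (mm_restr (rsupp_space X) r').
  by apply: contrapT => h; apply: nB; split => //; exact: lt_trans rr'.
have [_ /(_ delta d0)[c c0 cn]] := common_space_of_ghw hb ghw.
apply/limn_einf_gt0P; exists c => //; apply: filterS cn => n h.
apply/lower_massP => x sx xr; apply: h; apply: supp_restr_lt => //.
exact: lt_trans rr'.
Qed.

Lemma inf_mass_of_liminf : (forall n, heine_borel_class (Xs n)) -> liminf_mass -> inf_mass.
Proof.
move=> hb lm delta r d0 dr; have r0 : 0 < r by exact: lt_trans dr.
have /limn_einf_gt0P[c c0 [N _ cN]] := lm _ _ d0 r0.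
have [c' c'0 cN'] : exists2 c' : R, 0 < c' & forall n, (n < N)%N ->
    (c'%:E <= lower_mass delta r (Xs n))%E.
  elim: N {cN} => [|N [c1 c10 IH]]; first by exists 1.
  have [c2 c20 h] := heine_borel_lower_mass r (@bfXs N) (hb N) d0.
  exists (Num.min c1 c2); first by rewrite lt_min c10.
  move=> n; rewrite ltnS leq_eqVlt => /predU1P[->|nN].
    by apply: le_trans h; rewrite lee_fin ge_min lexx orbT.
  by apply: le_trans (IH n nN); rewrite lee_fin ge_min lexx.
apply: (@lt_le_trans _ _ (Num.min c c')%:E); first by rewrite lte_fin lt_min c0.
apply: le_ereal_inf_tmp => _ [n _ <-]; have [Nn|nN] := leqP N n.
  by apply: le_trans (cN n Nn); rewrite lee_fin ge_min lexx.
by apply: le_trans (cN' n nN); rewrite lee_fin ge_min lexx orbT.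
Qed.

Lemma liminf_mass_of_inf : inf_mass -> liminf_mass.
Proof.
(* The infimum bound speaks of radii delta < r only; lower masses increase with delta, so a large
   delta may be reduced to r / 2. *)
move=> im delta r d0 r0; pose d := Num.min delta (r / 2).
have dd0 : 0 < d by rewrite lt_min d0 divr_gt0.
have dr : d < r by rewrite gt_min; apply/orP; right; lra.
have := im d r dd0 dr; set I := ereal_inf _ => I0.
have [c c0 cI] : exists2 c : R, 0 < c & (c%:E <= I)%E.
  case: I I0 => [x|_|//]; last by exists 1 => //; rewrite leey.
  by rewrite lte_fin => x0; exists x.
apply/limn_einf_gt0P; exists c => //; apply: nearW => n.
apply: (@lower_mass_mono _ d); first by rewrite /d ge_min lexx.
by apply: (le_trans cI); apply: ereal_inf_lbound; exists n.
Qed.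

End equivalences.

Theorem corollary6p2 (R : realType) (X : mmspace R) (Xs : nat -> mmspace R)
    (bfX : boundedly_finite X) (bfXs : forall n, boundedly_finite (Xs n)) :
  let P1 :=
    gromov_vague Xs X /\
    (forall delta r : R, 0 < delta -> 0 < r ->
      (0 < limn_einf (fun n => lower_mass delta r (Xs n)))%E) in
  let P2 :=
    heine_borel (set_type (supp X)) /\
    gromov_hausdorff_vague (fun n => rsupp_space (Xs n)) (rsupp_space X) in
  let P3 :=
    gromov_vague Xs X /\
    (forall delta r : R, 0 < delta -> delta < r ->
      (0 < ereal_inf (range (fun n => lower_mass delta r (Xs n))))%E) in
  (P1 <-> P2) /\
  ((forall n, heine_borel_class (Xs n)) -> (P1 <-> P3) /\ (P2 <-> P3)).
Proof.
move=> P1 P2 P3.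
have P12 : P1 <-> P2.
  split => [[vague lm]|[hb ghv]]; first exact: ghv_of_gromov_vague.
  exact: gromov_vague_of_ghv.
split => // hb; have P13 : P1 <-> P3.
  split => -[vague lm]; split => //; first exact: inf_mass_of_liminf.
  exact: liminf_mass_of_inf.
by split => //; split => [/P12/P13|/P13/P12].
Qed.
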